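(* Let $V$ be a vector superspace of dimension $n|m$. Then the space $\Lambda^{1|1}(V^* )$ of Voronov–Zorich $1|1$-forms on $V$ is isomorphic to the vector space of closed differential $1$-forms on the projective superspace $\mathbb{P}^{m-1|n}=P(\Pi V)$.
   Context: Let $V$ be a (real) vector superspace of dimension $n|m$, with a homogeneous basis indexed by $A\in\{1,\dots,n,\hat 1,\dots,\hat m\}$; $\tilde A=0$ for $A\in\{1,\dots,n\}$ and $\tilde A=1$ for $A\in\{\hat1,\dots,\hat m\}$. Components of vectors and functions are taken in the usual sense of supergeometry (coordinates on superspaces). Let $F,G$ range over $\{1,\hat 1\}$ with $\tilde 1=0$, $\tilde{\hat 1}=1$. A Voronov–Zorich $1|1$-form on $V$ is a smooth function $L=L(\dot x)$ of one even vector $\dot x_1$ and one odd vector $\dot x_{\hat 1}$ of $V$, with components $\dot x_F^A$ of parity $\tilde A+\tilde F$, defined for $\dot x_{\hat 1}$ non-degenerate (i.e. at least one of the even components $\dot x_{\hat 1}^{\hat 1},\dots,\dot x_{\hat 1}^{\hat m}$ is invertible), such that (BER) $L(g\cdot\dot x)=L(\dot x)\cdot\operatorname{Ber} g$ for all $g\in GL(1|1)$, where $\dot x$ is viewed as a matrix whose rows are $\dot x_1,\dot x_{\hat 1}$ and $\operatorname{Ber}$ is the Berezinian; (PDE) $\displaystyle\frac{\partial^2L}{\partial\dot x_F^A\,\partial\dot x_G^B}+(-1)^{\tilde F\tilde G+\tilde B(\tilde F+\tilde G)}\frac{\partial^2L}{\partial\dot x_G^A\,\partial\dot x_F^B}=0$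 for all $A,B,F,G$. The space of such functions is $\Lambda^{1|1}(V^* )$. $\Pi$ is parity reversion, so $\Pi V$ has dimension $m|n$. $P(\Pi V)=\mathbb{P}^{m-1|n}$ is the projectivization of $\Pi V$: homogeneous coordinates are $(w^{\hat 1}:\dots:w^{\hat m}:w^1:\dots:w^n)$, where $w^{\hat\mu}$ are even and $w^a$ are odd, covered by the charts in which one of the even homogeneous coordinates is invertible. Differential forms on a supermanifold are fiberwise polynomial functions of differentials of the coordinates, with the de Rham differential $d$ an odd operator; $1$-forms are those of degree one, and closed means annihilated by $d$. *)

(* Defs.v *)
From HB Require Import structures.
From mathcomp Require Import all_boot all_order all_algebra.
From mathcomp Require Import zify.

Set Implicit Arguments.
Unset Strict Implicit.
Unset Printing Implicit Defensive.

Import Order.TTheory GRing.Theory Num.Theory.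

Local Open Scope ring_scope.

(* The element [x] stands for \sum_I (x I) xi_I, where xi_I is the product of
   the odd generators xi_i, i \in I, taken in increasing order of i. *)
Definition grassmann (R : fieldType) (N : nat) := {ffun {set 'I_N} -> R}.

HB.instance Definition _ (R : fieldType) (N : nat) :=
  GRing.Lmodule.copy (grassmann R N) {ffun {set 'I_N} -> R^o}.

Section GrassmannRing.
Variables (R : fieldType) (N : nat).
Implicit Types (x y z : grassmann R N) (I J K : {set 'I_N}).

(* xi_I * xi_J = (-1) ^+ inversions I J * xi_(I :|: J) for disjoint I, J. *)
Definition inversions I J : nat := \sum_(i in I) \sum_(j in J) (j < i)%N.

Definition gr_one : grassmann R N := [ffun I => (I == set0)%:R].

Definition gr_mul x y : grassmann R N :=
  [ffun K : {set 'I_N} => \sum_(I : {set 'I_N} | I \subset K)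
     (-1) ^+ inversions I (K :\: I) * x I * y (K :\: I)].

Fact gr_mul1 : left_id gr_one gr_mul.
Proof.
move=> x; apply/ffunP => K; rewrite ffunE.
rewrite (bigD1 set0) ?sub0set //= big1 ?addr0.
  by rewrite ffunE eqxx setD0 /inversions big_set0 expr0 !mul1r.
by move=> I /andP[_ /negPf I0]; rewrite ffunE I0 mulr0 mul0r.
Qed.

Fact gr_mulr1 : right_id gr_one gr_mul.
Proof.
move=> x; apply/ffunP => K; rewrite ffunE.
rewrite (bigD1 K) ?subxx //= big1 ?addr0.
  rewrite ffunE setDv eqxx /inversions big1 ?expr0 ?mul1r ?mulr1 //.
  by move=> i _; rewrite big_set0.
move=> I /andP[IK neqIK]; rewrite ffunE setD_eq0.
case: (boolP (K \subset I)) => [KI|]; last by rewrite mulr0.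
by move/negP: neqIK; case; rewrite eqEsubset IK.
Qed.

Fact gr_mulDl : left_distributive gr_mul +%R.
Proof.
move=> x y z; apply/ffunP => K; rewrite !ffunE -big_split /=.
by apply: eq_bigr => I _; rewrite ffunE mulrDr mulrDl.
Qed.

Fact gr_mulDr : right_distributive gr_mul +%R.
Proof.
move=> x y z; apply/ffunP => K; rewrite !ffunE -big_split /=.
by apply: eq_bigr => I _; rewrite ffunE mulrDr.
Qed.

Lemma sum_setU I J (F : 'I_N -> nat) : [disjoint I & J] ->
  \sum_(i in I :|: J) F i = (\sum_(i in I) F i + \sum_(i in J) F i)%N.
Proof. by move=> dIJ; rewrite -bigU //; apply: eq_bigl => i; rewrite !inE. Qed.

Lemma inversionsUl I J K : [disjoint I & J] ->
  inversions (I :|: J) K = (inversions I K + inversions J K)%N.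
Proof. exact: sum_setU. Qed.

Lemma inversionsUr I J K : [disjoint J & K] ->
  inversions I (J :|: K) = (inversions I J + inversions I K)%N.
Proof.
move=> dJK; rewrite /inversions -big_split /=.
by apply: eq_bigr => i _; rewrite sum_setU.
Qed.

Fact gr_mulA : associative gr_mul.
Proof.
move=> x y z; apply/ffunP => K; rewrite !ffunE.
transitivity (\sum_(I : {set 'I_N} | I \subset K)
   \sum_(J : {set 'I_N} | (I \subset J) && (J \subset K))
     (-1) ^+ (inversions I (K :\: I) + inversions (J :\: I) (K :\: J))
       * x I * y (J :\: I) * z (K :\: J)).
  apply: eq_bigr => I IK; rewrite ffunE mulr_sumr.
  rewrite (reindex_onto (fun J => J :\: I) (fun J => I :|: J)) /=; last first.
    move=> J /subsetP JK; apply/setP => i; rewrite !inE.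
    case iI: (i \in I) => //=; apply/esym/negbTE/negP => /JK.
    by rewrite !inE iI.
  apply: eq_big => [J|J /andP[J1 /eqP J2]].
    apply/andP/andP => [[J1 /eqP J2]|[IJ JK]]; split.
    - by rewrite -J2 subsetUl.
    - rewrite -J2; apply/subsetP => i; rewrite !inE => /orP[iI|/andP[iI iJ]].
        exact: (subsetP IK).
      by have /(subsetP J1) : i \in J :\: I; rewrite !inE ?iI ?iJ // => /andP[].
    - exact: setSD.
    - by apply/eqP/setP => i; rewrite !inE; case: (boolP (i \in I)) => //= /(subsetP IJ).
  have -> : K :\: I :\: (J :\: I) = K :\: J.
    apply/setP => i; rewrite !inE -J2 !inE.
    by case: (i \in I); case: (i \in J); case: (i \in K).
  rewrite exprD; set a := x I; set b := y _; set c := z _.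
  by rewrite !mulrA; congr (_ * b * c); rewrite -!mulrA; congr (_ * _); rewrite mulrC.
rewrite (exchange_big_dep (fun J : {set 'I_N} => J \subset K)) /=; last first.
  by move=> I J _ /andP[].
apply: eq_bigr => J JK; rewrite ffunE mulr_sumr mulr_suml.
apply: eq_big => [I|I /andP[IK /andP[IJ _]]].
  rewrite JK andbT; case: (boolP (I \subset J)) => [IJ|]; last by rewrite andbF.
  by rewrite (subset_trans IJ JK).
have eK : K :\: I = (J :\: I) :|: (K :\: J).
  apply/setP => i; rewrite !inE; move/subsetP/(_ i): IJ.
  move/subsetP/(_ i): JK.
  case: (i \in I); case: (i \in J); case: (i \in K) => //=.
  - by move=> _ /(_ isT).
  - by move=> /(_ isT).
have eJ : J = I :|: (J :\: I) by rewrite setDE setUIr setUCr setIT; apply/esym/setUidPr.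
have d1 : [disjoint J :\: I & K :\: J].
  by rewrite -setI_eq0; apply/eqP/setP => i; rewrite !inE; case: (i \in J); rewrite ?andbF.
have d2 : [disjoint I & J :\: I].
  by rewrite -setI_eq0; apply/eqP/setP => i; rewrite !inE; case: (i \in I).
rewrite !mulrA; congr (_ * _ * _ * _); rewrite -exprD; congr (_ ^+ _).
have -> : inversions J (K :\: J)
          = (inversions I (K :\: J) + inversions (J :\: I) (K :\: J))%N.
  by rewrite {1}eJ inversionsUl.
by rewrite eK inversionsUr //; lia.
Qed.

Fact gr_oner_neq0 : gr_one != 0.
Proof.
apply/eqP => /ffunP /(_ set0); rewrite !ffunE eqxx => /eqP.
by rewrite oner_eq0.
Qed.

HB.instance Definition _ := GRing.Zmodule_isNzRing.Build (grassmann R N)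
  gr_mulA gr_mul1 gr_mulr1 gr_mulDl gr_mulDr gr_oner_neq0.

Lemma gr_mulE x y : x * y = gr_mul x y. Proof. by []. Qed.

Lemma gr_oneE : 1 = gr_one :> grassmann R N. Proof. by []. Qed.

Lemma gr_scaleE (a : R) x I : (a *: x) I = a * x I.
Proof. by rewrite ffunE. Qed.

Fact gr_scalerAl (a : R) x y : a *: (x * y) = a *: x * y.
Proof.
apply/ffunP => K; rewrite gr_scaleE !gr_mulE !ffunE mulr_sumr.
by apply: eq_bigr => I _; rewrite gr_scaleE !mulrA (mulrC a).
Qed.

HB.instance Definition _ :=
  GRing.Lmodule_isLalgebra.Build R (grassmann R N) gr_scalerAl.

Fact gr_scalerAr (a : R) x y : a *: (x * y) = x * (a *: y).
Proof.
apply/ffunP => K; rewrite gr_scaleE !gr_mulE !ffunE mulr_sumr.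
by apply: eq_bigr => I _; rewrite gr_scaleE mulrCA.
Qed.

HB.instance Definition _ :=
  GRing.Lalgebra_isAlgebra.Build R (grassmann R N) gr_scalerAr.

Definition gr_body x : R := x set0.

Lemma gr_bodyM x y : gr_body (x * y) = gr_body x * gr_body y.
Proof.
rewrite /gr_body gr_mulE ffunE (big_pred1 set0) => [|I]; last exact: subset0.
by rewrite setD0 /inversions big_set0 expr0 mul1r.
Qed.

Lemma gr_body1 : gr_body 1 = 1.
Proof. by rewrite /gr_body gr_oneE ffunE eqxx. Qed.

Definition gr_order_ge k x := forall I, (#|I| < k)%N -> x I = 0.

Lemma gr_order_geM k l x y :
  gr_order_ge k x -> gr_order_ge l y -> gr_order_ge (k + l) (x * y).
Proof.
move=> xk yl K ltK; rewrite gr_mulE ffunE big1 // => I IK.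
have [ltI|leI] := ltnP #|I| k; first by rewrite xk // mulr0 mul0r.
rewrite yl ?mulr0 //; move: ltK; rewrite -(cardsID I K) (setIidPr IK).
by move: leI; lia.
Qed.

Lemma gr_nilpotent x : gr_body x = 0 -> x ^+ N.+1 = 0.
Proof.
move=> x0; have H k : gr_order_ge k (x ^+ k).
  elim: k => [|k IH]; first by move=> I; rewrite ltn0.
  rewrite exprS -[k.+1]add1n; apply: gr_order_geM => // I.
  by rewrite ltnS leqn0 cards_eq0 => /eqP ->.
apply/ffunP => I; rewrite H ?ffunE //.
by rewrite ltnS (leq_trans (max_card _)) // card_ord.
Qed.

Definition gr_unit : pred (grassmann R N) := fun x => gr_body x != 0.

(* The geometric series, which terminates because soul elements are nilpotent. *)
Definition gr_inv x : grassmann R N :=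
  if gr_unit x then
    (gr_body x)^-1 *: \sum_(k < N.+1) (1 - (gr_body x)^-1 *: x) ^+ k
  else x.

Lemma gr_geom (y : grassmann R N) : gr_body y = 0 ->
  (1 - y) * (\sum_(k < N.+1) y ^+ k) = 1
  /\ (\sum_(k < N.+1) y ^+ k) * (1 - y) = 1.
Proof.
move=> y0; have H : (1 - y) * (\sum_(k < N.+1) y ^+ k) = 1.
  by rewrite -opprB mulNr -subrX1 gr_nilpotent // sub0r opprK.
split=> //; rewrite -[RHS]H mulrBl mulrBr mul1r mulr1; congr (_ - _).
by rewrite mulr_suml mulr_sumr; apply: eq_bigr => k _; rewrite -exprS -exprSr.
Qed.

Lemma gr_body_sub1 x : gr_unit x -> gr_body (1 - (gr_body x)^-1 *: x) = 0.
Proof.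
move=> ux; have := gr_body1.
rewrite {2}/gr_body ffunE [(- _ : grassmann R N) _]ffunE.
by rewrite gr_scaleE /gr_body => ->; rewrite mulVf // subrr.
Qed.

Lemma gr_scaleK x : gr_unit x ->
  x = gr_body x *: (1 - (1 - (gr_body x)^-1 *: x)).
Proof. by move=> ux; rewrite subKr scalerA mulfV // scale1r. Qed.

Fact gr_mulVr : {in gr_unit, left_inverse 1 gr_inv *%R}.
Proof.
move=> x ux; rewrite /gr_inv ifT // {4}(gr_scaleK ux).
rewrite -scalerAr -scalerAl scalerA mulfV // scale1r.
by case: (gr_geom (gr_body_sub1 ux)).
Qed.

Fact gr_mulrV : {in gr_unit, right_inverse 1 gr_inv *%R}.
Proof.
move=> x ux; rewrite /gr_inv ifT // {1}(gr_scaleK ux).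
rewrite -scalerAr -scalerAl scalerA mulVf // scale1r.
by case: (gr_geom (gr_body_sub1 ux)).
Qed.

Fact gr_unitP x y : y * x = 1 /\ x * y = 1 -> gr_unit x.
Proof.
case=> yx _; apply/eqP => x0; move: (gr_bodyM y x).
by rewrite yx gr_body1 x0 mulr0 => /eqP; rewrite oner_eq0.
Qed.

Fact gr_inv_out : {in [predC gr_unit], gr_inv =1 id}.
Proof. by move=> x /negPf ux; rewrite /gr_inv ifF. Qed.

HB.instance Definition _ := GRing.NzRing_hasMulInverse.Build (grassmann R N)
  gr_mulVr gr_mulrV gr_unitP gr_inv_out.

Definition gr_gen (i : 'I_N) : grassmann R N := [ffun I => (I == [set i])%:R].

Definition gr_parity (b : bool) x := forall I, x I != 0 -> odd #|I| = b.

End GrassmannRing.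

(* Imported only here, since classical_sets shadows the names of finset. *)
From mathcomp Require Import all_classical all_reals all_analysis.
Import numFieldNormedType.Exports.
Local Open Scope classical_set_scope.
Local Open Scope ring_scope.

(* [f x I] is the coefficient of xi_I at the point x of the body R^p. *)
Definition superfun (R : realType) (p q : nat) := 'rV[R]_p -> grassmann R q.

Section Superfunctions.
Variable R : realType.

Definition pderiv p (i : 'I_p) (h : 'rV[R]_p -> R) : 'rV[R]_p -> R :=
  fun x => 'D_(delta_mx 0 i) h x.

Fixpoint Ck (k : nat) p (U : set 'rV[R]_p) (h : 'rV[R]_p -> R) : Prop :=
  (forall x, U x -> {for x, continuous h}) /\
  if k is k'.+1 then
    forall i : 'I_p, (forall x, U x -> derivable h x (delta_mx 0 i)) /\
                     Ck k' U (pderiv i h)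
  else True.

(* Meant for open U. *)
Definition smooth p q (U : set 'rV[R]_p) (f : superfun R p q) : Prop :=
  forall (I : {set 'I_q}) (k : nat), Ck k U (fun x => f x I).

Definition superfun_parity p q (b : bool) (f : superfun R p q) : Prop :=
  forall x, gr_parity b (f x).

(* The left derivative with respect to xi_j. *)
Definition gr_deriv q (j : 'I_q) (c : grassmann R q) : grassmann R q :=
  [ffun I : {set 'I_q} => if j \in I then 0 else
     (-1) ^+ #|[set i in I | (i < j)%N]%SET| * c (j |: I)%SET].

(* Coordinates of R^{p|q} are indexed by 'I_p + 'I_q, even ones first. *)
Definition sderiv p q (c : 'I_p + 'I_q) (f : superfun R p q) : superfun R p q :=
  match c with
  | inl i => fun x => [ffun I => pderiv i (fun y => f y I) x]
  | inr j => fun x => gr_deriv j (f x)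
  end.

(* Value of a function of even variables at z = body + soul, given by its
   Taylor expansion at the body; the souls are nilpotent, so the terms of degree
   greater than N vanish. *)
Definition gr_taylor p N (h : 'rV[R]_p -> R) (z : 'I_p -> grassmann R N) :
    grassmann R N :=
  let x := \row_i gr_body (z i) in
  \sum_(k < N.+1) \sum_(t : k.-tuple 'I_p)
    ((k`!)%:R^-1 * foldr (@pderiv p) h t x) *:
      \prod_(i <- t) (z i - (gr_body (z i))%:A).

(* Value of f at a Grassmann-valued point z of R^{p|q}; the even (odd)
   coordinates of z are assumed to be even (odd) elements. *)
Definition gr_eval p q N (f : superfun R p q)
    (z : 'I_p + 'I_q -> grassmann R N) : grassmann R N :=
  \sum_(I : {set 'I_q})
    gr_taylor (fun x => f x I) (fun i => z (inl i)) *
      \prod_(j in I) z (inr j).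

End Superfunctions.

(* V = R^{n|m}.  An index A : 'I_(n + m) is even if it comes from 'I_n and odd if it comes
   from 'I_m; in F : 'I_2, the values 0 and 1 stand for 1 and \hat 1.  The
   superdomain of pairs of an even and an odd vector is R^{n+m|m+n}, with even
   coordinates (x_1^a, x_{\hat 1}^{\hat mu}) and odd coordinates
   (x_1^{\hat mu}, x_{\hat 1}^a). *)
Section VoronovZorich.
Variables (R : realType) (n m : nat).

Definition idx_parity (A : 'I_(n + m)) : bool :=
  if fintype.split A is inr _ then true else false.

Definition frame_coord (F : 'I_2) (A : 'I_(n + m)) : 'I_(n + m) + 'I_(m + n) :=
  match fintype.split A with
  | inl a => if F == 0 then inl (lshift m a) else inr (rshift m a)
  | inr mu => if F == 0 then inr (lshift n mu) else inl (rshift n mu)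
  end.

(* The point of R^{n+m|m+n} whose coordinates are the entries of X. *)
Definition frame_point N (X : 'M[grassmann R N]_(2, n + m))
    (c : 'I_(n + m) + 'I_(m + n)) : grassmann R N :=
  match c with
  | inl k => match fintype.split k with
             | inl a => X 0 (lshift m a)
             | inr mu => X 1 (rshift n mu)
             end
  | inr k => match fintype.split k with
             | inl mu => X 0 (rshift n mu)
             | inr a => X 1 (lshift m a)
             end
  end.

Lemma frame_pointE N (X : 'M[grassmann R N]_(2, n + m)) F A :
  frame_point X (frame_coord F A) = X F A.
Proof.
rewrite /frame_coord /frame_point.
have F1 : F != 0 -> F = 1 by case: F => [[|[|k]] lt] // _; apply: val_inj.
case: splitP => [a eA|mu eA].
  have -> : A = lshift m a by apply: val_inj.
  case: eqVneq => [->|/F1 ->].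
    by rewrite (unsplitK (inl _ a)).
  by rewrite (unsplitK (inr _ a)).
have -> : A = rshift n mu by apply: val_inj.
case: eqVneq => [->|/F1 ->].
  by rewrite (unsplitK (inl _ mu)).
by rewrite (unsplitK (inr _ mu)).
Qed.

Definition nondegenerate_frames : set 'rV[R]_(n + m) :=
  [set x | exists mu : 'I_m, x 0 (rshift n mu) != 0].

(* Grassmann-valued points of the superdomain over [nondegenerate_frames]. *)
Definition is_frame N (X : 'M[grassmann R N]_(2, n + m)) : Prop :=
  (forall (F : 'I_2) A, gr_parity (odd F (+) idx_parity A) (X F A)) /\
  exists mu : 'I_m, X 1 (rshift n mu) \is a GRing.unit.

Definition GL11 N (g : 'M[grassmann R N]_2) : Prop :=
  (forall F G : 'I_2, gr_parity (odd F (+) odd G) (g F G)) /\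
  exists h : 'M[grassmann R N]_2, g *m h = 1%:M /\ h *m g = 1%:M.

Definition Ber N (g : 'M[grassmann R N]_2) : grassmann R N :=
  (g 0 0 - g 0 1 * (g 1 1)^-1 * g 1 0) * (g 1 1)^-1.

(* The identity between functions on GL(1|1) x {nondegenerate frames}, tested
   on points with values in all finite-dimensional Grassmann algebras. *)
Definition BER (L : superfun R (n + m) (m + n)) : Prop :=
  forall (N : nat) (g : 'M[grassmann R N]_2) (X : 'M[grassmann R N]_(2, n + m)),
    GL11 g -> is_frame X ->
    gr_eval L (frame_point (g *m X)) = gr_eval L (frame_point X) * Ber g.

Definition PDE (L : superfun R (n + m) (m + n)) : Prop :=
  forall (A B : 'I_(n + m)) (F G : 'I_2) x, nondegenerate_frames x ->
    sderiv (frame_coord F A) (sderiv (frame_coord G B) L) x +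
    (-1) ^+ (F * G + idx_parity B * (F + G))%N *:
      sderiv (frame_coord G A) (sderiv (frame_coord F B) L) x = 0.

(* A function on the nondegenerate frames is represented by its extension by 0. *)
Definition VZ_form : set (superfun R (n + m) (m + n)) :=
  [set L | [/\ smooth nondegenerate_frames L,
               forall x, ~ nondegenerate_frames x -> L x = 0,
               BER L & PDE L]].

End VoronovZorich.

(* Forms are superfunctions on R^{p+q|q+p} with even coordinates (x, d xi) and
   odd coordinates (xi, dx). *)
Section DifferentialForms.
Variable R : realType.

Definition base_coord p q (c : 'I_p + 'I_q) : 'I_(p + q) + 'I_(q + p) :=
  match c with
  | inl i => inl (lshift q i)
  | inr j => inr (lshift p j)
  end.

Definition base_fun p q (f : superfun R p q) : superfun R (p + q) (q + p) :=
  fun y => \sum_(J : {set 'I_q})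
    f (lsubmx y) J *: \prod_(j in J) gr_gen R (lshift p j).

Definition dcoord p q (c : 'I_p + 'I_q) : superfun R (p + q) (q + p) :=
  match c with
  | inl i => fun=> gr_gen R (rshift q i)
  | inr j => fun y => (y 0 (rshift p j))%:A
  end.

Definition deRham p q (w : superfun R (p + q) (q + p)) :
    superfun R (p + q) (q + p) :=
  fun y => \sum_(c : 'I_p + 'I_q) dcoord c y * sderiv (base_coord c) w y.

Definition one_form p q (w : superfun R (p + q) (q + p)) : Prop :=
  exists a : 'I_p + 'I_q -> superfun R p q,
    (forall c, smooth setT (a c)) /\
    forall y, w y = \sum_(c : 'I_p + 'I_q) dcoord c y * base_fun (a c) y.

(* The morphism phi, given by its coordinate functions, acts on the
   differentials of the coordinates by d(phi^c). *)
Definition tangent_point p q p' q' (phi : 'I_p' + 'I_q' -> superfun R p q)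
    (y : 'rV[R]_(p + q)) (c : 'I_(p' + q') + 'I_(q' + p')) :
    grassmann R (q + p) :=
  match c with
  | inl k => match fintype.split k with
             | inl i => base_fun (phi (inl i)) y
             | inr j => deRham (base_fun (phi (inr j))) y
             end
  | inr k => match fintype.split k with
             | inl j => base_fun (phi (inr j)) y
             | inr i => deRham (base_fun (phi (inl i))) y
             end
  end.

Definition pullback p q p' q' (phi : 'I_p' + 'I_q' -> superfun R p q)
    (w : superfun R (p' + q') (q' + p')) : superfun R (p + q) (q + p) :=
  fun y => gr_eval w (tangent_point phi y).

End DifferentialForms.

Section Projective.
Variables (R : realType) (n m : nat).

(* The chart mu : 'I_m is R^{m-1|n}, with coordinates u^k = w^(lift mu k) / w^mu
   and eta^a = w^a / w^mu.  [homog mu u] is the even part of the homogeneous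
   coordinates normalised by w^mu = 1. *)
Definition homog (mu : 'I_m) (u : 'rV[R]_m.-1) (nu : 'I_m) : R :=
  if unlift mu nu is Some k then u 0 k else 1.

(* The change of coordinates from chart mu to chart nu, defined where
   [homog mu u nu != 0]. *)
Definition transition (mu nu : 'I_m) (c : 'I_m.-1 + 'I_n) :
    superfun R m.-1 n :=
  match c with
  | inl k => fun u => (homog mu u (lift nu k) / homog mu u nu)%:A
  | inr a => fun u => (homog mu u nu)^-1 *: gr_gen R a
  end.

Definition proj_forms := 'I_m -> superfun R (m.-1 + n) (n + m.-1).

Definition glues (w : proj_forms) : Prop :=
  forall mu nu y, homog mu (lsubmx y) nu != 0 ->
    w mu y = pullback (transition mu nu) (w nu) y.

Definition proj_one_form : set proj_forms :=
  [set w | (forall mu, one_form (w mu)) /\ glues w].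

Definition proj_closed_one_form : set proj_forms :=
  [set w | proj_one_form w /\ forall mu y, deRham (w mu) y = 0].

Definition proj_forms_parity (b : bool) (w : proj_forms) : Prop :=
  forall mu, superfun_parity b (w mu).

End Projective.

(* A and B are linear subspaces of E and F, graded by parE and parF. *)
Definition super_isomorphic (R : realType) (E F : lmodType R)
    (parE : bool -> E -> Prop) (parF : bool -> F -> Prop)
    (A : set E) (B : set F) : Prop :=
  exists Phi : E -> F,
    [/\ forall (a : R) u v, A u -> A v ->
          Phi (a *: u + v) = a *: Phi u + Phi v,
        set_bij A B Phi
      & forall b u, A u -> parE b u -> parF b (Phi u)].

(* Main.v *)
Require Import Defs.
From HB Require Import structures.
From mathcomp Require Import all_boot all_order all_algebra.

Set Implicit Arguments.
Unset Strict Implicit.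
Unset Printing Implicit Defensive.

Import Order.TTheory GRing.Theory Num.Theory.

Local Open Scope ring_scope.

(** Write [w] for the odd row and [x] for the even row of a frame.  Since
    parities are reversed, [w] is a vector of homogeneous coordinates on P(Pi
    V), and [x] has the parities of the differential of [w].  Over the chart
    [mu] of P(Pi V), the pair of a point and its differential is the normalised
    frame [chart_frame], with w = (1 : u : eta) and x = (0 : du : d eta), and
    the isomorphism [Phi] restricts a function of frames to the normalised
    frames.

    Condition BER then says exactly that the restrictions form a closed
    one-form, one property for each kind of element of GL(1|1).

    - The element diag(t, 1) multiplies [x] and [L] by [t].  As [L] is smooth at
      [x = 0], a function of degree one in [x] is linear in [x] ([homog_limit],
      [dx_const], [BER_euler]), so that [Phi L] is a one-form ([Phi_one_form]).
    - The lower unitriangular element with odd entry [rho] replaces [w] by [w +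
      rho x], which is the flow of the de Rham vector field, and its Berezinian
      is 1.  Hence the differential of [Phi L] is zero ([Phi_closed]).
    - An upper triangular element [norm_mx] of Berezinian 1 normalises any frame
      for which w^mu is invertible.  By the quotient rule, normalising the pair
      (w, dw) is the change of chart together with its tangent map
      ([tangent_psi]); so the restrictions glue ([Phi_glues]), and they
      determine [L] ([BER_psi], [Phi_inj]).

    Conversely, a closed one-form is pulled back along the normalisation of
    frames ([lift_form]).  A frame is [h X0] with [X0] normalised and [h] upper
    triangular, and normalising [g h X0] moves the base point of [X0] by [rho]
    times its differential and multiplies the differentials by [Ber g].
    Linearity in the differentials and closedness give BER ([BER_lift_form]);
    gluing makes the pullbacks from two charts agree ([lift_form_overlap]).

    The differential equations follow from BER ([BER_imp_PDE]): linearity in [x]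
    is the equation for two derivatives along [x], and the mixed equation comes
    from differentiating twice along [x] the identity expressing closedness
    ([BER_D]).

    All this happens at points with values in Grassmann algebras, where a smooth
    function is evaluated by its Taylor series.  The only analytic fact needed
    is that the expansion to first order is exact for increments whose pairwise
    products vanish ([gr_taylor_shift]).  A nilpotent part is a sum of
    square-zero increments, so algebraic identities extend from real points
    ([soul_ind]): evaluation is a morphism of algebras, compatible with
    composition ([gr_evalM], [gr_eval_scomp]) and with odd vector fields
    ([gr_eval_shift]).  Identities between functions are recovered at the
    generic point, whose odd coordinates are the generators
    ([gr_eval_gen_point]), extra generators playing the role of odd parameters
    ([extra1_inj], [extra2_inj]). *)

(** * Grassmann algebras *)

Section Supercommutativity.
Variables (R : fieldType) (N : nat).
Implicit Types (x y z : grassmann R N) (I J K : {set 'I_N}).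

Lemma gr_mul_coef x y K : (x * y) K =
  \sum_(I : {set 'I_N} | I \subset K)
     (-1) ^+ inversions I (K :\: I) * x I * y (K :\: I).
Proof. by rewrite gr_mulE ffunE. Qed.

(** For i in I and j in J, exactly one of the pairs (i, j) and (j, i) is an
    inversion. *)
Lemma inversionsC I J : [disjoint I & J] ->
  (inversions J I + inversions I J)%N = (#|I| * #|J|)%N.
Proof.
move=> dIJ; rewrite /inversions exchange_big -big_split /= -sum_nat_const.
apply: eq_bigr => i iI; rewrite -big_split /= -sum1_card.
apply: eq_bigr => j jJ; case: (ltngtP i j) => // /val_inj eij.
by move: (disjointFr dIJ iI); rewrite eij jJ.
Qed.

Lemma gr_mul_coefC x y K : (y * x) K =
  \sum_(I : {set 'I_N} | I \subset K)
     (-1) ^+ (inversions I (K :\: I) + #|I| * #|K :\: I|)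
       * x I * y (K :\: I).
Proof.
rewrite gr_mul_coef (reindex_onto (fun I => K :\: I) (fun I => K :\: I)) /=;
  last by move=> I /setIidPr IK; rewrite setDDr setDv set0U.
apply: eq_big => [I|I /andP[_ /eqP KI]].
  rewrite subsetDl /=; apply/eqP/idP => [<-|/setIidPr IK].
    exact: subsetDl.
  by rewrite setDDr setDv set0U.
rewrite KI mulrAC; congr (_ * _ * _).
have d : [disjoint I & K :\: I].
  by rewrite -setI_eq0 setIDA setDIl setDv set0I.
by rewrite -(inversionsC d) addnCA addnn exprD -[X in _ * X]signr_odd odd_double mulr1.
Qed.

Lemma gr_even_comm x y : gr_parity false x -> x * y = y * x.
Proof.
move=> xe; apply/ffunP => K; rewrite gr_mul_coef gr_mul_coefC.
apply: eq_bigr => I _; have [->|/xe oI] := eqVneq (x I) 0.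
  by rewrite !mulr0 !mul0r.
by rewrite exprD -[X in _ * X * _ * _]signr_odd oddM oI expr0 mulr1.
Qed.

Lemma gr_odd_anticomm x y :
  gr_parity true x -> gr_parity true y -> x * y = - (y * x).
Proof.
move=> xo yo; apply/ffunP => K; rewrite [RHS]ffunE gr_mul_coef gr_mul_coefC.
rewrite -sumrN; apply: eq_bigr => I _.
have [->|/xo oI] := eqVneq (x I) 0; first by rewrite !(mulr0, mul0r) oppr0.
have [->|/yo oJ] := eqVneq (y (K :\: I)) 0; first by rewrite !mulr0 oppr0.
by rewrite exprD -[X in _ * X * _ * _]signr_odd oddM oI oJ expr1 mulrN1 !mulNr opprK.
Qed.

Lemma gr_parity0 b : gr_parity b (0 : grassmann R N).
Proof. by move=> I; rewrite ffunE eqxx. Qed.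

Lemma gr_parity1 : gr_parity false (1 : grassmann R N).
Proof.
move=> I; rewrite gr_oneE ffunE; case: (eqVneq I) => [->|]; last by rewrite eqxx.
by rewrite cards0.
Qed.

Lemma gr_parityD b x y : gr_parity b x -> gr_parity b y -> gr_parity b (x + y).
Proof.
move=> xb yb I; rewrite ffunE.
have [->|/xb] := eqVneq (x I) 0; last by [].
by rewrite add0r => /yb.
Qed.

Lemma gr_parityZ b (a : R) x : gr_parity b x -> gr_parity b (a *: x).
Proof. by move=> xb I; rewrite gr_scaleE mulf_eq0 negb_or => /andP[_ /xb]. Qed.

Lemma gr_parityN b x : gr_parity b x -> gr_parity b (- x).
Proof. by move=> xb; rewrite -scaleN1r; apply: gr_parityZ. Qed.

Lemma gr_parityB b x y : gr_parity b x -> gr_parity b y -> gr_parity b (x - y).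
Proof. by move=> xb yb; apply/gr_parityD/gr_parityN. Qed.

Lemma gr_parityM b c x y :
  gr_parity b x -> gr_parity c y -> gr_parity (b (+) c) (x * y).
Proof.
move=> xb yc K; rewrite gr_mul_coef => nz.
have [I IK] : exists2 I : {set 'I_N}, I \subset K &
    (-1) ^+ inversions I (K :\: I) * x I * y (K :\: I) != 0.
  apply/exists_inP; apply: contraNT nz => /exists_inPn /= H.
  by rewrite big1 // => I /H; rewrite negbK => /eqP.
rewrite !mulf_eq0 !negb_or -!andbA => /and3P[_ /xb <- /yc <-].
by rewrite -(cardsID I K) (setIidPr IK) oddD.
Qed.

Lemma gr_parity_sum b (T : Type) (r : seq T) (P : pred T) (F : T -> grassmann R N) :
  (forall i, P i -> gr_parity b (F i)) -> gr_parity b (\sum_(i <- r | P i) F i).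
Proof.
move=> H; apply: (big_ind (gr_parity b)) => //.
- exact: gr_parity0.
- by move=> x y; apply: gr_parityD.
Qed.

Lemma gr_parity_prod (T : Type) (r : seq T) (F : T -> grassmann R N) :
  (forall i, gr_parity true (F i)) ->
  gr_parity (odd (size r)) (\prod_(i <- r) F i).
Proof.
move=> H; elim: r => [|i r IH]; first by rewrite big_nil; apply: gr_parity1.
by rewrite big_cons /= -addTb; apply: gr_parityM.
Qed.

Lemma gr_parity_prod_even (T : Type) (r : seq T) (P : pred T) (F : T -> grassmann R N) :
  (forall i, P i -> gr_parity false (F i)) ->
  gr_parity false (\prod_(i <- r | P i) F i).
Proof.
move=> H; apply: (big_ind (gr_parity false)) => //.
- exact: gr_parity1.
- by move=> x y xe ye; rewrite -[false]/(false (+) false); apply: gr_parityM.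
Qed.

Lemma gr_parity_alg (a : R) : gr_parity false (a%:A : grassmann R N).
Proof. exact/gr_parityZ/gr_parity1. Qed.

Lemma gr_parity_gen (i : 'I_N) : gr_parity true (gr_gen R i).
Proof.
move=> I; rewrite ffunE; case: (eqVneq I) => [->|]; last by rewrite eqxx.
by rewrite cards1.
Qed.

Lemma gr_algM (a : R) x : a%:A * x = a *: x.
Proof. by rewrite -scalerAl mul1r. Qed.

Lemma gr_Malg (a : R) x : x * a%:A = a *: x.
Proof. by rewrite -scalerAr mulr1. Qed.

Lemma gr_unitE x : (x \is a GRing.unit) = (gr_body x != 0).
Proof. by []. Qed.

Lemma gr_bodyD x y : gr_body (x + y) = gr_body x + gr_body y.
Proof. by rewrite /gr_body ffunE. Qed.

Lemma gr_body0 : gr_body (0 : grassmann R N) = 0.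
Proof. by rewrite /gr_body ffunE. Qed.

Lemma gr_bodyZ (a : R) x : gr_body (a *: x) = a * gr_body x.
Proof. by rewrite /gr_body gr_scaleE. Qed.

Lemma gr_bodyN x : gr_body (- x) = - gr_body x.
Proof. by rewrite -scaleN1r gr_bodyZ mulN1r. Qed.

Lemma gr_bodyB x y : gr_body (x - y) = gr_body x - gr_body y.
Proof. by rewrite gr_bodyD gr_bodyN. Qed.

Lemma gr_body_alg (a : R) : gr_body (a%:A : grassmann R N) = a.
Proof. by rewrite gr_bodyZ gr_body1 mulr1. Qed.

Lemma gr_bodyV x : gr_body x^-1 = (gr_body x)^-1.
Proof.
have [ux|nux] := boolP (x \is a GRing.unit); last first.
  rewrite invr_out //; move: nux; rewrite gr_unitE negbK => /eqP ->.
  by rewrite invr0.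
have bx : gr_body x != 0 by rewrite -gr_unitE.
by apply: (mulIf bx); rewrite -gr_bodyM mulVr // mulVf // gr_body1.
Qed.

Lemma gr_body_odd x : gr_parity true x -> gr_body x = 0.
Proof.
move=> xo; apply/eqP; apply: contraT => /xo.
by rewrite cards0.
Qed.

Lemma gr_body_sum (T : Type) (r : seq T) (P : pred T) (F : T -> grassmann R N) :
  gr_body (\sum_(i <- r | P i) F i) = \sum_(i <- r | P i) gr_body (F i).
Proof. exact: (big_morph _ gr_bodyD gr_body0). Qed.

Lemma gr_parityV x : gr_parity false x -> gr_parity false x^-1.
Proof.
move=> xe; rewrite /GRing.inv /= /gr_inv; case: ifP => // _.
apply: gr_parityZ; apply: gr_parity_sum => k _.
elim: (val k) => [|j IH]; first by rewrite expr0; apply: gr_parity1.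
rewrite exprS -[false]/(false (+) false); apply: gr_parityM => //.
by apply: gr_parityB; [exact: gr_parity1 | exact: gr_parityZ].
Qed.

End Supercommutativity.

Section Generators.
Variables (R : fieldType).

Lemma gr_gen_mul N (i : 'I_N) (y : grassmann R N) (K : {set 'I_N}) :
  (gr_gen R i * y) K = if i \in K
    then (-1) ^+ #|[set k in K | (k < i)%N]| * y (K :\ i) else 0.
Proof.
rewrite gr_mul_coef; case: ifP => iK; last first.
  rewrite big1 // => I IK; rewrite ffunE; case: eqVneq => [eI|].
    by move: IK; rewrite eI sub1set iK.
  by rewrite mulr0 mul0r.
rewrite (bigD1 [set i]) ?sub1set //= [X in _ + X]big1 ?addr0; last first.
  by move=> I /andP[_ /negPf nI]; rewrite ffunE nI mulr0 mul0r.
rewrite ffunE eqxx mulr1; congr (_ ^+ _ * _).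
rewrite /inversions big_set1 -sum1_card [RHS]big_mkcond [LHS]big_mkcond /=.
apply: eq_bigr => k _; rewrite !inE; case: eqVneq => [->|_] /=.
  by rewrite ltnn andbF.
by case: (k \in K); case: (k < i)%N.
Qed.

Definition gr_mono N (I : {set 'I_N}) : grassmann R N := [ffun K => (K == I)%:R].

Lemma gr_mono_basis N (x : grassmann R N) : x = \sum_I x I *: gr_mono I.
Proof.
apply/ffunP => K; rewrite sum_ffunE (bigD1 K) //= big1 ?addr0.
  by rewrite gr_scaleE ffunE eqxx mulr1.
by move=> I /negPf nI; rewrite gr_scaleE ffunE eq_sym nI mulr0.
Qed.

Definition oprod N N' (z : 'I_N -> grassmann R N') (s : seq 'I_N) :=
  \prod_(j <- s) z j.

(** Left multiplication by a generator smaller than all the others produces no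
    sign. *)
Lemma oprod_mono N (s : seq 'I_N) : sorted ltn (map val s) ->
  oprod (@gr_gen R N) s = gr_mono [set j in s].
Proof.
rewrite /oprod; elim: s => [|i s IH] /= ss.
  rewrite big_nil; apply/ffunP => K; rewrite gr_oneE !ffunE.
  by congr ((K == _)%:R); apply/setP => j; rewrite !inE.
rewrite big_cons IH ?(path_sorted ss) //; apply/ffunP => K; rewrite gr_gen_mul.
have lti : forall k, k \in s -> (i < k)%N.
  move=> k ks; move: ss; rewrite path_sortedE; last exact: ltn_trans.
  by case/andP => /allP /(_ (val k)) H _; apply: H; apply: map_f.
have nis : i \notin s by apply/negP => /lti; rewrite ltnn.
rewrite !ffunE; case: ifP => [iK|niK]; last first.
  by case: eqVneq => // eK; move: niK; rewrite eK !inE eqxx.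
have -> : (K :\ i == [set j in s]) = (K == [set j in i :: s]).
  apply/eqP/eqP => [eK|->].
    apply/setP => j; move/setP/(_ j): eK; rewrite !inE.
    by case: eqVneq => [->|] //=.
  apply/setP => j; rewrite !inE; case: eqVneq => //= ->.
  by rewrite (negPf nis).
case: eqVneq => [eK|]; last by rewrite mulr0.
rewrite (_ : [set k in K | (k < i)%N] = set0) ?cards0 ?mul1r //.
apply/setP => k; rewrite eK !inE; apply/negbTE/negP => /andP[/orP[/eqP->|/lti]].
  by rewrite ltnn.
by move=> ik /(ltn_trans ik); rewrite ltnn.
Qed.

Lemma sorted_enum_ord N (I : {set 'I_N}) : sorted ltn (map val (enum I)).
Proof.
apply: (@subseq_sorted _ ltn ltn_trans _ (map val (enum 'I_N))).
  by apply: map_subseq; rewrite enumT filter_subseq.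
by rewrite val_enum_ord iota_ltn_sorted.
Qed.

Lemma oprod_enum N N' (z : 'I_N -> grassmann R N') (I : {set 'I_N}) :
  \prod_(j in I) z j = oprod z (enum I).
Proof. by rewrite /oprod [in RHS]/enum_mem big_filter [index_enum _]unlock. Qed.

Lemma gr_monoE N (I : {set 'I_N}) : gr_mono I = \prod_(j in I) gr_gen R j.
Proof.
rewrite oprod_enum oprod_mono ?sorted_enum_ord //.
by congr gr_mono; apply/setP => j; rewrite inE mem_enum.
Qed.

(** Monomials are iterated products of generators, so identities between linear
    maps on a Grassmann algebra need only be checked on 1 and on left multiples
    by a generator. *)
Lemma gr_ind N (P : grassmann R N -> Prop) :
  P 1 -> (forall i x, P x -> P (gr_gen R i * x)) ->
  (forall (a : R) x y, P x -> P y -> P (a *: x + y)) -> forall x, P x.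
Proof.
move=> P1 Pg PD x; have P0 : P 0.
  by rewrite -(subrr 1) -scaleN1r addrC; apply: PD.
rewrite (gr_mono_basis x); elim/big_rec: _ => // I y _ Py; apply: PD => //.
rewrite gr_monoE oprod_enum /oprod; elim: (enum _) => [|i s IH].
  by rewrite big_nil.
by rewrite big_cons; apply: Pg.
Qed.

End Generators.

Section Substitution.
Variables (R : realFieldType) (N N' : nat).

Lemma gr_odd_sq M (x : grassmann R M) : gr_parity true x -> x * x = 0.
Proof.
move=> xo; have /eqP := gr_odd_anticomm xo xo.
by rewrite -addr_eq0 -mulr2n -scaler_nat scaler_eq0 pnatr_eq0 => /eqP.
Qed.

(** The letter moves right past smaller ones, with a sign each time; a repeated
    letter gives c = 0, as odd elements square to zero.  The scalar and the
    sorted word are the same for all odd families, in all Grassmann algebras. *)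
Lemma insert_sorted (i : 'I_N) (s : seq 'I_N) : sorted ltn (map val s) ->
  exists (c : R) (s' : seq 'I_N), [/\ sorted ltn (map val s'),
    forall k : 'I_N, k \in s' -> k \in i :: s &
    forall M (z : 'I_N -> grassmann R M), (forall j, gr_parity true (z j)) ->
      oprod z (i :: s) = c *: oprod z s'].
Proof.
rewrite /oprod; elim: s => [|j s IH] /= ss.
  by exists 1, [:: i]; split=> // M z zo; rewrite scale1r.
case: (ltngtP i j) => [ij|ji|/val_inj eij].
- by exists 1, [:: i, j & s]; split=> //= [|M z _]; rewrite ?ij // scale1r.
- have [c [s' [ss' sub H]]] := IH (path_sorted ss).
  exists (- c), (j :: s'); split=> [/=|k|M z zo].
  + rewrite path_sortedE; last exact: ltn_trans.
    rewrite ss' andbT; apply/allP => _ /mapP[k /sub + ->].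
    rewrite inE => /orP[/eqP->//|ks].
    move: ss; rewrite path_sortedE; last exact: ltn_trans.
    by case/andP => /allP /(_ (val k)) Hk _; apply: Hk; apply: map_f.
  + rewrite !inE => /orP[->|/sub]; first by rewrite orbT.
    by rewrite !inE => /orP[->//|->]; rewrite !orbT.
  + rewrite !big_cons mulrA (gr_odd_anticomm (zo i) (zo j)) mulNr -mulrA.
    by have := H M z zo; rewrite big_cons => ->; rewrite scaleNr scalerAr.
- exists 0, [::]; split=> // M z zo; rewrite eij !big_cons mulrA.
  by rewrite gr_odd_sq // mul0r scale0r.
Qed.

(** A word in the generators and its image under a substitution are sorted with
    the same scalar; this makes substitution multiplicative. *)
Lemma oprod_sort (s : seq 'I_N) :
  exists (c : R) (s' : seq 'I_N), sorted ltn (map val s') /\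
    forall M (z : 'I_N -> grassmann R M), (forall j, gr_parity true (z j)) ->
      oprod z s = c *: oprod z s'.
Proof.
elim: s => [|i s [c [s1 [ss1 H1]]]].
  by exists 1, [::]; split=> // M z _; rewrite scale1r.
have [d [s2 [ss2 _ H2]]] := insert_sorted i ss1.
exists (c * d), s2; split=> // M z zo.
move: (H1 M z zo) (H2 M z zo); rewrite /oprod !big_cons => -> H.
by rewrite -scalerA -H -scalerAr.
Qed.

(** For a family z of odd elements, the algebra morphism sending each generator
    to z. *)
Definition gr_subst (z : 'I_N -> grassmann R N') (c : grassmann R N) :
    grassmann R N' :=
  \sum_(I : {set 'I_N}) c I *: \prod_(j in I) z j.

Variable z : 'I_N -> grassmann R N'.

Lemma gr_subst_linear a x y :
  gr_subst z (a *: x + y) = a *: gr_subst z x + gr_subst z y.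
Proof.
rewrite /gr_subst scaler_sumr -big_split; apply: eq_bigr => I _ /=.
by rewrite ffunE gr_scaleE scalerDl scalerA.
Qed.

Lemma gr_substZ a x : gr_subst z (a *: x) = a *: gr_subst z x.
Proof.
rewrite /gr_subst scaler_sumr; apply: eq_bigr => I _ /=.
by rewrite gr_scaleE scalerA.
Qed.

Lemma gr_substD x y : gr_subst z (x + y) = gr_subst z x + gr_subst z y.
Proof. by rewrite -[x]scale1r gr_subst_linear !scale1r. Qed.

Lemma gr_subst0 : gr_subst z 0 = 0.
Proof. by rewrite -[0](scale0r 0) gr_substZ scale0r. Qed.

Lemma gr_subst_sum (T : Type) (r : seq T) (P : pred T) (F : T -> grassmann R N) :
  gr_subst z (\sum_(i <- r | P i) F i) = \sum_(i <- r | P i) gr_subst z (F i).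
Proof. exact: (big_morph _ gr_substD gr_subst0). Qed.

Lemma gr_subst_mono I : gr_subst z (gr_mono R I) = \prod_(j in I) z j.
Proof.
rewrite /gr_subst (bigD1 I) //= [X in _ + X]big1.
  by rewrite addr0 ffunE eqxx scale1r.
by move=> J /negPf nJ; rewrite ffunE nJ scale0r.
Qed.

Lemma gr_subst1 : gr_subst z 1 = 1.
Proof.
rewrite (_ : 1 = gr_mono R set0) ?gr_subst_mono ?big_set0 //.
Qed.

Hypothesis zo : forall j, gr_parity true (z j).

Lemma gr_subst_oprod (s : seq 'I_N) :
  gr_subst z (oprod (@gr_gen R N) s) = oprod z s.
Proof.
have [c [s' [ss' H]]] := oprod_sort s.
rewrite (H _ z) // (H _ (@gr_gen R N)); last by move=> j; apply: gr_parity_gen.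
rewrite gr_substZ oprod_mono // gr_subst_mono oprod_enum; congr (_ *: oprod z _).
apply: (inj_map val_inj); apply: (irr_sorted_eq ltn_trans ltnn) => //.
  exact: sorted_enum_ord.
move=> k; apply/mapP/mapP => -[j js ->]; exists j => //.
  by move: js; rewrite mem_enum inE.
by rewrite mem_enum inE.
Qed.

Lemma gr_subst_gen i : gr_subst z (gr_gen R i) = z i.
Proof.
by have := gr_subst_oprod [:: i]; rewrite /oprod !big_seq1.
Qed.

(** Both sides are bilinear, and the product of two monomials is a word in the
    generators, on which substitution is computed by [gr_subst_oprod]. *)
Lemma gr_substM x y : gr_subst z (x * y) = gr_subst z x * gr_subst z y.
Proof.
have mono I J : gr_subst z (gr_mono R I * gr_mono R J) =
    gr_subst z (gr_mono R I) * gr_subst z (gr_mono R J).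
  rewrite !gr_monoE !oprod_enum !gr_subst_oprod /oprod -!big_cat.
  exact: gr_subst_oprod.
rewrite (gr_mono_basis x) (gr_mono_basis y) mulr_suml !gr_subst_sum mulr_suml.
apply: eq_bigr => I _; rewrite mulr_sumr gr_subst_sum mulr_sumr.
apply: eq_bigr => J _.
by rewrite -!scalerAl -!scalerAr !gr_substZ mono -!scalerAl -!scalerAr.
Qed.

End Substitution.

(* Not imported above, since classical_sets shadows the notations of finset. *)
From mathcomp Require Import all_classical all_reals all_analysis.
From mathcomp Require Import ring lra.
Import numFieldNormedType.Exports.

Local Open Scope classical_set_scope.
Local Open Scope ring_scope.

Section OddDerivative.
Variables (R : realType) (N : nat).
Implicit Types (x y : grassmann R N).

Lemma gr_deriv_linear j a x y :
  gr_deriv j (a *: x + y) = a *: gr_deriv j x + gr_deriv j y.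
Proof.
apply/ffunP => I; rewrite !ffunE; case: ifP => _; first by rewrite scaler0 addr0.
rewrite mulrDr; congr (_ + _).
by rewrite [RHS]mulrCA.
Qed.

Lemma gr_derivZ j a x : gr_deriv j (a *: x) = a *: gr_deriv j x.
Proof.
apply/ffunP => I; rewrite !ffunE; case: ifP => _; first by rewrite scaler0.
by rewrite [RHS]mulrCA.
Qed.

Lemma gr_derivD j x y : gr_deriv j (x + y) = gr_deriv j x + gr_deriv j y.
Proof. by rewrite -[x]scale1r gr_deriv_linear !scale1r. Qed.

Lemma gr_deriv0 j : gr_deriv j (0 : grassmann R N) = 0.
Proof. by rewrite -[0](scale0r 0) gr_derivZ !scale0r. Qed.

Lemma gr_deriv1 j : gr_deriv j (1 : grassmann R N) = 0.
Proof.
apply/ffunP => I; rewrite !ffunE; case: ifP => // jI.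
case: eqVneq => [/setP/(_ j)|]; last by rewrite mulr0.
by rewrite !inE eqxx.
Qed.

(** The Leibniz rule for one generator.  Together with linearity and [gr_deriv1]
    it determines the left derivative, which is how the next two lemmas are
    proved by [gr_ind]. *)
Lemma gr_deriv_gen i j y :
  gr_deriv j (gr_gen R i * y) = (i == j)%:R *: y - gr_gen R i * gr_deriv j y.
Proof.
apply/ffunP => K; rewrite [LHS]ffunE [RHS]ffunE gr_scaleE.
rewrite [(- _ : grassmann R N) _]ffunE !gr_gen_mul [gr_deriv j y _]ffunE.
rewrite !inE.
have cardlt (L : {set 'I_N}) (k l : 'I_N) : l \notin L ->
    #|[set a in l |: L | (a < k)%N]| = ((l < k) + #|[set a in L | (a < k)%N]|)%N.
  move=> lL; case: (ltnP l k) => lk.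
    rewrite (_ : [set a in l |: L | _] = l |: [set a in L | (a < k)%N]).
      by rewrite cardsU1 inE (negPf lL).
    by apply/setP => a; rewrite !inE; case: eqVneq => // ->; rewrite lk.
  rewrite add0n; apply: eq_card => a; rewrite !inE; case: eqVneq => // ->.
  by rewrite ltnNge lk /= !andbF.
have cardltD (L : {set 'I_N}) (k l : 'I_N) : l \in L ->
    #|[set a in L | (a < k)%N]| = ((l < k) + #|[set a in L :\ l | (a < k)%N]|)%N.
  by move=> lL; rewrite -cardlt ?finset.setD11 // finset.setD1K.
have [<-|nij] := eqVneq i j.
  rewrite mul1r; case: (boolP (i \in K)) => iK.
    rewrite finset.setD1K // mulrA -exprD (cardltD K i i) // ltnn add0n addnn.
    by rewrite -signr_odd odd_double expr0 mul1r subrr.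
  rewrite subr0 mulrA -exprD cardlt // ltnn add0n addnn.
  rewrite -signr_odd odd_double expr0 mul1r; congr (y _).
  by apply/setP => a; rewrite !inE; case: eqVneq => // ->; rewrite (negPf iK).
rewrite /= mul0r add0r.
case: (boolP (i \in K)) => iK; last by rewrite mulr0 oppr0 if_same.
case: (boolP (j \in K)) => jK; first by rewrite mulr0 oppr0.
have -> : (j |: K) :\ i = j |: (K :\ i).
  by apply/setP => a; rewrite !inE; case: (eqVneq a j) => // ->; rewrite eq_sym nij.
rewrite cardlt // (cardltD _ j i) // !mulrA -mulNr -!exprD.
congr (_ * _); rewrite -[RHS]mulN1r -exprS.
rewrite -signr_odd -[in RHS]signr_odd; congr (_ ^+ nat_of_bool _).
rewrite /= !oddD; set A := odd #|_|; set B := odd #|_|.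
case: (ltngtP (i : nat) j) => [ij|ij|/val_inj eij] /=.
- by case: A; case: B.
- by case: A; case: B.
- by move: nij; rewrite eij eqxx.
Qed.

Lemma gr_derivC i j x : gr_deriv i (gr_deriv j x) = - gr_deriv j (gr_deriv i x).
Proof.
move: x; apply: gr_ind => [|k x IH|a x y IHx IHy].
- by rewrite !gr_deriv1 !gr_deriv0 oppr0.
- rewrite !gr_deriv_gen.
  have E l u v : gr_deriv l (u - v) = gr_deriv l u - gr_deriv l v :> grassmann R N.
    by rewrite -[v in LHS]opprK opprK -scaleN1r gr_derivD gr_derivZ scaleN1r.
  rewrite !E !gr_derivZ !gr_deriv_gen IH mulrN opprK !opprB opprD addrA.
  by rewrite addrAC.
- by rewrite !gr_deriv_linear IHx IHy scalerN opprD.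
Qed.

(** As rho squares to zero, the substitution is affine in rho; its coefficient
    satisfies a Leibniz rule over [gr_subst z] and takes the value v on
    generators. *)
Lemma gr_subst_shift N' (z v : 'I_N -> grassmann R N') (rho : grassmann R N') x :
  (forall j, gr_parity true (z j)) -> (forall j, gr_parity false (v j)) ->
  gr_parity true rho ->
  gr_subst (fun j => z j + rho * v j) x =
  gr_subst z x + rho * \sum_j v j * gr_subst z (gr_deriv j x).
Proof.
move=> zo ve ro.
have zo' j : gr_parity true (z j + rho * v j).
  by apply: gr_parityD => //; rewrite -[true]/(true (+) false); apply: gr_parityM.
move: x; apply: gr_ind => [|i x IH|a x y IHx IHy].
- rewrite !gr_subst1 big1 ?mulr0 ?addr0 // => j _.
  by rewrite gr_deriv1 gr_subst0 mulr0.
- rewrite (gr_substM zo') (gr_subst_gen zo') IH (gr_substM zo) (gr_subst_gen zo).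
  set S := gr_subst z x; set D := \sum_j _.
  have -> : \sum_j v j * gr_subst z (gr_deriv j (gr_gen R i * x)) =
      v i * S - z i * D.
    rewrite (eq_bigr (fun j => (i == j)%:R *: (v j * S)
        - z i * (v j * gr_subst z (gr_deriv j x)))) => [|j _].
      rewrite sumrB -mulr_sumr; congr (_ - _).
      rewrite (bigD1 i) //= big1 ?addr0 ?eqxx ?scale1r // => j /negPf nji.
      by rewrite eq_sym nji scale0r.
    rewrite gr_deriv_gen -[X in v j * gr_subst z (_ + X)]scaleN1r addrC.
    rewrite gr_subst_linear gr_substZ (gr_substM zo) (gr_subst_gen zo) scaleN1r addrC.
    rewrite mulrBr -scalerAr; congr (_ - _).
    by rewrite !mulrA (gr_even_comm _ (ve j)).
  have h1 : z i * (rho * D) = - (rho * (z i * D)).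
    by rewrite mulrA (gr_odd_anticomm (zo i) ro) mulNr mulrA.
  have h2 : rho * v i * (rho * D) = 0.
    by rewrite -(gr_even_comm rho (ve i)) mulrA -(mulrA (v i)) gr_odd_sq // mulr0 mul0r.
  by rewrite mulrDl !mulrDr h1 h2 addr0 mulrN -addrA addrC -(mulrA rho) addrC [X in _ + X]addrC.
- rewrite !gr_subst_linear IHx IHy scalerDr addrACA; congr (_ + _).
  rewrite scalerAr -mulrDr; congr (_ * _); rewrite scaler_sumr -big_split /=.
  apply: eq_bigr => j _; rewrite gr_deriv_linear gr_subst_linear mulrDr.
  by rewrite scalerAr.
Qed.

End OddDerivative.

(** * Functions of class C^k on open subsets of R^p *)

Section Calculus.
Variable R : realType.

Lemma is_derive_line p (h : 'rV[R]_p -> R) (a e : 'rV[R]_p) (t : R) :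
  derivable h (a + t *: e) e ->
  is_derive t 1 (fun s : R => h (a + s *: e)) ('D_e h (a + t *: e)).
Proof.
have E : (fun s => s^-1 *: (((fun s : R => h (a + s *: e)) \o shift t) (s *: 1)
             - h (a + t *: e)))
  = (fun s => s^-1 *: ((h \o shift (a + t *: e)) (s *: e) - h (a + t *: e))).
  apply/funext => s /=; congr (_ *: (h _ - _)).
  by rewrite [s *: 1]mulr1 scalerDl addrCA.
move=> dh; apply: DeriveDef; first by rewrite /derivable E.
by rewrite /derive E.
Qed.

(** Bounding by absolute values, instead of using an interval, treats both signs
    of s. *)
Lemma MVT_line p (h : 'rV[R]_p -> R) (a e : 'rV[R]_p) (s : R) :
  (forall t, `|t| <= `|s| -> derivable h (a + t *: e) e) ->
  exists2 c, `|c| <= `|s| & h (a + s *: e) - h a = s * 'D_e h (a + c *: e).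
Proof.
move=> dh; pose g t := h (a + t *: e).
have cont (u v : R) : (forall t, t \in `[u, v] -> `|t| <= `|s|) ->
    {within `[u, v], continuous g}.
  move=> uv; apply: derivable_within_continuous => t /uv /dh /is_derive_line dg.
  exact: ex_derive.
have drv (u v : R) : (forall t, t \in `[u, v] -> `|t| <= `|s|) ->
    forall t, t \in `]u, v[%R -> is_derive t 1 g ('D_e h (a + t *: e)).
  move=> uv t tuv; apply/is_derive_line/dh/uv; move: tuv.
  exact: subset_itv_oo_cc.
have g0 : g 0 = h a by rewrite /g scale0r addr0.
have [s0|/ltW s0] := leP 0 s.
  have H t : t \in `[0, s] -> `|t| <= `|s|.
    by rewrite in_itv /= => /andP[t0 ts]; rewrite !ger0_norm.
  have [c cs] := MVT_segment s0 (drv _ _ H) (cont _ _ H).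
  by rewrite g0 subr0 mulrC => E; exists c => //; apply: H.
have H t : t \in `[s, 0] -> `|t| <= `|s|.
  by rewrite in_itv /= => /andP[st t0]; rewrite !ler0_norm // lerN2.
have [c cs] := MVT_segment s0 (drv _ _ H) (cont _ _ H).
rewrite g0 sub0r mulrN => E; exists c; first exact: H.
by rewrite -[LHS]opprB E opprK mulrC.
Qed.

Lemma norm_coord p (v : 'rV[R]_p) i : `|v 0 i| <= `|v|.
Proof.
rewrite [leRHS]/Num.Def.normr /= mx_normrE; apply/bigmax_geP; right => /=.
by exists (0, i).
Qed.

Lemma norm_rV_le p (v : 'rV[R]_p) (M : R) : 0 <= M ->
  (forall i, `|v 0 i| <= M) -> `|v| <= M.
Proof.
move=> M0 H; rewrite [leLHS]/Num.Def.normr /= mx_normrE; apply/bigmax_leP; split=> //=.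
by move=> [i j] _ /=; rewrite ord1.
Qed.

Definition lin_pderiv p (h : 'rV[R]_p -> R) x (v : 'rV[R]_p) : R :=
  \sum_i v 0 i * pderiv i h x.

Lemma lin_pderiv_linear p (h : 'rV[R]_p -> R) x : linear (lin_pderiv h x).
Proof.
move=> a u v; rewrite /lin_pderiv scaler_sumr -big_split /=.
apply: eq_bigr => i _; rewrite !mxE mulrDl.
by rewrite -mulrA.
Qed.

(** The increment v is decomposed along the path that changes one coordinate at
    a time; on each segment the mean value theorem gives a partial derivative at
    a point close to x. *)
Lemma C1_littleo p (U : set 'rV[R]_p) (h : 'rV[R]_p -> R) x :
  open U -> U x ->
  (forall i y, U y -> derivable h y (delta_mx 0 i)) ->
  (forall i, {for x, continuous (pderiv i h)}) ->
  forall eps : R, 0 < eps -> \forall v \near (0 : 'rV[R]_p),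
    `|h (v + x) - (h x + lin_pderiv h x v)| <= eps * `|v|.
Proof.
move=> oU Ux dh cdh _/posnumP[eps].
have e'0 : 0 < eps%:num / (p.+1)%:R by rewrite divr_gt0.
have /nbhs_ballP[d /= d0 Hd] : \forall y \near x, U y /\
    forall i, `|pderiv i h x - pderiv i h y| < eps%:num / (p.+1)%:R.
  near=> y; split; first by near: y; apply: open_nbhs_nbhs.
  near: y; apply: filter_forall => i.
  have /cvgrPdist_lt /(_ _ e'0) := cdh i.
  exact.
near=> v; have vd : `|v| < d.
  by near: v; apply/nbhs_ballP; exists d => //= z; rewrite -ball_normE /= sub0r normrN.
(* The vertices of the path from 0 to v that changes one coordinate at a time. *)
pose tr k : 'rV[R]_p := \row_i (if (i < k)%N then v 0 i else 0).
have trp : tr p = v by apply/rowP => i; rewrite mxE ltn_ord.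
have tr0 : tr 0%N = 0 by apply/rowP => i; rewrite !mxE.
have trS (i : 'I_p) : tr i.+1 = tr i + v 0 i *: delta_mx 0 i.
  apply/rowP => j; rewrite !mxE eqxx /= ltnS.
  case: (ltngtP j i) => [ji|ij|/val_inj ->].
  - by rewrite (_ : j == i = false) ?mulr0 ?addr0 //; apply/eqP => E; rewrite E ltnn in ji.
  - by rewrite (_ : j == i = false) ?mulr0 ?addr0 //; apply/eqP => E; rewrite E ltnn in ij.
  - by rewrite eqxx mulr1 add0r.
have near_x (i : 'I_p) c : `|c| <= `|v 0 i| ->
    ball x d (x + tr i + c *: delta_mx 0 i).
  move=> cv; rewrite -ball_normE /ball_ /= -addrA opprD addrA subrr add0r normrN.
  apply: le_lt_trans vd; apply: norm_rV_le => // j; rewrite !mxE eqxx /=.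
  case: (ltngtP j i) => [ji|ij|/val_inj ->].
  - rewrite (_ : j == i = false) ?mulr0 ?addr0 ?norm_coord //.
    by apply/eqP => E; rewrite E ltnn in ji.
  - rewrite (_ : j == i = false) ?mulr0 ?addr0 ?normr0 //.
    by apply/eqP => E; rewrite E ltnn in ij.
  - by rewrite eqxx mulr1 add0r (le_trans cv) // norm_coord.
have step (i : 'I_p) : `|h (x + tr i.+1) - h (x + tr i) - v 0 i * pderiv i h x|
    <= `|v| * (eps%:num / (p.+1)%:R).
  have [t tv|c cv] := @MVT_line _ h (x + tr i) (delta_mx 0 i) (v 0 i).
    by apply: dh; have [] := Hd _ (near_x i t tv).
  rewrite trS addrA => ->; rewrite -mulrBr normrM.
  have [_ /(_ i) /ltW] := Hd _ (near_x i c cv).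
  by rewrite distrC => le; apply: ler_pM => //; apply: norm_coord.
have E : h (v + x) - (h x + lin_pderiv h x v) =
    \sum_(i < p) (h (x + tr i.+1) - h (x + tr i) - v 0 i * pderiv i h x).
  rewrite sumrB; have := telescope_sumr (fun k => h (x + tr k)) (leq0n p).
  by rewrite big_mkord => ->; rewrite trp tr0 addr0 opprD addrA (addrC v).
rewrite E; apply: le_trans (ler_norm_sum _ _ _) _.
apply: le_trans (ler_sum _ (fun i _ => step i)) _.
rewrite sumr_const card_ord -[leLHS]mulr_natr.
have -> : `|v| * (eps%:num / p.+1%:R) * p%:R = eps%:num * `|v| * (p%:R / p.+1%:R).
  by ring.
by rewrite ler_piMr ?mulr_ge0 // ler_pdivrMr ?ltr0Sn // mul1r ler_nat.
Unshelve. all: by end_near. Qed.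

Lemma lin_pderiv_continuous p (h : 'rV[R]_p -> R) x : continuous (lin_pderiv h x).
Proof.
have -> : lin_pderiv h x = \sum_i (fun v : 'rV[R]_p => v 0 i * pderiv i h x).
  by apply/funext => v; rewrite fct_sumE.
apply: (big_ind (fun f : 'rV[R]_p -> R => continuous f)).
- exact: cst_continuous.
- by move=> f g cf cg v; apply: continuousD; [exact: cf | exact: cg].
- move=> i _ v.
  apply: (@continuousM R _ (fun v : 'rV[R]_p => v 0 i) (cst (pderiv i h x))).
    exact/differentiable_continuous/differentiable_coord.
  exact: cst_continuous.
Qed.

Lemma C1_differentiable p (U : set 'rV[R]_p) (h : 'rV[R]_p -> R) x :
  open U -> U x ->
  (forall i y, U y -> derivable h y (delta_mx 0 i)) ->
  (forall i, {for x, continuous (pderiv i h)}) ->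
  is_diff x h (lin_pderiv h x).
Proof.
move=> oU Ux dh cdh.
have lb : linear (lin_pderiv h x : 'rV[R]_p -> R) by exact: lin_pderiv_linear.
pose lM := GRing.isLinear.Build _ _ _ _ _ lb.
pose l : {linear _ -> _} := HB.pack (lin_pderiv h x) lM.
have cl : continuous (l : 'rV[R]_p -> R) by exact: lin_pderiv_continuous.
have ol : h \o shift x = cst (h x) + (l : 'rV[R]_p -> R) +o_ (0 : 'rV[R]_p) id.
  apply/eqaddoP => _/posnumP[eps].
  exact: C1_littleo oU Ux dh cdh _ _.
have dl := diff_unique cl ol.
by apply: DiffDef => //; apply/diff_locallyP; rewrite dl.
Qed.

Lemma derivable_line p (h : 'rV[R]_p -> R) (x e : 'rV[R]_p) :
  derivable (fun t : R => h (x + t *: e)) 0 1 <-> derivable h x e.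
Proof.
have -> : (fun t : R => h (x + t *: e)) =
    (fun t : R => h (t *: e + x)) by apply/funext => t; rewrite addrC.
exact: iff_sym (derivable1P h x e).
Qed.

Lemma derive_line p (h : 'rV[R]_p -> R) (x e : 'rV[R]_p) :
  derivable h x e -> 'D_e h x = 'D_1 (fun t : R => h (x + t *: e)) 0.
Proof.
move=> dh; have := @is_derive_line _ h x e 0; rewrite scale0r addr0.
by move=> /(_ dh) [_ ->].
Qed.

(** Along a line only derivable coordinates of u are needed, while h has to be
    totally differentiable, which [C1_differentiable] provides. *)
Lemma chain_line p q (V : set 'rV[R]_q) (h : 'rV[R]_q -> R)
    (u : 'rV[R]_p -> 'rV[R]_q) (x e : 'rV[R]_p) :
  open V -> Ck 1 V h -> V (u x) ->
  (forall k, derivable (fun y => u y 0 k) x e) ->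
  is_derive x e (h \o u) (\sum_k pderiv k h (u x) * 'D_e (fun y => u y 0 k) x).
Proof.
move=> oV [ch dh] Vu du.
have hdiff : is_diff (u x) h (lin_pderiv h (u x)).
  apply: (C1_differentiable oV Vu) => [i y Vy|i].
    exact: (dh i).1.
  exact: (dh i).2.1.
pose g (t : R) := u (x + t *: e).
have dg : derivable g 0 1.
  apply/derivable_mxP => i j; rewrite ord1.
  exact/(derivable_line (fun y => u y 0 j)).
have g0 : g 0 = u x by rewrite /g scale0r addr0.
have gdiff : differentiable g 0 by apply/derivable1_diffP.
have cdiff : differentiable (h \o g) 0.
  by apply: differentiable_comp => //; rewrite g0; apply: ex_diff.
have dhu : derivable (h \o u) x e.
  by apply/derivable_line/derivable1_diffP.
apply: DeriveDef; first exact: dhu.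
rewrite (derive_line dhu) -[fun t : R => _]/(h \o g).
rewrite deriveE // diff_comp //; last by rewrite g0; apply: ex_diff.
rewrite g0 (@diff_val _ _ _ _ _ _ _ hdiff) /= -deriveE // derive_mx //.
rewrite /lin_pderiv; apply: eq_bigr => k _; rewrite mxE mulrC; congr (_ * _).
by rewrite -(derive_line (h := fun y => u y 0 k)).
Qed.

(** The mean value theorem along i for the difference of h in the direction j,
    then along j for the partial derivative that this gives. *)
Lemma second_difference p (U : set 'rV[R]_p) (h : 'rV[R]_p -> R) (x : 'rV[R]_p)
    (i j : 'I_p) (s : R) :
  (forall a b, `|a| <= `|s| -> `|b| <= `|s| ->
     U (x + a *: delta_mx 0 i + b *: delta_mx 0 j)) -> Ck 2 U h ->
  exists a b, [/\ `|a| <= `|s|, `|b| <= `|s| &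
    h (x + s *: delta_mx 0 i + s *: delta_mx 0 j) - h (x + s *: delta_mx 0 i)
      - h (x + s *: delta_mx 0 j) + h x =
    s * (s * pderiv j (pderiv i h) (x + a *: delta_mx 0 i + b *: delta_mx 0 j))].
Proof.
move=> Us [ch dh].
set ei : 'rV[R]_p := delta_mx 0 i; set ej : 'rV[R]_p := delta_mx 0 j.
pose f (y : 'rV[R]_p) := h (y + s *: ej) - h y.
have U0 a : `|a| <= `|s| -> U (x + a *: ei).
  by move=> la; have := @Us a 0 la; rewrite normr0 scale0r addr0; apply.
have dshift y : U (y + s *: ej) ->
    is_derive y ei (fun y => h (y + s *: ej)) ('D_ei h (y + s *: ej)).
  move=> Uy; have E (z : 'rV[R]_p) : (fun t : R => h (z + t *: ei + s *: ej)) =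
      (fun t : R => h (z + s *: ej + t *: ei)).
    by apply/funext => t; rewrite addrAC.
  have D : derivable (fun y => h (y + s *: ej)) y ei.
    by apply/derivable_line; rewrite E; apply/derivable_line; apply: (dh i).1.
  apply: DeriveDef; first exact: D.
  by rewrite (derive_line D) E -(derive_line ((dh i).1 _ Uy)).
have df a : `|a| <= `|s| -> is_derive (x + a *: ei) ei f
    (pderiv i h (x + a *: ei + s *: ej) - pderiv i h (x + a *: ei)).
  move=> la; apply: is_deriveB.
    exact/dshift/Us.
  exact/derivableP/(dh i).1/U0.
have [a la Ea] := @MVT_line _ f x ei s (fun a la => @ex_derive _ _ _ _ _ _ _ (df a la)).
move: Ea; rewrite (@derive_val _ _ _ _ _ _ _ (df a la)).
have [b lb ->] := @MVT_line _ (pderiv i h) (x + a *: ei) ej s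
   (fun b lb => ((dh i).2.2 j).1 _ (Us a b la lb)).
by move=> E; exists a, b; split=> //; rewrite -E /f opprB -[LHS]addrA (addrC (- h _)).
Qed.

(** The second difference is symmetric in i and j, so [second_difference]
    expresses it by a value of either mixed derivative near x; continuity
    concludes. *)
Lemma pderivC p (U : set 'rV[R]_p) (h : 'rV[R]_p -> R) (x : 'rV[R]_p) (i j : 'I_p) :
  open U -> U x -> Ck 2 U h ->
  pderiv i (pderiv j h) x = pderiv j (pderiv i h) x.
Proof.
move=> oU Ux C2h; apply/eqP; rewrite -subr_eq0 -normr_le0; apply/ler_addgt0Pr => e e0.
rewrite add0r.
have e20 : 0 < e / 2 by rewrite divr_gt0.
have [d d0 Hd] : exists2 d : R, 0 < d & forall y, `|y - x| < d -> [/\ U y,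
   `|pderiv i (pderiv j h) x - pderiv i (pderiv j h) y| < e / 2 &
   `|pderiv j (pderiv i h) x - pderiv j (pderiv i h) y| < e / 2].
  have cont k l : {for x, continuous (pderiv k (pderiv l h))}.
    by have [_ /(_ l) [_ [_ /(_ k) [_ [+ _]]]]] := C2h; apply.
  have : \forall y \near x, [/\ U y,
   `|pderiv i (pderiv j h) x - pderiv i (pderiv j h) y| < e / 2 &
   `|pderiv j (pderiv i h) x - pderiv j (pderiv i h) y| < e / 2].
    have c1 := cont i j; have c2 := cont j i.
    move/cvgrPdist_lt : c1 => /(_ _ e20) c1.
    move/cvgrPdist_lt : c2 => /(_ _ e20) c2.
    have oU' : nbhs x U by exact: open_nbhs_nbhs.
    apply: filterS3 oU' c1 c2 => y Uy yi yj.
    exact: And3 Uy yi yj.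
  move=> /nbhs_ballP[d /= d0 H]; exists d => // y yx; apply: H.
  by rewrite -ball_normE /= distrC.
(* Two steps of length s in coordinate directions stay in the ball of radius d. *)
pose s := d / 3; have s0 : 0 < s by rewrite divr_gt0.
have ns : `|s| = s by rewrite gtr0_norm.
have small k l a b : `|a| <= `|s| -> `|b| <= `|s| ->
    `|x + a *: delta_mx 0 k + b *: delta_mx 0 l - x| < d.
  rewrite ns => la lb; rewrite -(addrA x) addrAC subrr add0r.
  have nd (m : 'I_p) : `|delta_mx 0 m : 'rV[R]_p| <= 1.
    apply: norm_rV_le => // r; rewrite mxE eqxx /=; case: (r == m); rewrite ?normr1 ?normr0 //.
  apply: le_lt_trans (ler_normD _ _) _; rewrite !normrZ.
  have : `|a| * `|delta_mx 0 k : 'rV[R]_p| <= s * 1 by apply: ler_pM.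
  have : `|b| * `|delta_mx 0 l : 'rV[R]_p| <= s * 1 by apply: ler_pM.
  by rewrite /s; move: d0; lra.
have Us k l a b : `|a| <= `|s| -> `|b| <= `|s| ->
    U (x + a *: delta_mx 0 k + b *: delta_mx 0 l).
  by move=> la lb; have [] := Hd _ (small k l a b la lb).
have [a [b [la lb E1]]] := second_difference (Us i j) C2h.
have [c [f [lc lf E2]]] := second_difference (Us j i) C2h.
have : s * (s * pderiv j (pderiv i h) (x + a *: delta_mx 0 i + b *: delta_mx 0 j)) =
   s * (s * pderiv i (pderiv j h) (x + c *: delta_mx 0 j + f *: delta_mx 0 i)).
  refine (etrans (esym E1) (etrans _ E2)).
  rewrite [in h (_ + _ + _)]addrAC; congr (_ + _).
  by rewrite -!addrA; congr (_ + _); rewrite addrC.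
move/(mulfI (lt0r_neq0 s0))/(mulfI (lt0r_neq0 s0)) => E.
have [_ _ H1] := Hd _ (small i j _ _ la lb).
have [_ H2 _] := Hd _ (small j i _ _ lc lf).
rewrite E in H1; move: H1 H2; set z := pderiv i _ (_ + _).
move: (pderiv i _ x) (pderiv j _ x) z => X Y z H1 H2.
have -> : X - Y = (X - z) - (Y - z) by rewrite opprB addrA subrK.
apply: le_trans (ler_normB _ _) _; rewrite [leRHS]splitr.
exact: lerD (ltW H2) (ltW H1).
Unshelve. all: by end_near. Qed.

Lemma Ck_le k p (U : set 'rV[R]_p) h : Ck k.+1 U h -> Ck k U h.
Proof.
elim: k h => [|k IH] h; first by case.
move=> [ch dh]; split=> // i; split; first exact: (dh i).1.
exact/IH/(dh i).2.
Qed.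

Lemma Ck_continuous k p (U : set 'rV[R]_p) h x :
  Ck k U h -> U x -> {for x, continuous h}.
Proof. by case: k => [|k] [ch _]; apply: ch. Qed.

Lemma near_congr p (U : set 'rV[R]_p) (f g : 'rV[R]_p -> R) x :
  open U -> (forall x, U x -> f x = g x) -> U x -> \forall y \near x, f y = g y.
Proof.
move=> oU fg Ux; have nU : nbhs x U by exact: open_nbhs_nbhs.
exact: filterS nU.
Qed.

Lemma continuous_congr p (U : set 'rV[R]_p) (f g : 'rV[R]_p -> R) x :
  open U -> (forall x, U x -> f x = g x) -> U x ->
  {for x, continuous f} -> {for x, continuous g}.
Proof.
move=> oU fg Ux; rewrite /prop_for /continuous_at (fg x Ux).
exact: cvg_trans (near_eq_cvg (near_congr oU fg Ux)).
Qed.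

Lemma pderiv_congr p (U : set 'rV[R]_p) (f g : 'rV[R]_p -> R) i :
  open U -> (forall x, U x -> f x = g x) ->
  forall x, U x -> pderiv i f x = pderiv i g x.
Proof.
by move=> oU fg x Ux; apply/near_eq_derive/(near_congr oU fg Ux).
Qed.

Lemma Ck_congr k p (U : set 'rV[R]_p) (f g : 'rV[R]_p -> R) :
  open U -> (forall x, U x -> f x = g x) -> Ck k U f -> Ck k U g.
Proof.
move=> oU; elim: k f g => [|k IH] f g fg [cf df].
  split=> // x Ux; exact: (continuous_congr oU fg Ux (cf x Ux)).
split=> [x Ux|i]; first exact: (continuous_congr oU fg Ux (cf x Ux)).
split=> [x Ux|].
  exact: near_eq_derivable (near_congr oU fg Ux) ((df i).1 x Ux).
apply: IH (df i).2; exact: pderiv_congr.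
Qed.

Lemma Ck_cst k p (U : set 'rV[R]_p) (c : R) : Ck k U (fun=> c).
Proof.
elim: k c => [|k IH] c; split => //; first by move=> x _; apply: cst_continuous.
  by move=> x _; apply: cst_continuous.
move=> i; split; first by move=> x _; apply: derivable_cst.
rewrite (_ : pderiv i _ = fun=> 0) //.
by apply/funext => x; rewrite /pderiv derive_cst.
Qed.

Lemma CkD k p (U : set 'rV[R]_p) (f g : 'rV[R]_p -> R) : open U ->
  Ck k U f -> Ck k U g -> Ck k U (fun x => f x + g x).
Proof.
move=> oU; elim: k f g => [|k IH] f g [cf df] [cg dg]; split=> //.
- by move=> x Ux; apply: continuousD; [apply: cf|apply: cg].
- by move=> x Ux; apply: continuousD; [apply: cf|apply: cg].
- move=> i; split.
    by move=> x Ux; apply: derivableD; [apply: (df i).1|apply: (dg i).1].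
  apply: (Ck_congr oU _ (IH _ _ (df i).2 (dg i).2)) => x Ux.
  by rewrite /pderiv deriveD //; [apply: (df i).1|apply: (dg i).1].
Qed.

Lemma CkM k p (U : set 'rV[R]_p) (f g : 'rV[R]_p -> R) : open U ->
  Ck k U f -> Ck k U g -> Ck k U (fun x => f x * g x).
Proof.
move=> oU; elim: k f g => [|k IH] f g Cf Cg; split=> //.
- move=> x Ux; exact: continuousM (Ck_continuous Cf Ux) (Ck_continuous Cg Ux).
- move=> x Ux; exact: continuousM (Ck_continuous Cf Ux) (Ck_continuous Cg Ux).
- move: (Cf) (Cg) => [cf df] [cg dg] i; split.
    by move=> x Ux; apply: derivableM; [apply: (df i).1|apply: (dg i).1].
  apply: (@Ck_congr _ _ _ (fun x => f x * pderiv i g x + g x * pderiv i f x)) => //.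
    move=> x Ux; rewrite /pderiv.
    by rewrite deriveM //; [apply: (df i).1|apply: (dg i).1].
  by apply: CkD => //; apply: IH; rewrite ?(df i).2 ?(dg i).2 //;
    first [exact: Ck_le | exact: (df i).2 | exact: (dg i).2].
Qed.

Lemma is_derive_affine p (h : 'rV[R]_p -> R) (x e : 'rV[R]_p) (c : R) :
  (forall t : R, h (x + t *: e) = h x + t * c) -> is_derive x e h c.
Proof.
move=> H.
have L : t^-1 *: ((h \o shift x) (t *: e) - h x) @[t --> 0^'] --> c.
  apply: cvg_near_cst.
  have : \forall t \near (0 : R)^', t != 0 by exact: nbhs_dnbhs_neq.
  apply: filterS => t t0 /=.
  by rewrite addrC addrC [t *: e + x]addrC H addrAC subrr add0r /GRing.scale /= mulKf.
by apply: DeriveDef; [apply/cvg_ex; exists c | exact: cvg_lim L].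
Qed.

Lemma is_derive_coord p (x e : 'rV[R]_p) (j : 'I_p) :
  is_derive x e (fun x : 'rV[R]_p => x 0 j) (e 0 j).
Proof. by apply: is_derive_affine => t; rewrite !mxE. Qed.

Lemma Ck_coord k p (U : set 'rV[R]_p) (j : 'I_p) : Ck k U (fun x => x 0 j).
Proof.
have cc (x : 'rV[R]_p) : {for x, continuous (fun x : 'rV[R]_p => x 0 j)}.
  exact/differentiable_continuous/differentiable_coord.
case: k => [|k]; split=> // i; split.
  by move=> x _; have [] := is_derive_coord x (delta_mx 0 i) j.
rewrite (_ : pderiv i _ = fun=> (delta_mx 0 i : 'rV[R]_p) 0 j).
  exact: Ck_cst.
by apply/funext => x; rewrite /pderiv; have [_ ->] := is_derive_coord x (delta_mx 0 i) j.
Qed.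

Lemma Ck_sum k p (U : set 'rV[R]_p) (T : Type) (r : seq T) (P : pred T)
    (F : T -> 'rV[R]_p -> R) : open U -> (forall i, P i -> Ck k U (F i)) ->
  Ck k U (fun x => \sum_(i <- r | P i) F i x).
Proof.
move=> oU H; elim: r => [|i r IH].
  by apply: Ck_congr (Ck_cst k U 0) => // x _; rewrite big_nil.
apply: (@Ck_congr _ _ _ (fun x => (if P i then F i x else 0)
    + \sum_(j <- r | P j) F j x)) => //.
  by move=> x _; rewrite big_cons; case: ifP; rewrite ?add0r.
by apply: CkD => //; case Pi: (P i); [exact: H | exact: Ck_cst].
Qed.

Lemma CkV k p (U : set 'rV[R]_p) (f : 'rV[R]_p -> R) : open U ->
  (forall x, U x -> f x != 0) -> Ck k U f -> Ck k U (fun x => (f x)^-1).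
Proof.
move=> oU f0; elim: k => [|k IH] Cf.
  by split=> // x Ux; exact: (continuousV (s := f) (f0 x Ux) (Ck_continuous Cf Ux)).
split=> [x Ux|i].
  exact: (continuousV (s := f) (f0 x Ux) (Ck_continuous Cf Ux)).
have [cf df] := Cf; split=> [x Ux|].
  exact: (derivableV (f := f) (f0 x Ux) ((df i).1 x Ux)).
have CV := IH (Ck_le Cf).
apply: (@Ck_congr _ _ _ (fun x => (-1 * ((f x)^-1 * (f x)^-1)) * pderiv i f x)) => //.
  move=> x Ux; rewrite /pderiv (deriveV (f0 x Ux) ((df i).1 x Ux)).
  by rewrite mulN1r -invfM.
apply: CkM => //; last exact: (df i).2.
by apply: CkM => //; [exact: Ck_cst | exact: CkM].
Qed.

Lemma coordwise_continuous p q (u : 'rV[R]_p -> 'rV[R]_q) x :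
  (forall j, {for x, continuous (fun y => u y 0 j)}) -> {for x, continuous u}.
Proof.
move=> cu; rewrite /prop_for /continuous_at; apply/(@cvgrPdist_le R 'rV[R]_q 'rV[R]_p (nbhs x)) => e e0.
have H j : \forall y \near x, `|u x 0 j - u y 0 j| <= e.
  by have /cvgrPdist_le /(_ _ e0) := cu j; exact.
have A : \forall y \near x, forall j, `|u x 0 j - u y 0 j| <= e.
  exact: (@filter_forall _ _ (fun j y => `|u x 0 j - u y 0 j| <= e) (nbhs x) _ H).
apply: filterS A => y Hy; apply: norm_rV_le; first exact: ltW.
by move=> j; rewrite !mxE.
Qed.

Lemma pderiv_comp p q (U : set 'rV[R]_p) (V : set 'rV[R]_q) (h : 'rV[R]_q -> R)
    (u : 'rV[R]_p -> 'rV[R]_q) (i : 'I_p) x :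
  open V -> Ck 1 V h -> (forall x, U x -> V (u x)) ->
  (forall k, Ck 1 U (fun x => u x 0 k)) -> U x ->
  pderiv i (h \o u) x = \sum_k pderiv k h (u x) * pderiv i (fun y => u y 0 k) x.
Proof.
move=> oV Ch uUV Cu Ux.
have [_ E] := chain_line (e := delta_mx 0 i) oV Ch (uUV x Ux)
  (fun k => (((Cu k).2 i).1 x Ux)).
exact: E.
Qed.

(** By the chain rule, the derivatives of the composite are sums of products to
    which the induction hypothesis applies. *)
Lemma Ck_comp k p q (U : set 'rV[R]_p) (V : set 'rV[R]_q) (h : 'rV[R]_q -> R)
    (u : 'rV[R]_p -> 'rV[R]_q) :
  open U -> open V -> Ck k V h -> (forall x, U x -> V (u x)) ->
  (forall n j, Ck n U (fun x => u x 0 j)) -> Ck k U (h \o u).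
Proof.
move=> oU oV + uUV Cu; elim: k h => [|k IH] h Ch.
  split=> // x Ux; apply: continuous_comp (Ck_continuous Ch (uUV x Ux)).
  by apply: coordwise_continuous => j; apply: Ck_continuous (Cu 0%N j) Ux.
split=> [x Ux|i].
  apply: continuous_comp (Ck_continuous Ch (uUV x Ux)).
  by apply: coordwise_continuous => j; apply: Ck_continuous (Cu 0%N j) Ux.
have C1h : Ck 1 V h by elim: {IH} k h Ch => // k IH h /Ck_le /IH.
split=> [x Ux|].
  by have [] := chain_line (e := delta_mx 0 i) oV C1h (uUV x Ux)
     (fun j => (((Cu 1%N j).2 i).1 x Ux)).
apply: (@Ck_congr _ _ _ (fun x =>
    \sum_j pderiv j h (u x) * pderiv i (fun y => u y 0 j) x)) => //.
  by move=> x Ux; rewrite (pderiv_comp i oV C1h uUV (Cu 1%N) Ux).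
apply: Ck_sum => // j _; apply: CkM => //; last exact: ((Cu k.+1 j).2 i).2.
exact: IH (Ch.2 j).2.
Qed.

End Calculus.

(** * Taylor extension to even Grassmann-valued arguments *)

Section Cinf.
Variable R : realType.

Definition Cinf p (U : set 'rV[R]_p) (h : 'rV[R]_p -> R) := forall k, Ck k U h.

Variables (p : nat) (U : set 'rV[R]_p).
Hypothesis oU : open U.
Implicit Types h f g : 'rV[R]_p -> R.

Lemma Cinf_pderiv i h : Cinf U h -> Cinf U (pderiv i h).
Proof. by move=> Ch k; have [_ /(_ i) []] := Ch k.+1. Qed.

Lemma Cinf_cst c : Cinf U (fun=> c).
Proof. by move=> k; apply: Ck_cst. Qed.

Lemma CinfD f g : Cinf U f -> Cinf U g -> Cinf U (fun x => f x + g x).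
Proof. by move=> Cf Cg k; apply: CkD. Qed.

Lemma CinfM f g : Cinf U f -> Cinf U g -> Cinf U (fun x => f x * g x).
Proof. by move=> Cf Cg k; apply: CkM. Qed.

Lemma Cinf_congr f g : (forall x, U x -> f x = g x) -> Cinf U f -> Cinf U g.
Proof. by move=> fg Cf k; apply: Ck_congr (Cf k). Qed.

Lemma Cinf_sum (T : Type) (r : seq T) (P : pred T) (F : T -> 'rV[R]_p -> R) :
  (forall i, P i -> Cinf U (F i)) -> Cinf U (fun x => \sum_(i <- r | P i) F i x).
Proof. by move=> H k; apply: Ck_sum => // i Pi; apply: H. Qed.

Lemma Cinf_coord j : Cinf U (fun x => x 0 j).
Proof. by move=> k; apply: Ck_coord. Qed.

Lemma CinfV f : (forall x, U x -> f x != 0) -> Cinf U f -> Cinf U (fun x => (f x)^-1).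
Proof. by move=> f0 Cf k; apply: CkV. Qed.

Lemma Cinf_comp q (V : set 'rV[R]_q) (h : 'rV[R]_q -> R) (u : 'rV[R]_p -> 'rV[R]_q) :
  open V -> Cinf V h -> (forall x, U x -> V (u x)) ->
  (forall j, Cinf U (fun x => u x 0 j)) -> Cinf U (h \o u).
Proof. by move=> oV Ch uUV Cu k; apply: (Ck_comp oU oV (Ch k) uUV) => n j; apply: Cu. Qed.

Lemma Cinf_derivable h i x : Cinf U h -> U x -> derivable h x (delta_mx 0 i).
Proof. by move=> Ch; have [_ /(_ i) [+ _]] := Ch 1%N; apply. Qed.

Lemma pderivD i f g x : Cinf U f -> Cinf U g -> U x ->
  pderiv i (fun x => f x + g x) x = pderiv i f x + pderiv i g x.
Proof.
move=> Cf Cg Ux; rewrite /pderiv; apply: deriveD; exact: Cinf_derivable.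
Qed.

Lemma pderivM i f g x : Cinf U f -> Cinf U g -> U x ->
  pderiv i (fun x => f x * g x) x = pderiv i f x * g x + f x * pderiv i g x.
Proof.
move=> Cf Cg Ux; rewrite addrC [X in _ = _ + X]mulrC.
exact: (deriveM (Cinf_derivable Cf Ux) (Cinf_derivable Cg Ux)).
Qed.

Lemma pderiv_cst i c x : pderiv i (fun _ : 'rV[R]_p => c) x = 0.
Proof. by rewrite /pderiv derive_cst. Qed.

Lemma pderiv_coord i j x : pderiv i (fun x : 'rV[R]_p => x 0 j) x = (i == j)%:R.
Proof.
rewrite /pderiv; have [_ ->] := is_derive_coord x (delta_mx 0 i) j.
by rewrite mxE eqxx /= eq_sym.
Qed.

Lemma pderivZ i c f x : Cinf U f -> U x ->
  pderiv i (fun x => c * f x) x = c * pderiv i f x.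
Proof.
move=> Cf Ux; rewrite pderivM //; last exact: Cinf_cst.
by rewrite pderiv_cst mul0r add0r.
Qed.

Lemma pderiv_sum (T : Type) (r : seq T) (P : pred T) (F : T -> 'rV[R]_p -> R) i x :
  (forall j, P j -> Cinf U (F j)) -> U x ->
  pderiv i (fun x => \sum_(j <- r | P j) F j x) x = \sum_(j <- r | P j) pderiv i (F j) x.
Proof.
move=> H Ux; elim: r => [|j r IH].
  rewrite big_nil -[RHS](pderiv_cst i 0 x).
  by apply: pderiv_congr Ux => // y _; rewrite big_nil.
rewrite big_cons; case: ifP => Pj.
  rewrite -IH -pderivD //; [|exact: H|exact: Cinf_sum].
  by apply: pderiv_congr Ux => // y _; rewrite big_cons Pj.
rewrite -IH; by apply: pderiv_congr Ux => // y _; rewrite big_cons Pj.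
Qed.

Lemma Cinf_foldr (t : seq 'I_p) h : Cinf U h -> Cinf U (foldr (@pderiv R p) h t).
Proof. by move=> Ch; elim: t => //= i t; apply: Cinf_pderiv. Qed.

Lemma foldr_pderiv_congr (t : seq 'I_p) f g : (forall x, U x -> f x = g x) ->
  forall x, U x -> foldr (@pderiv R p) f t x = foldr (@pderiv R p) g t x.
Proof. by move=> fg; elim: t => //= i t IH; apply: pderiv_congr. Qed.

Lemma foldr_pderivC (t : seq 'I_p) i h x : Cinf U h -> U x ->
  pderiv i (foldr (@pderiv R p) h t) x = foldr (@pderiv R p) (pderiv i h) t x.
Proof.
move=> Ch; elim: t x => //= j t IH x Ux.
rewrite (pderivC i j oU Ux (Cinf_foldr t Ch 2)).
exact: (pderiv_congr j oU IH).
Qed.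

End Cinf.

Lemma sum_tuple_cons (V : nmodType) (T : finType) k (F : seq T -> V) :
  \sum_(t : k.+1.-tuple T) F t = \sum_(i : T) \sum_(t : k.-tuple T) F (i :: t).
Proof.
rewrite pair_big /=.
rewrite (reindex (fun u : T * k.-tuple T => [tuple of u.1 :: u.2])) //=.
exists (fun t => (thead t, [tuple of behead t])) => [[i t] _|t _] /=.
  by congr pair; apply: val_inj.
by rewrite -tuple_eta.
Qed.

Section Taylor.
Variables (R : realType) (N p : nat).
Implicit Types (z n e : 'I_p -> grassmann R N) (h f g : 'rV[R]_p -> R).

Definition body_pt z : 'rV[R]_p := \row_i gr_body (z i).

(** k! times the part of degree k of the Taylor series at x; without the
    factorial, the recursion [taylor_termS] has no denominators. *)
Definition taylor_term k h (x : 'rV[R]_p) n :=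
  \sum_(t : k.-tuple 'I_p) foldr (@pderiv R p) h t x *: \prod_(i <- t) n i.

Lemma gr_taylorE h z : gr_taylor h z = \sum_(k < N.+1)
  (k`!)%:R^-1 *: taylor_term k h (body_pt z) (fun i => z i - (gr_body (z i))%:A).
Proof.
apply: eq_bigr => k _; rewrite scaler_sumr; apply: eq_bigr => t _.
by rewrite scalerA.
Qed.

Section Open.
Variable U : set 'rV[R]_p.
Hypothesis oU : open U.

Lemma taylor_term_congr k f g x n : (forall x, U x -> f x = g x) -> U x ->
  taylor_term k f x n = taylor_term k g x n.
Proof.
by move=> fg Ux; apply: eq_bigr => t _; rewrite (foldr_pderiv_congr oU t fg Ux).
Qed.

Lemma gr_taylor_congr f g z : (forall x, U x -> f x = g x) -> U (body_pt z) ->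
  gr_taylor f z = gr_taylor g z.
Proof.
by move=> fg Ux; rewrite !gr_taylorE; apply: eq_bigr => k _; rewrite (taylor_term_congr _ _ fg Ux).
Qed.

Lemma taylor_term0 h x n : taylor_term 0 h x n = (h x)%:A.
Proof.
rewrite /taylor_term (big_pred1 [tuple]) => [|t]; first by rewrite big_nil.
by apply/esym/eqP; exact: tuple0.
Qed.

Lemma taylor_termS k h x n : Cinf U h -> U x ->
  taylor_term k.+1 h x n = \sum_i n i * taylor_term k (pderiv i h) x n.
Proof.
move=> Ch Ux; rewrite /taylor_term.
rewrite (@sum_tuple_cons _ _ k (fun t => foldr (@pderiv R p) h t x *: \prod_(i <- t) n i)).
apply: eq_bigr => i _; rewrite mulr_sumr; apply: eq_bigr => t _ /=.
by rewrite big_cons (foldr_pderivC oU _ _ Ch Ux) scalerAr.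
Qed.

(** Since products of two increments vanish, at most one factor of a monomial
    contributes an increment, and by symmetry of the derivatives its k + 1
    possible positions contribute equally. *)
Lemma taylor_term_shift k h x n e :
  (forall i, gr_parity false (n i)) -> (forall i j, e i * e j = 0) ->
  Cinf U h -> U x ->
  taylor_term k.+1 h x (fun i => n i + e i) =
  taylor_term k.+1 h x n + k.+1%:R *: \sum_i e i * taylor_term k (pderiv i h) x n.
Proof.
move=> ne ee; elim: k h => [|k IH] h Ch Ux.
  rewrite !taylor_termS // scale1r -big_split; apply: eq_bigr => i _ /=.
  by rewrite !taylor_term0 mulrDl.
rewrite (taylor_termS _ _ Ch Ux) (taylor_termS k.+1 n Ch Ux).
pose A i j := taylor_term k (pderiv i (pderiv j h)) x n.
have -> : \sum_i (n i + e i) * taylor_term k.+1 (pderiv i h) x (fun i => n i + e i)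
  = \sum_i n i * taylor_term k.+1 (pderiv i h) x n
    + (\sum_i e i * taylor_term k.+1 (pderiv i h) x n
    + k.+1%:R *: \sum_i \sum_j n i * (e j * A j i)).
  rewrite scaler_sumr -!big_split; apply: eq_bigr => i _ /=.
  rewrite IH //; last exact: Cinf_pderiv.
  rewrite mulrDr !mulrDl -addrA; congr (_ + _); congr (_ + _).
  rewrite -mulr_sumr -!scalerAr; rewrite [X in _ + X](_ : _ = 0) ?addr0 //.
  rewrite mulr_sumr big1 ?scaler0 // => j _.
  by rewrite mulrA ee mul0r.
congr (_ + _); rewrite [in RHS]mulrSr scalerDl scale1r addrC; congr (_ + _).
congr (_ *: _); rewrite exchange_big; apply: eq_bigr => j _ /=.
rewrite (taylor_termS k n (Cinf_pderiv j Ch) Ux) mulr_sumr; apply: eq_bigr => i _.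
have E : A j i = taylor_term k (pderiv i (pderiv j h)) x n.
  by apply: taylor_term_congr Ux => y Uy; apply: pderivC (Ch 2%N).
rewrite -E; move: (A j i) => a.
by rewrite mulrA (gr_even_comm _ (ne i)) -mulrA.
Qed.

Lemma body_soul (x : grassmann R N) : gr_body (x - (gr_body x)%:A) = 0.
Proof. by rewrite gr_bodyB gr_body_alg subrr. Qed.

Lemma gr_order_body (x : grassmann R N) : gr_body x = 0 -> gr_order_ge 1 x.
Proof. by move=> x0 I; rewrite ltnS leqn0 cards_eq0 => /eqP ->. Qed.

Lemma gr_order_prod (T : Type) (s : seq T) (F : T -> grassmann R N) :
  (forall i, gr_body (F i) = 0) -> gr_order_ge (size s) (\prod_(i <- s) F i).
Proof.
move=> F0; elim: s => [|i s IH] //=; rewrite big_cons -add1n.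
exact/gr_order_geM/IH/gr_order_body.
Qed.

Lemma gr_order_max (x : grassmann R N) : gr_order_ge N.+1 x -> x = 0.
Proof.
move=> H; apply/ffunP => I; rewrite H ?ffunE //.
by rewrite ltnS (leq_trans (max_card _)) // card_ord.
Qed.

(** A product of N + 1 elements without body is zero.  This removes the term of
    degree N of the differentiated series in [gr_taylor_shift], which has no
    counterpart in the original one. *)
Lemma taylor_term_max h x n (y : grassmann R N) : gr_body y = 0 ->
  (forall i, gr_body (n i) = 0) -> y * taylor_term N h x n = 0.
Proof.
move=> y0 n0; rewrite mulr_sumr big1 // => t _; rewrite -scalerAr.
have -> : y * \prod_(i <- t) n i = 0; last by rewrite scaler0.
apply: gr_order_max; rewrite -add1n; apply: gr_order_geM; first exact: gr_order_body.
by have := gr_order_prod (s := t) n0; rewrite size_tuple.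
Qed.

Lemma body_pt_shift z e : (forall i, gr_body (e i) = 0) ->
  body_pt (fun i => z i + e i) = body_pt z.
Proof. by move=> e0; apply/rowP => i; rewrite !mxE gr_bodyD e0 addr0. Qed.

(** The Taylor expansion to first order is exact: all terms of higher order
    contain a product of two increments. *)
Lemma gr_taylor_shift h z e :
  (forall i, gr_parity false (z i)) -> (forall i j, e i * e j = 0) ->
  (forall i, gr_body (e i) = 0) -> Cinf U h -> U (body_pt z) ->
  gr_taylor h (fun i => z i + e i) =
  gr_taylor h z + \sum_i e i * gr_taylor (pderiv i h) z.
Proof.
move=> ze ee e0 Ch Ux; rewrite !gr_taylorE body_pt_shift //.
set n := fun i => z i - (gr_body (z i))%:A.
have -> : (fun i => z i + e i - (gr_body (z i + e i))%:A) = (fun i => n i + e i).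
  by apply/funext => i; rewrite gr_bodyD e0 addr0 addrAC.
have ne i : gr_parity false (n i) by exact/gr_parityB/gr_parity_alg.
rewrite big_ord_recl [X in _ = X + _]big_ord_recl /= !taylor_term0 -addrA.
congr (_ + _).
under eq_bigr => k _ do rewrite /bump leq0n add1n (taylor_term_shift k (x := body_pt z) ne ee Ch Ux) scalerDr.
rewrite big_split /=; congr (_ + _).
under [RHS]eq_bigr => i _ do rewrite gr_taylorE big_ord_recr mulrDr -scalerAr /=.
rewrite [RHS](eq_bigr (fun i => \sum_(k < N) (k`!)%:R^-1 *:
    (e i * taylor_term k (pderiv i h) (body_pt z) n))) => [|i _].
  rewrite exchange_big; apply: eq_bigr => k _ /=.
  rewrite scalerA factS natrM invfM mulrAC mulVf ?pnatr_eq0 // mul1r.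
  by rewrite scaler_sumr.
rewrite taylor_term_max // ?scaler0 ?addr0 => [|j]; last exact: body_soul.
by rewrite mulr_sumr; apply: eq_bigr => k _; rewrite scalerAr.
Qed.

Lemma gr_taylor_shift1 h z i0 (s : grassmann R N) :
  (forall i, gr_parity false (z i)) -> s * s = 0 ->
  gr_body s = 0 -> Cinf U h -> U (body_pt z) ->
  gr_taylor h (fun i => z i + (i == i0)%:R *: s) =
  gr_taylor h z + s * gr_taylor (pderiv i0 h) z.
Proof.
move=> ze ss s0 Ch Ux; rewrite gr_taylor_shift //.
- congr (_ + _); rewrite (bigD1 i0) //= big1 ?addr0 ?eqxx ?scale1r // => i /negPf ->.
  by rewrite scale0r mul0r.
- by move=> i j; rewrite -scalerAl -scalerAr ss !scaler0.
- by move=> i; rewrite gr_bodyZ s0 mulr0.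
Qed.

Lemma gr_taylor_real h (x : 'rV[R]_p) :
  gr_taylor h (fun i => (x 0 i)%:A : grassmann R N) = (h x)%:A.
Proof.
rewrite gr_taylorE big_ord_recl /= taylor_term0 invr1 scale1r.
have -> : body_pt (fun i => (x 0 i)%:A) = x.
  by apply/rowP => i; rewrite mxE gr_body_alg.
rewrite big1 ?addr0 // => k _; rewrite /taylor_term big1 ?scaler0 // => t _.
case/tupleP: t => i t; rewrite big_cons gr_body_alg subrr mul0r scaler0 //.
Qed.

End Open.

Lemma gr_mono_sq (I : {set 'I_N}) : I != finset.set0 -> gr_mono R I * gr_mono R I = 0.
Proof.
move=> I0; apply/ffunP => K; rewrite gr_mul_coef big1 ?ffunE // => J _.
rewrite !ffunE; case: (eqVneq J I) => [->|_]; last by rewrite mulr0 mul0r.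
case: eqVneq => [E|_]; last by rewrite mulr0.
case/set0Pn: I0 => i iI; move/setP/(_ i): E; rewrite !inE iI.
by [].
Qed.

(** The soul of an even element is a sum of multiples of monomials of positive
    even degree, each of square zero; they are added one at a time.  With
    [gr_taylor_shift1], a rule for Taylor extensions follows from the
    corresponding rule for derivatives. *)
Lemma soul_ind (Q : ('I_p -> grassmann R N) -> Prop) :
  (forall x : 'rV[R]_p, Q (fun i => (x 0 i)%:A)) ->
  (forall z i0 s, (forall i, gr_parity false (z i)) -> gr_parity false s ->
    s * s = 0 -> gr_body s = 0 -> Q z -> Q (fun i => z i + (i == i0)%:R *: s)) ->
  forall z, (forall i, gr_parity false (z i)) -> Q z.
Proof.
move=> Q0 QS z ze.
pose inc (u : 'I_p * {set 'I_N}) i : grassmann R N :=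
  (i == u.1)%:R *: (z u.1 u.2 *: gr_mono R u.2).
pose zs (r : seq ('I_p * {set 'I_N})) i : grassmann R N :=
  (gr_body (z i))%:A + \sum_(u <- r | u.2 != finset.set0) inc u i.
have moe i (I : {set 'I_N}) : gr_parity false (z i I *: gr_mono R I).
  have [->|zI] := eqVneq (z i I) 0; first by rewrite scale0r; apply: gr_parity0.
  apply: gr_parityZ => J; rewrite ffunE; case: (eqVneq J I) => [->|]; last by rewrite eqxx.
  by move=> _; apply: ze zI.
have zse r i : gr_parity false (zs r i).
  apply: gr_parityD; first exact: gr_parity_alg.
  by apply: gr_parity_sum => u _; apply: gr_parityZ.
have Qzs r : Q (zs r).
  elim: r => [|u r IH].
    have -> : zs [::] = fun i => ((\row_i gr_body (z i)) 0 i)%:A.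
      by apply/funext => i; rewrite /zs big_nil addr0 mxE.
    exact: Q0.
  have [u0|u0] := eqVneq u.2 finset.set0.
    have -> // : zs (u :: r) = zs r.
    by apply/funext => i; rewrite /zs big_cons u0 eqxx.
  have -> : zs (u :: r) = fun i => zs r i + (i == u.1)%:R *: (z u.1 u.2 *: gr_mono R u.2).
    by apply/funext => i; rewrite /zs big_cons u0 -addrA [X in _ + X]addrC.
  apply: QS => //.
  - by rewrite -scalerAl -scalerAr gr_mono_sq // !scaler0.
  - rewrite gr_bodyZ /gr_body ffunE.
    by rewrite eq_sym (negPf u0) mulr0.
have -> // : z = zs (index_enum _).
apply/funext => i; rewrite /zs.
rewrite (eq_bigl (fun u : 'I_p * {set 'I_N} => true && (u.2 != finset.set0))) //.
rewrite -(pair_big (fun _ => true) (fun I : {set 'I_N} => I != finset.set0) (fun j I => inc (j, I) i)) /=.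
rewrite (bigD1 i) //= [X in _ + (_ + X)]big1 ?addr0 => [|j ji]; last first.
  by rewrite big1 // => I _; rewrite /inc /= eq_sym (negPf ji) scale0r.
rewrite [LHS]gr_mono_basis (bigD1 finset.set0) //=; congr (_ + _).
by apply: eq_bigr => I _; rewrite /inc /= eqxx scale1r.
Qed.

Section OpenHom.
Variable U : set 'rV[R]_p.
Hypothesis oU : open U.

Lemma body_pt_shift1 z i0 (s : grassmann R N) : gr_body s = 0 ->
  body_pt (fun i => z i + (i == i0)%:R *: s) = body_pt z.
Proof. by move=> s0; apply: body_pt_shift => i; rewrite gr_bodyZ s0 mulr0. Qed.

Lemma gr_parity_taylor h z : (forall i, gr_parity false (z i)) ->
  gr_parity false (gr_taylor h z).
Proof.
move=> ze; apply: gr_parity_sum => k _; apply: gr_parity_sum => t _.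
apply/gr_parityZ/gr_parity_prod_even => i _.
exact/gr_parityB/gr_parity_alg.
Qed.

Lemma gr_body_taylor h z : gr_body (gr_taylor h z) = h (body_pt z).
Proof.
rewrite gr_taylorE big_ord_recl /= taylor_term0 invr1 scale1r gr_bodyD gr_body_alg.
rewrite gr_body_sum big1 ?addr0 // => k _; rewrite gr_bodyZ gr_body_sum big1 ?mulr0 // => t _.
case/tupleP: t => i t; rewrite big_cons gr_bodyZ gr_bodyM.
by rewrite body_soul mul0r mulr0.
Qed.

(* Unification must not unfold Taylor sums and limits. *)
Local Opaque gr_taylor pderiv.

Lemma gr_taylor_cst c z : (forall i, gr_parity false (z i)) ->
  gr_taylor (fun=> c) z = c%:A.
Proof.
move=> ze; move: z ze c.
apply: (soul_ind (Q := fun z => forall c : R, gr_taylor (fun=> c) z = c%:A)) => [x c|].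
  by rewrite gr_taylor_real.
move=> z i0 s ze se ss s0 IH c.
rewrite (gr_taylor_shift1 openT i0 ze ss s0) ?IH //; last exact: Cinf_cst.
rewrite (@gr_taylor_congr setT openT _ (fun=> 0)) ?IH ?scale0r ?mulr0 ?addr0 //.
by move=> x _; apply: pderiv_cst.
Qed.

Lemma gr_taylorD f g z : (forall i, gr_parity false (z i)) -> U (body_pt z) ->
  Cinf U f -> Cinf U g ->
  gr_taylor (fun x => f x + g x) z = gr_taylor f z + gr_taylor g z.
Proof.
move=> ze; move: z ze f g.
apply: (soul_ind (Q := fun z => forall f g, U (body_pt z) -> Cinf U f -> Cinf U g ->
   gr_taylor (fun x => f x + g x) z = gr_taylor f z + gr_taylor g z)) => [x f g _ _ _|].
  by rewrite !gr_taylor_real scalerDl.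
move=> z i0 s ze se ss s0 IH f g; rewrite body_pt_shift1 // => Uz Cf Cg.
have Cfg := CinfD oU Cf Cg.
rewrite !(gr_taylor_shift1 oU i0 ze ss s0) // IH //.
rewrite (gr_taylor_congr oU (f := pderiv i0 (fun x => f x + g x))
   (g := fun x => pderiv i0 f x + pderiv i0 g x)) //.
  by rewrite (IH _ _ Uz (Cinf_pderiv i0 Cf) (Cinf_pderiv i0 Cg)) mulrDr addrACA.
by move=> x Ux; apply: pderivD Cf Cg Ux.
Qed.

Lemma gr_taylorM f g z : (forall i, gr_parity false (z i)) -> U (body_pt z) ->
  Cinf U f -> Cinf U g ->
  gr_taylor (fun x => f x * g x) z = gr_taylor f z * gr_taylor g z.
Proof.
move=> ze; move: z ze f g.
apply: (soul_ind (Q := fun z => forall f g, U (body_pt z) -> Cinf U f -> Cinf U g ->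
   gr_taylor (fun x => f x * g x) z = gr_taylor f z * gr_taylor g z)) => [x f g _ _ _|].
  by rewrite !gr_taylor_real gr_algM scalerA.
move=> z i0 s ze se ss s0 IH f g; rewrite body_pt_shift1 // => Uz Cf Cg.
have Cf' := Cinf_pderiv i0 Cf; have Cg' := Cinf_pderiv i0 Cg.
rewrite !(gr_taylor_shift1 oU i0 ze ss s0) //; last exact: CinfM.
rewrite (gr_taylor_congr oU (f := pderiv i0 (fun x => f x * g x))
   (g := fun x => pderiv i0 f x * g x + f x * pderiv i0 g x)) //; last first.
  by move=> x Ux; apply: pderivM Cf Cg Ux.
rewrite gr_taylorD //; [|exact: CinfM|exact: CinfM].
rewrite !IH //; set F := gr_taylor f z; set G := gr_taylor g z.
set F' := gr_taylor _ z; set G' := gr_taylor _ z.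
have Fe : gr_parity false F by apply: gr_parity_taylor.
have Z : s * F' * (s * G') = 0.
  by rewrite (gr_even_comm F' se) mulrA -(mulrA F') ss mulr0 mul0r.
rewrite mulrDl !mulrDr Z addr0 -!addrA; congr (_ + _).
by rewrite addrC !mulrA (gr_even_comm F se).
Qed.

Lemma gr_taylorZ c f z : (forall i, gr_parity false (z i)) -> U (body_pt z) ->
  Cinf U f -> gr_taylor (fun x => c * f x) z = c *: gr_taylor f z.
Proof.
move=> ze Uz Cf; rewrite gr_taylorM //; last exact: Cinf_cst.
by rewrite gr_taylor_cst // gr_algM.
Qed.

Lemma gr_taylor_sum (T : Type) (r : seq T) (P : pred T) (F : T -> 'rV[R]_p -> R) z :
  (forall i, gr_parity false (z i)) -> U (body_pt z) ->
  (forall i, P i -> Cinf U (F i)) ->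
  gr_taylor (fun x => \sum_(i <- r | P i) F i x) z =
  \sum_(i <- r | P i) gr_taylor (F i) z.
Proof.
move=> ze Uz CF; elim: r => [|i r IH].
  rewrite big_nil (gr_taylor_congr oU (g := fun=> 0)) //.
    by rewrite gr_taylor_cst // scale0r.
  by move=> x _; rewrite big_nil.
rewrite big_cons; case: ifP => Pi.
  rewrite -IH -gr_taylorD //; [|exact: CF|exact: Cinf_sum].
  by apply: gr_taylor_congr Uz => // x _; rewrite big_cons Pi.
by rewrite -IH; apply: gr_taylor_congr Uz => // x _; rewrite big_cons Pi.
Qed.

Lemma gr_taylor_coord j z : (forall i, gr_parity false (z i)) ->
  gr_taylor (fun x => x 0 j) z = z j.
Proof.
move=> ze; move: z ze j.
apply: (soul_ind (Q := fun z => forall j, gr_taylor (fun x => x 0 j) z = z j)) => [x j|].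
  by rewrite gr_taylor_real.
move=> z i0 s ze se ss s0 IH j.
rewrite (gr_taylor_shift1 openT i0 ze ss s0) ?IH //; last exact: Cinf_coord.
rewrite (@gr_taylor_congr setT openT _ (fun=> (i0 == j)%:R)) //; last first.
  by move=> x _; apply: pderiv_coord.
by rewrite gr_taylor_cst // gr_Malg eq_sym.
Qed.

End OpenHom.

End Taylor.

Section TaylorComp.
Variables (R : realType) (N p q : nat).
Variables (U : set 'rV[R]_p) (V : set 'rV[R]_q).
Hypotheses (oU : open U) (oV : open V).

Lemma body_pt_taylor (u : 'rV[R]_p -> 'rV[R]_q) (z : 'I_p -> grassmann R N) :
  body_pt (fun k : 'I_q => gr_taylor (fun x => u x 0 k) z) = u (body_pt z).
Proof. by apply/rowP => k; rewrite mxE gr_body_taylor. Qed.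

(** The induction step is the chain rule: the increments of the inner functions
    are multiples of one square-zero element, so that [gr_taylor_shift] applies
    to h as well. *)
Lemma gr_taylor_comp (h : 'rV[R]_q -> R) (u : 'rV[R]_p -> 'rV[R]_q)
    (z : 'I_p -> grassmann R N) :
  (forall i, gr_parity false (z i)) -> U (body_pt z) ->
  Cinf V h -> (forall x, U x -> V (u x)) -> (forall j, Cinf U (fun x => u x 0 j)) ->
  gr_taylor (h \o u) z = gr_taylor h (fun k => gr_taylor (fun x => u x 0 k) z).
Proof.
move=> ze Uz Ch uUV Cu; move: z ze Uz h Ch.
apply: (soul_ind (Q := fun z => U (body_pt z) -> forall h, Cinf V h ->
  gr_taylor (h \o u) z = gr_taylor h (fun k => gr_taylor (fun x => u x 0 k) z)))
  => [x Ux h Ch|].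
  rewrite [in RHS](_ : (fun k : 'I_q => _) = fun k => (u x 0 k)%:A).
    by rewrite !gr_taylor_real.
  by apply/funext => k; rewrite gr_taylor_real.
move=> z i0 s ze se ss s0 IH; rewrite (body_pt_shift1 z i0 s0) => Uz h Ch.
have Chu : Cinf U (h \o u) by apply: Cinf_comp Ch uUV Cu.
rewrite (gr_taylor_shift1 oU i0 ze ss s0 Chu Uz) (IH Uz _ Ch).
set zu := fun k => gr_taylor (fun x => u x 0 k) z.
pose e k := s * gr_taylor (pderiv i0 (fun x => u x 0 k)) z.
have -> : (fun k => gr_taylor (fun x => u x 0 k) (fun i => z i + (i == i0)%:R *: s))
    = fun k => zu k + e k.
  by apply/funext => k; rewrite (gr_taylor_shift1 oU i0 ze ss s0 (Cu k) Uz).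
have zue k : gr_parity false (zu k) by apply: gr_parity_taylor.
have Vzu : V (body_pt zu) by rewrite body_pt_taylor; apply: uUV.
rewrite (gr_taylor_shift oV) //.
- congr (_ + _).
  rewrite (gr_taylor_congr oU (f := pderiv i0 (h \o u)) (g := fun x =>
    \sum_k pderiv k h (u x) * pderiv i0 (fun y => u y 0 k) x)) //; last first.
    by move=> x Ux; rewrite (pderiv_comp i0 oV (Ch 1%N) uUV (fun k => Cu k 1%N) Ux).
  have CA k : Cinf U (pderiv k h \o u) by apply: Cinf_comp (Cinf_pderiv k Ch) uUV Cu.
  have CB k : Cinf U (pderiv i0 (fun y => u y 0 k)) := Cinf_pderiv i0 (Cu k).
  rewrite (gr_taylor_sum oU) //; last by move=> k _; exact: (CinfM oU (CA k) (CB k)).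
  rewrite mulr_sumr; apply: eq_bigr => k _.
  rewrite (gr_taylorM oU ze Uz (CA k) (CB k)) (IH Uz _ (Cinf_pderiv k Ch)) /e -mulrA.
  by congr (_ * _); apply: gr_even_comm; exact: gr_parity_taylor zue.
- move=> k l; rewrite /e mulrA -(mulrA s) (gr_even_comm _ (gr_parity_taylor ze)).
  by rewrite (mulrA s) ss !mul0r.
- by move=> k; rewrite /e gr_bodyM s0 mul0r.
Qed.

End TaylorComp.

(** * Evaluation of superfunctions at Grassmann-valued points *)

Section SmoothSuper.
Variables (R : realType) (p q : nat) (U : set 'rV[R]_p).
Hypothesis oU : open U.
Implicit Types f g : superfun R p q.

(** Superfunctions are finite sums of these ([stensor_basis]), on which
    evaluation is a Taylor extension times a substitution ([gr_eval_tensor]). *)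
Definition stensor (h : 'rV[R]_p -> R) (c : grassmann R q) : superfun R p q :=
  fun x => h x *: c.

Lemma smooth_congr f g : (forall x, U x -> f x = g x) -> smooth U f -> smooth U g.
Proof.
by move=> fg sf I; apply: (Cinf_congr oU _ (sf I)) => x Ux; rewrite fg.
Qed.

Lemma smooth_tensor h c : Cinf U h -> smooth U (stensor h c).
Proof.
move=> Ch I; apply: (@Cinf_congr _ _ _ oU (fun x => c I * h x)).
  by move=> x _; rewrite /stensor gr_scaleE mulrC.
apply: CinfM => //; exact: Cinf_cst.
Qed.

Lemma smooth_cst c : smooth U (fun=> c : grassmann R q).
Proof. by move=> I; apply: Cinf_cst. Qed.

Lemma smoothD f g : smooth U f -> smooth U g -> smooth U (fun x => f x + g x).
Proof.
move=> sf sg I; apply: (@Cinf_congr _ _ _ oU (fun x => f x I + g x I)).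
  by move=> x _; rewrite ffunE.
exact: CinfD (sf I) (sg I).
Qed.

Lemma smooth_sum (T : Type) (r : seq T) (P : pred T) (F : T -> superfun R p q) :
  (forall i, P i -> smooth U (F i)) -> smooth U (fun x => \sum_(i <- r | P i) F i x).
Proof.
move=> sF I; apply: (@Cinf_congr _ _ _ oU (fun x => \sum_(i <- r | P i) F i x I)).
  by move=> x _; rewrite sum_ffunE.
by apply: Cinf_sum => // i Pi; apply: sF.
Qed.

Lemma smoothM f g : smooth U f -> smooth U g -> smooth U (fun x => f x * g x).
Proof.
move=> sf sg K; apply: (@Cinf_congr _ _ _ oU (fun x =>
    \sum_(I : {set 'I_q} | I \subset K)
     (-1) ^+ inversions I (K :\: I)%SET * f x I * g x (K :\: I)%SET)).
  by move=> x _; rewrite gr_mul_coef.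
apply: Cinf_sum => // I _.
have A : Cinf U (fun x => f x I) := sf I.
have B : Cinf U (fun x => g x (K :\: I)%SET) := sg _.
exact: (CinfM oU (CinfM oU (Cinf_cst U _) A) B).
Qed.

Lemma smooth_prod (T : Type) (r : seq T) (F : T -> superfun R p q) :
  (forall i, smooth U (F i)) -> smooth U (fun x => \prod_(i <- r) F i x).
Proof.
move=> sF; elim: r => [|i r IH].
  by apply: (smooth_congr _ (smooth_cst 1)) => x _; rewrite big_nil.
apply: (smooth_congr _ (smoothM (sF i) IH)) => x _.
by rewrite big_cons.
Qed.

Lemma stensor_basis f x : f x = \sum_I stensor (fun x => f x I) (gr_mono R I) x.
Proof. exact: gr_mono_basis. Qed.

Lemma sderiv_congr c f g x : (forall x, U x -> f x = g x) -> U x ->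
  sderiv c f x = sderiv c g x.
Proof.
move=> fg Ux; case: c => [i|j] /=; last by rewrite fg.
apply/ffunP => I; rewrite !ffunE.
by apply: pderiv_congr Ux => // y Uy; rewrite fg.
Qed.

Lemma sderivD c f g x : smooth U f -> smooth U g -> U x ->
  sderiv c (fun x => f x + g x) x = sderiv c f x + sderiv c g x.
Proof.
move=> sf sg Ux; case: c => [i|j] /=; last by rewrite gr_derivD.
apply/ffunP => I; rewrite !ffunE -(pderivD i (sf I) (sg I) Ux).
by apply: pderiv_congr Ux => // y _; rewrite ffunE.
Qed.

Lemma sderiv_sum c (T : Type) (r : seq T) (P : pred T) (F : T -> superfun R p q) x :
  (forall i, P i -> smooth U (F i)) -> U x ->
  sderiv c (fun x => \sum_(i <- r | P i) F i x) x = \sum_(i <- r | P i) sderiv c (F i) x.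
Proof.
move=> sF Ux; case: c => [i|j] /=; last first.
  by apply: (big_morph (gr_deriv j)); [exact: gr_derivD | exact: gr_deriv0].
apply/ffunP => I; rewrite sum_ffunE ffunE.
transitivity (pderiv i (fun x => \sum_(j <- r | P j) F j x I) x).
  by apply: pderiv_congr Ux => // y _; rewrite sum_ffunE.
rewrite (pderiv_sum oU) //; last by move=> j Pj; apply: sF.
by apply: eq_bigr => j _; rewrite ffunE.
Qed.

Lemma sderiv_tensor_even i h c x : Cinf U h -> U x ->
  sderiv (inl i) (stensor h c) x = stensor (pderiv i h) c x.
Proof.
move=> Ch Ux; apply/ffunP => I; rewrite ffunE /stensor gr_scaleE mulrC.
rewrite -(pderivZ i (c I) Ch Ux).
by apply: pderiv_congr Ux => // y _; rewrite gr_scaleE mulrC.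
Qed.

Lemma sderiv_tensor_odd j h c x :
  sderiv (inr j) (stensor h c) x = stensor h (gr_deriv j c) x.
Proof. exact: gr_derivZ. Qed.

Lemma smooth_sderiv c f : smooth U f -> smooth U (sderiv c f).
Proof.
move=> sf I; case: c => [i|j].
  apply: (@Cinf_congr _ _ _ oU (pderiv i (fun x => f x I))).
    by move=> x _; rewrite ffunE.
  exact: Cinf_pderiv.
case jI: (j \in I).
  apply: (@Cinf_congr _ _ _ oU (fun=> 0)); last exact: Cinf_cst.
  by move=> x _; rewrite ffunE jI.
apply: (@Cinf_congr _ _ _ oU (fun x =>
   (-1) ^+ #|[set i in I | (i < j)%N]%SET| * f x (j |: I)%SET)).
  by move=> x _; rewrite ffunE jI.
have A : Cinf U (fun x => f x (j |: I)%SET) := sf _.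
exact: (CinfM oU (Cinf_cst U _) A).
Qed.

End SmoothSuper.

Section Eval.
Variables (R : realType) (p q N : nat) (U : set 'rV[R]_p).
Hypothesis oU : open U.
Implicit Types (f g : superfun R p q) (z v : 'I_p + 'I_q -> grassmann R N).

Definition even_part z : 'I_p -> grassmann R N := fun i => z (inl i).
Definition odd_part z : 'I_q -> grassmann R N := fun j => z (inr j).

(** The points of the superdomain U with values in the Grassmann algebra on N
    generators. *)
Definition spoint z := [/\ forall i, gr_parity false (z (inl i)),
  forall j, gr_parity true (z (inr j)) & U (body_pt (even_part z))].

Lemma gr_eval_congr f g z : (forall x, U x -> f x = g x) -> spoint z ->
  gr_eval f z = gr_eval g z.
Proof.
move=> fg [_ _ Uz]; apply: eq_bigr => I _; congr (_ * _).
by apply: (gr_taylor_congr oU) Uz => x Ux; rewrite fg.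
Qed.

Lemma gr_evalD f g z : spoint z -> smooth U f -> smooth U g ->
  gr_eval (fun x => f x + g x) z = gr_eval f z + gr_eval g z.
Proof.
move=> [ze zo Uz] sf sg; rewrite /gr_eval -big_split; apply: eq_bigr => I _ /=.
rewrite -mulrDl -(gr_taylorD oU ze Uz (sf I) (sg I)); congr (_ * _).
by apply: (gr_taylor_congr oU) Uz => x _; rewrite ffunE.
Qed.

Lemma gr_eval_sum (T : Type) (r : seq T) (P : pred T) (F : T -> superfun R p q) z :
  spoint z -> (forall i, P i -> smooth U (F i)) ->
  gr_eval (fun x => \sum_(i <- r | P i) F i x) z = \sum_(i <- r | P i) gr_eval (F i) z.
Proof.
move=> [ze zo Uz] sF; rewrite exchange_big; apply: eq_bigr => I _ /=.
rewrite -mulr_suml -(gr_taylor_sum oU r ze Uz (fun i Pi => sF i Pi I)); congr (_ * _).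
by apply: (gr_taylor_congr oU) Uz => x _; rewrite sum_ffunE.
Qed.

Lemma gr_eval_tensor h c z : spoint z -> Cinf U h ->
  gr_eval (stensor h c) z = gr_taylor h (even_part z) * gr_subst (odd_part z) c.
Proof.
move=> [ze zo Uz] Ch; rewrite /gr_subst mulr_sumr; apply: eq_bigr => I _.
rewrite -scalerAr scalerAl -(gr_taylorZ oU (c I) ze Uz Ch); congr (_ * _).
by apply: (gr_taylor_congr oU) Uz => x _; rewrite gr_scaleE mulrC.
Qed.

Lemma gr_eval_basis f z : spoint z -> smooth U f ->
  gr_eval f z = \sum_I gr_eval (stensor (fun x => f x I) (gr_mono R I)) z.
Proof.
move=> sz sf; rewrite -gr_eval_sum //; last by move=> I _; apply/smooth_tensor/sf.
by apply: gr_eval_congr sz => x _; apply: stensor_basis.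
Qed.

Lemma gr_evalM f g z : spoint z -> smooth U f -> smooth U g ->
  gr_eval (fun x => f x * g x) z = gr_eval f z * gr_eval g z.
Proof.
move=> sz sf sg; have [ze zo Uz] := sz.
have tM h h' c c' : Cinf U h -> Cinf U h' ->
    gr_eval (fun x => stensor h c x * stensor h' c' x) z =
    gr_eval (stensor h c) z * gr_eval (stensor h' c') z.
  move=> Ch Ch'; rewrite (@gr_eval_congr _ (stensor (fun x => h x * h' x) (c * c'))) //.
    rewrite !gr_eval_tensor //; last exact: CinfM.
    rewrite (gr_taylorM oU ze Uz Ch Ch') gr_substM // !mulrA; congr (_ * _).
    rewrite -!mulrA; congr (_ * _); apply: gr_even_comm.
    exact: gr_parity_taylor.
  by move=> x _; rewrite /stensor -scalerAl -scalerAr scalerA.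
have st I : smooth U (stensor (fun x => f x I) (gr_mono R I)) by apply/smooth_tensor/sf.
have st' I : smooth U (stensor (fun x => g x I) (gr_mono R I)) by apply/smooth_tensor/sg.
transitivity (gr_eval (fun x => \sum_I \sum_J
   stensor (fun x => f x I) (gr_mono R I) x * stensor (fun x => g x J) (gr_mono R J) x) z).
  apply: gr_eval_congr sz => x _; rewrite [f x]stensor_basis [g x]stensor_basis.
  by rewrite mulr_suml; apply: eq_bigr => I _; rewrite mulr_sumr.
rewrite gr_eval_sum //; last first.
  by move=> I _; apply: smooth_sum => // J _; apply: smoothM.
rewrite (gr_eval_basis sz sf) (gr_eval_basis sz sg) mulr_suml.
apply: eq_bigr => I _; rewrite gr_eval_sum //; last by move=> J _; apply: smoothM.
rewrite mulr_sumr; apply: eq_bigr => J _; exact: tM (sf I) (sg J).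
Qed.

Lemma gr_eval_cst c z : spoint z -> gr_eval (fun=> c) z = gr_subst (odd_part z) c.
Proof.
move=> sz; have [ze zo Uz] := sz.
rewrite (@gr_eval_congr _ (stensor (fun=> 1) c)) //.
  by rewrite gr_eval_tensor //; [rewrite gr_taylor_cst // gr_algM scale1r|exact: Cinf_cst].
by move=> x _; rewrite /stensor scale1r.
Qed.

Lemma gr_eval_prod (T : Type) (r : seq T) (F : T -> superfun R p q) z :
  spoint z -> (forall i, smooth U (F i)) ->
  gr_eval (fun x => \prod_(i <- r) F i x) z = \prod_(i <- r) gr_eval (F i) z.
Proof.
move=> sz sF; elim: r => [|i r IH].
  rewrite big_nil (@gr_eval_congr _ (fun=> 1)) //; last by move=> x _; rewrite big_nil.
  by rewrite gr_eval_cst // gr_subst1.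
rewrite big_cons -IH -gr_evalM //; last exact: smooth_prod.
by apply: gr_eval_congr sz => x _; rewrite big_cons.
Qed.

Lemma gr_eval_scalar h z : spoint z -> Cinf U h ->
  gr_eval (fun x => (h x)%:A) z = gr_taylor h (even_part z).
Proof.
by move=> sz Ch; rewrite (gr_eval_tensor 1 sz Ch) gr_subst1 mulr1.
Qed.

Lemma gr_eval_even_coord i z : spoint z ->
  gr_eval (fun x : 'rV[R]_p => (x 0 i)%:A) z = z (inl i).
Proof.
move=> sz; have [ze zo Uz] := sz; rewrite gr_eval_scalar //; last exact: Cinf_coord.
exact: gr_taylor_coord.
Qed.

Lemma gr_eval_gen j z : spoint z -> gr_eval (fun=> gr_gen R j) z = z (inr j).
Proof. by move=> sz; have [ze zo Uz] := sz; rewrite gr_eval_cst // gr_subst_gen. Qed.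

Lemma gr_eval_real f (x : 'rV[R]_p) z :
  (forall i, z (inl i) = (x 0 i)%:A) -> gr_eval f z = gr_subst (odd_part z) (f x).
Proof.
move=> zE; apply: eq_bigr => I _.
rewrite (_ : (fun i => z (inl i)) = fun i => (x 0 i)%:A); last exact/funext.
by rewrite gr_taylor_real gr_algM.
Qed.

Lemma gr_parity_eval b f z : spoint z -> superfun_parity b f ->
  gr_parity b (gr_eval f z).
Proof.
move=> [ze zo Uz] fb; apply: gr_parity_sum => I _.
have [E|ne] := eqVneq (odd #|I|) b.
  rewrite -E -[odd _]addFb; apply: gr_parityM; first exact: gr_parity_taylor.
  by rewrite oprod_enum cardE; apply: gr_parity_prod.
rewrite (gr_taylor_congr openT (g := fun=> 0)) //.
  by rewrite gr_taylor_cst // scale0r mul0r; apply: gr_parity0.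
by move=> x _; apply/eqP; apply: contraNT ne => /fb ->.
Qed.

End Eval.

Section Shift.
Variables (R : realType) (p q N : nat) (U : set 'rV[R]_p).
Hypothesis oU : open U.
Implicit Types (f g : superfun R p q) (z v : 'I_p + 'I_q -> grassmann R N).

(** An odd parameter times an odd vector field v.  As rho squares to zero, the
    expansions [gr_taylor_shift] in the even and [gr_subst_shift] in the odd
    arguments are exact; the derivatives act from the left because rho is taken
    out on the left. *)
Lemma gr_eval_shift f z v (rho : grassmann R N) :
  spoint U z -> smooth U f -> gr_parity true rho ->
  (forall i, gr_parity true (v (inl i))) -> (forall j, gr_parity false (v (inr j))) ->
  gr_eval f (fun c => z c + rho * v c) =
  gr_eval f z + rho * \sum_c v c * gr_eval (sderiv c f) z.
Proof.
move=> sz sf ro vo ve; have [ze zo Uz] := sz.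
set z' := fun c => z c + rho * v c.
have ee i : gr_parity false (rho * v (inl i)).
  by rewrite -[false]/(true (+) true); apply: gr_parityM.
have e0 i : gr_body (rho * v (inl i)) = 0.
  by rewrite gr_bodyM (gr_body_odd ro) mul0r.
have rr := gr_odd_sq ro.
have eE i j : rho * v (inl i) * (rho * v (inl j)) = 0.
  by rewrite mulrA -(mulrA rho) (gr_odd_anticomm (vo i) ro) mulrN mulrA rr mul0r oppr0 mul0r.
have bz' : body_pt (even_part z') = body_pt (even_part z) by apply: body_pt_shift.
have sz' : spoint U z'.
  split; first by move=> i; apply: gr_parityD.
    move=> j; apply: gr_parityD => //.
    by rewrite -[true]/(true (+) false); apply: gr_parityM.
  by rewrite bz'.
have tS h c : Cinf U h -> gr_eval (stensor h c) z' = gr_eval (stensor h c) z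
    + rho * \sum_d v d * gr_eval (sderiv d (stensor h c)) z.
  move=> Ch; rewrite !(gr_eval_tensor oU) //.
  rewrite (gr_taylor_shift oU (z := even_part z) ze eE e0 Ch Uz).
  rewrite (gr_subst_shift c zo ve ro) big_sumType /=.
  set T := gr_taylor h _; set S := gr_subst _ c.
  have Te : gr_parity false T by apply: gr_parity_taylor.
  have -> : \sum_i v (inl i) * gr_eval (sderiv (inl i) (stensor h c)) z =
      (\sum_i v (inl i) * gr_taylor (pderiv i h) (even_part z)) * S.
    rewrite mulr_suml; apply: eq_bigr => i _; rewrite -mulrA; congr (_ * _).
    rewrite -(gr_eval_tensor oU c sz (Cinf_pderiv i Ch)).
    by apply: (gr_eval_congr oU) sz => x Ux; apply: (sderiv_tensor_even oU i c Ch Ux).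
  have -> : \sum_j v (inr j) * gr_eval (sderiv (inr j) (stensor h c)) z =
      T * \sum_j v (inr j) * gr_subst (odd_part z) (gr_deriv j c).
    rewrite mulr_sumr; apply: eq_bigr => j _.
    rewrite mulrA (gr_even_comm _ Te) -mulrA -(gr_eval_tensor oU (gr_deriv j c) sz Ch).
    congr (_ * _).
    by apply: (gr_eval_congr oU) sz => x Ux; apply: sderiv_tensor_odd.
  have -> : \sum_i rho * v (inl i) * gr_taylor (pderiv i h) (even_part z) =
      rho * \sum_i v (inl i) * gr_taylor (pderiv i h) (even_part z).
    by rewrite mulr_sumr; apply: eq_bigr => i _; rewrite mulrA.
  set A := \sum_i _; set B := \sum_j _.
  have Z : rho * A * (rho * B) = 0.
    have Ao : gr_parity true A.
      apply: gr_parity_sum => i _; rewrite -[true]/(true (+) false).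
      by apply: gr_parityM => //; apply: gr_parity_taylor.
    by rewrite mulrA -(mulrA rho) (gr_odd_anticomm Ao ro) mulrN mulrA rr mul0r oppr0 mul0r.
  rewrite mulrDl !mulrDr Z addr0 -!addrA; congr (_ + _).
  by rewrite addrC !mulrA (gr_even_comm rho Te).
have st I : Cinf U (fun x => f x I) by exact: sf.
rewrite (gr_eval_basis oU sz' sf) (gr_eval_basis oU sz sf).
rewrite (eq_bigr _ (fun I _ => tS _ (gr_mono R I) (st I))) big_split /=; congr (_ + _).
rewrite -mulr_sumr exchange_big; congr (_ * _); apply: eq_bigr => d _ /=.
rewrite -mulr_sumr -(gr_eval_sum oU _ sz); last first.
  by move=> I _; apply/(smooth_sderiv oU)/(smooth_tensor oU).
congr (_ * _); apply: (gr_eval_congr oU) sz => x Ux.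
rewrite -(sderiv_sum oU) //; last by move=> I _; apply: (smooth_tensor oU).
apply: (sderiv_congr oU) Ux => y Uy; exact/esym/stensor_basis.
Qed.

End Shift.

Section EvalComp.
Variables (R : realType) (p q p' q' : nat) (U : set 'rV[R]_p) (U' : set 'rV[R]_p').
Hypotheses (oU : open U) (oU' : open U').
Variables (phi : 'I_p' + 'I_q' -> superfun R p q) (u : 'rV[R]_p -> 'rV[R]_p').
Hypotheses (phiE : forall k x, phi (inl k) x = (u x 0 k)%:A)
  (Cu : forall k, Cinf U (fun x => u x 0 k)) (uU : forall x, U x -> U' (u x))
  (sphi : forall j, smooth U (phi (inr j))).

(** The pullback of f along the morphism of superdomains with coordinate
    functions phi: at each real point, these are a Grassmann-valued point of the
    target. *)
Definition scomp (f : superfun R p' q') : superfun R p q :=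
  fun x => gr_eval f (fun c => phi c x).

Lemma scompE f x : scomp f x =
  \sum_J (f (u x) J)%:A * \prod_(j <- enum J) phi (inr j) x.
Proof.
rewrite /scomp (@gr_eval_real _ _ _ _ f (u x)) // /gr_subst.
by apply: eq_bigr => J _; rewrite gr_algM oprod_enum.
Qed.

Lemma smooth_scomp f : smooth U' f -> smooth U (scomp f).
Proof.
move=> sf; apply: (smooth_congr oU (fun x _ => esym (scompE f x))).
apply: smooth_sum => // J _; apply: smoothM => //.
  apply: (smooth_tensor oU (h := (fun x => f x J) \o u)).
  exact: (Cinf_comp oU oU' (sf J)).
exact: smooth_prod.
Qed.

(** Evaluation is functorial: on the coefficients of f this is [gr_taylor_comp],
    and the products of odd coordinates are preserved by [gr_evalM]. *)
Lemma gr_eval_scomp N f (z : 'I_p + 'I_q -> grassmann R N) :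
  spoint U z -> smooth U' f ->
  gr_eval (scomp f) z = gr_eval f (fun c => gr_eval (phi c) z).
Proof.
move=> sz sf; have [ze zo Uz] := sz.
rewrite (gr_eval_congr oU (fun x _ => scompE f x) sz).
have sA J : smooth U (fun x => (f (u x) J)%:A : grassmann R q).
  apply: (smooth_tensor oU (h := (fun x => f x J) \o u)).
  exact: (Cinf_comp oU oU' (sf J)).
have sB (J : {set 'I_q'}) : smooth U (fun x => \prod_(j <- enum J) phi (inr j) x).
  exact: smooth_prod.
rewrite (gr_eval_sum oU _ sz); last by move=> J _; apply: smoothM.
rewrite [RHS]/gr_eval; apply: eq_bigr => J _.
rewrite (gr_evalM oU sz) // (gr_eval_prod oU _ sz) // oprod_enum; congr (_ * _).
have Cfu : Cinf U ((fun x => f x J) \o u) by exact: (Cinf_comp oU oU' (sf J)).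
rewrite (gr_eval_scalar oU sz Cfu) (gr_taylor_comp oU oU' ze Uz (sf J) uU Cu).
congr gr_taylor; apply/funext => k; rewrite -(gr_eval_scalar oU sz (Cu k)).
by congr gr_eval; apply/funext => x; rewrite phiE.
Qed.

End EvalComp.

(** * Generic points; differential forms at Grassmann-valued points *)

Local Opaque gr_eval.

Section GenericPoints.
Variables (R : realType).

Definition gpt N p q (eps : 'I_q -> grassmann R N) (y : 'rV[R]_p)
    (c : 'I_p + 'I_q) : grassmann R N :=
  match c with inl k => (y 0 k)%:A | inr j => eps j end.

Lemma gr_eval_gpt N p q (eps : 'I_q -> grassmann R N) (f : superfun R p q) y :
  gr_eval f (gpt eps y) = gr_subst eps (f y).
Proof. by rewrite (@gr_eval_real _ _ _ _ f y). Qed.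

Lemma spoint_gpt N p q (eps : 'I_q -> grassmann R N) (U : set 'rV[R]_p) y :
  (forall j, gr_parity true (eps j)) -> U y -> spoint U (gpt eps y).
Proof.
move=> eo Uy; split=> //.
  by move=> i; apply: gr_parity_alg.
by rewrite (_ : body_pt _ = y) //; apply/rowP => i; rewrite mxE gr_body_alg.
Qed.

Lemma gr_subst_id q (c : grassmann R q) : gr_subst (@gr_gen R q) c = c.
Proof.
rewrite {2}(gr_mono_basis c) /gr_subst; apply: eq_bigr => I _.
by rewrite gr_monoE.
Qed.

(** The generic point at y, with the generators as odd coordinates, gives back
    the value at y.  Identities that hold at all Grassmann-valued points
    therefore are identities of superfunctions. *)
Lemma gr_eval_gen_point p q (f : superfun R p q) y :
  gr_eval f (gpt (@gr_gen R q) y) = f y.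
Proof. by rewrite gr_eval_gpt gr_subst_id. Qed.

Lemma spoint_gen_point p q (U : set 'rV[R]_p) y :
  U y -> spoint U (gpt (@gr_gen R q) y).
Proof. by apply: spoint_gpt => j; apply: gr_parity_gen. Qed.

Variable q : nat.

(** The generators inside an algebra with two more, [extra 0] and [extra 1],
    which serve as odd parameters. *)
Definition emb_gen (j : 'I_q) : grassmann R (q + 2) := gr_gen R (lshift 2 j).
Definition extra (i : 'I_2) : grassmann R (q + 2) := gr_gen R (rshift q i).

Lemma emb_gen_odd j : gr_parity true (emb_gen j).
Proof. exact: gr_parity_gen. Qed.

Lemma extra_odd i : gr_parity true (extra i).
Proof. exact: gr_parity_gen. Qed.

Lemma deriv_emb i (c : grassmann R q) :
  gr_deriv (rshift q i) (gr_subst emb_gen c) = 0.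
Proof.
move: c; apply: gr_ind => [|j c IH|a c d IHc IHd].
- by rewrite gr_subst1 gr_deriv1.
- rewrite gr_substM ?gr_subst_gen; try exact: emb_gen_odd.
  by rewrite gr_deriv_gen IH mulr0 subr0 eq_lrshift scale0r.
- by rewrite gr_subst_linear gr_deriv_linear IHc IHd scaler0 addr0.
Qed.

(** Setting the additional generators to zero is a left inverse. *)
Lemma emb_inj (c : grassmann R q) : gr_subst emb_gen c = 0 -> c = 0.
Proof.
pose k (j : 'I_(q + 2)) : grassmann R q :=
  if fintype.split j is inl i then gr_gen R i else 0.
have ko j : gr_parity true (k j).
  rewrite /k; case: fintype.split => i; [exact: gr_parity_gen | exact: gr_parity0].
have kE : gr_subst k (gr_subst emb_gen c) = c.
  move: c; apply: gr_ind => [|j c IH|a c d IHc IHd].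
  - by rewrite !gr_subst1.
  - rewrite gr_substM ?gr_subst_gen; try exact: emb_gen_odd.
    rewrite gr_substM // IH gr_subst_gen //.
    by rewrite /k (unsplitK (inl _ j)).
  - by rewrite !gr_subst_linear IHc IHd.
by move=> c0; rewrite -kE c0 gr_subst0.
Qed.

(** The coefficient of an odd parameter is found by differentiating with respect
    to it. *)
Lemma extra1_inj (c : grassmann R q) : extra 0 * gr_subst emb_gen c = 0 -> c = 0.
Proof.
move=> /(congr1 (gr_deriv (rshift q 0))); rewrite gr_deriv_gen deriv_emb.
by rewrite mulr0 subr0 eqxx scale1r gr_deriv0 => /emb_inj.
Qed.

Lemma extra2_inj (c : grassmann R q) :
  extra 0 * (extra 1 * gr_subst emb_gen c) = 0 -> c = 0.
Proof.
move=> /(congr1 (gr_deriv (rshift q 0))); rewrite !gr_deriv_gen deriv_emb.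
rewrite eqxx scale1r gr_deriv0 eq_rshift /= scale0r mulr0 subr0 mulr0 subr0.
move=> /(congr1 (gr_deriv (rshift q 1))); rewrite gr_deriv_gen deriv_emb.
by rewrite mulr0 subr0 eqxx scale1r gr_deriv0 => /emb_inj.
Qed.

End GenericPoints.

Section Forms.
Variables (R : realType) (p q : nat).

(** The coordinate d c of the superspace on which forms are functions. *)
Definition diff_idx (c : 'I_p + 'I_q) : 'I_(p + q) + 'I_(q + p) :=
  match c with inl i => inr (rshift q i) | inr j => inl (rshift p j) end.

Definition fpoint T (b d : 'I_p + 'I_q -> T) (c : 'I_(p + q) + 'I_(q + p)) : T :=
  match c with
  | inl k => match fintype.split k with inl i => b (inl i) | inr j => d (inr j) end
  | inr k => match fintype.split k with inl j => b (inr j) | inr i => d (inl i) end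
  end.

Lemma fpoint_base T (b d : 'I_p + 'I_q -> T) c : fpoint b d (base_coord c) = b c.
Proof.
by case: c => i /=; [rewrite (unsplitK (inl _ i)) | rewrite (unsplitK (inl _ i))].
Qed.

Lemma fpoint_diff T (b d : 'I_p + 'I_q -> T) c : fpoint b d (diff_idx c) = d c.
Proof.
by case: c => i /=; [rewrite (unsplitK (inr _ i)) | rewrite (unsplitK (inr _ i))].
Qed.

Lemma fpointE T (z : 'I_(p + q) + 'I_(q + p) -> T) :
  fpoint (fun c => z (base_coord c)) (fun c => z (diff_idx c)) = z.
Proof.
by apply/funext => -[k|k] /=; case: (fintype.splitP k) => i E /=;
  congr (z (_ _)); apply: val_inj.
Qed.

Lemma sum_fpoint (V : nmodType) (F : 'I_(p + q) + 'I_(q + p) -> V) :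
  \sum_c F c = \sum_c F (base_coord c) + \sum_c F (diff_idx c).
Proof.
rewrite !big_sumType /= !big_split_ord /= addrACA -!addrA; congr (_ + _).
by congr (_ + _); rewrite addrC.
Qed.

Lemma gr_eval_dcoord N c (z : 'I_(p + q) + 'I_(q + p) -> grassmann R N) :
  spoint setT z -> gr_eval (@dcoord R p q c) z = z (diff_idx c).
Proof.
move=> sz; case: c => i /=; first exact: (gr_eval_gen openT _ sz).
exact: (gr_eval_even_coord openT _ sz).
Qed.

Lemma smooth_dcoord c : smooth setT (@dcoord R p q c).
Proof.
case: c => i /=; first exact: smooth_cst.
apply: (smooth_tensor openT (h := fun y : 'rV[R]_(p + q) => y 0 (rshift p i))).
exact: Cinf_coord.
Qed.

Lemma gr_eval_deRham N (w : superfun R (p + q) (q + p))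
    (z : 'I_(p + q) + 'I_(q + p) -> grassmann R N) :
  spoint setT z -> smooth setT w ->
  gr_eval (deRham w) z =
    \sum_c z (diff_idx c) * gr_eval (sderiv (base_coord c) w) z.
Proof.
move=> sz sw; have sA c := @smooth_dcoord c.
have sB c := smooth_sderiv openT (base_coord c) sw.
rewrite (gr_eval_sum openT _ sz) => [|c _]; last exact: (smoothM openT (sA c) (sB c)).
apply: eq_bigr => c _; rewrite (gr_evalM openT sz (sA c) (sB c)).
by rewrite gr_eval_dcoord.
Qed.

(** On the superspace whose functions are forms, d is the odd vector field with
    components dx along x and 0 along dx; this is its flow. *)
Lemma form_shift N (w : superfun R (p + q) (q + p))
    (z : 'I_(p + q) + 'I_(q + p) -> grassmann R N) rho :
  spoint setT z -> smooth setT w -> gr_parity true rho ->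
  gr_eval w (fpoint (fun c => z (base_coord c) + rho * z (diff_idx c))
                    (fun c => z (diff_idx c)))
  = gr_eval w z + rho * gr_eval (deRham w) z.
Proof.
move=> sz sw ro; have [ze zo _] := sz.
pose v := fpoint (fun c => z (diff_idx c)) (fun c => 0).
have -> : fpoint (fun c => z (base_coord c) + rho * z (diff_idx c))
    (fun c => z (diff_idx c)) = fun c => z c + rho * v c.
  rewrite -[in RHS](fpointE z) /v; apply/funext => -[k|k] /=;
    by case: (fintype.split k) => i; rewrite ?mulr0 ?addr0.
have v1 i : gr_parity true (v (inl i)).
  rewrite /v /=; case: (fintype.split i) => j; first exact: zo.
  exact: gr_parity0.
have v2 i : gr_parity false (v (inr i)).
  rewrite /v /=; case: (fintype.split i) => j; first exact: ze.
  exact: gr_parity0.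
rewrite (gr_eval_shift openT sz sw ro v1 v2) (gr_eval_deRham sz sw).
rewrite sum_fpoint [X in _ * (_ + X)]big1 => [|c _]; last by rewrite /v fpoint_diff mul0r.
by rewrite addr0; congr (_ + _ * _); apply: eq_bigr => c _; rewrite /v fpoint_base.
Qed.

(** The projection from forms to the base, which makes [base_fun] a pullback. *)
Definition base_phi (c : 'I_p + 'I_q) : superfun R (p + q) (q + p) :=
  match c with
  | inl i => fun y => (lsubmx y 0 i)%:A
  | inr j => fun=> gr_gen R (lshift p j)
  end.

Lemma base_funE (f : superfun R p q) : base_fun f = scomp base_phi f.
Proof.
apply/funext => y; rewrite (scompE (u := lsubmx)) //.
apply: eq_bigr => J _; rewrite gr_algM; congr (_ *: _).
by rewrite oprod_enum.
Qed.

Lemma Cinf_lsubmx k : Cinf setT (fun y : 'rV[R]_(p + q) => lsubmx y 0 k).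
Proof.
apply: (@Cinf_congr _ _ _ openT (fun y => y 0 (lshift q k))); last exact: Cinf_coord.
by move=> y _; rewrite mxE.
Qed.

Lemma smooth_base_fun (f : superfun R p q) :
  smooth setT f -> smooth setT (base_fun f).
Proof.
rewrite base_funE; apply: (smooth_scomp openT openT (u := lsubmx)) => //.
- exact: Cinf_lsubmx.
- by move=> j; apply: smooth_cst.
Qed.

Lemma gr_eval_base_fun N (f : superfun R p q)
    (z : 'I_(p + q) + 'I_(q + p) -> grassmann R N) :
  spoint setT z -> smooth setT f ->
  gr_eval (base_fun f) z = gr_eval f (fun c => z (base_coord c)).
Proof.
move=> sz sf; rewrite base_funE.
have E (k : 'I_p) (x : 'rV[R]_(p + q)) : base_phi (inl k) x = (lsubmx x 0 k)%:A by [].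
have sphi j : smooth setT (base_phi (inr j)) by exact: smooth_cst.
rewrite (gr_eval_scomp openT openT E Cinf_lsubmx (fun x _ => I) sphi sz sf).
congr gr_eval; apply/funext => -[i|j]; last exact: (gr_eval_gen openT _ sz).
have -> : base_phi (inl i) = fun y => (y 0 (lshift q i))%:A.
  by apply/funext => y; rewrite E mxE.
exact: (gr_eval_even_coord openT (lshift q i) sz).
Qed.

Lemma smooth_one_form (w : superfun R (p + q) (q + p)) : one_form w -> smooth setT w.
Proof.
move=> [a [sa wE]]; apply: (smooth_congr openT (fun y _ => esym (wE y))).
apply: (smooth_sum openT) => c _; apply: (smoothM openT).
  exact: smooth_dcoord.
exact/smooth_base_fun.
Qed.

Lemma gr_eval_one_form N (w : superfun R (p + q) (q + p)) a
    (z : 'I_(p + q) + 'I_(q + p) -> grassmann R N) :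
  (forall c, smooth setT (a c)) ->
  (forall y, w y = \sum_(c : 'I_p + 'I_q) dcoord c y * base_fun (a c) y) ->
  spoint setT z ->
  gr_eval w z = \sum_c z (diff_idx c) * gr_eval (a c) (fun c => z (base_coord c)).
Proof.
move=> sa wE sz; rewrite (gr_eval_congr openT (fun y _ => wE y) sz).
have sA c := @smooth_dcoord c; have sB c := smooth_base_fun (sa c).
rewrite (gr_eval_sum openT _ sz) => [|c _]; last exact: (smoothM openT (sA c) (sB c)).
apply: eq_bigr => c _; rewrite (gr_evalM openT sz (sA c) (sB c)).
by rewrite gr_eval_dcoord // gr_eval_base_fun.
Qed.

End Forms.

(** * GL(1|1), frames and their normalisation *)

Section Mx2.
Variables (R : realType) (N : nat).
Local Notation G := (grassmann R N).

Definition mx2 (a b c d : G) : 'M[G]_2 :=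
  \matrix_(i, j) if i == 0 then (if j == 0 then a else b) else (if j == 0 then c else d).

Lemma mx2E a b c d : [/\ mx2 a b c d 0 0 = a, mx2 a b c d 0 1 = b,
  mx2 a b c d 1 0 = c & mx2 a b c d 1 1 = d].
Proof. by split; rewrite mxE. Qed.

Lemma ord2P (F : 'I_2) : F = 0 \/ F = 1.
Proof. by case: F => [[|[|k]] lt] //; [left | right]; apply: val_inj. Qed.

Lemma mulmx2 p (g : 'M[G]_2) (X : 'M[G]_(2, p)) F A :
  (g *m X) F A = g F 0 * X 0 A + g F 1 * X 1 A.
Proof.
rewrite mxE big_ord_recl big_ord1; congr (_ + g F _ * X _ A); exact: val_inj.
Qed.

Lemma mx2_eq p (X Y : 'M[G]_(2, p)) :
  (forall A, X 0 A = Y 0 A) -> (forall A, X 1 A = Y 1 A) -> X = Y.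
Proof. by move=> H0 H1; apply/matrixP => F A; case: (ord2P F) => ->. Qed.

Lemma mx2_eta (g : 'M[G]_2) : g = mx2 (g 0 0) (g 0 1) (g 1 0) (g 1 1).
Proof.
apply/matrixP => F A; rewrite mxE.
by case: (ord2P F) => ->; case: (ord2P A) => ->.
Qed.

Lemma mulmx22 a b c d a' b' c' d' : mx2 a b c d *m mx2 a' b' c' d' =
  mx2 (a * a' + b * c') (a * b' + b * d') (c * a' + d * c') (c * b' + d * d').
Proof.
by apply: mx2_eq => A; rewrite mulmx2 !mxE /=; case: (ord2P A) => ->.
Qed.

Lemma mx2_1 : mx2 1 0 0 1 = 1%:M.
Proof. by apply: mx2_eq => A; rewrite !mxE; case: (ord2P A) => ->. Qed.

Lemma mx2_parity a b c d : gr_parity false a -> gr_parity true b ->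
  gr_parity true c -> gr_parity false d ->
  forall F K : 'I_2, gr_parity (odd F (+) odd K) (mx2 a b c d F K).
Proof.
by move=> pa pb pc pd F K; rewrite mxE; case: (ord2P F) => ->; case: (ord2P K) => ->.
Qed.

Lemma GL11_upper a b d : gr_parity false a -> gr_parity true b ->
  gr_parity false d -> a \is a GRing.unit -> d \is a GRing.unit ->
  GL11 (mx2 a b 0 d).
Proof.
move=> pa pb pd ua ud; split.
  by apply: mx2_parity => //; exact: gr_parity0.
exists (mx2 a^-1 (- (a^-1 * b * d^-1)) 0 d^-1); rewrite !mulmx22 -!mx2_1.
rewrite !mul0r !mulr0 !addr0 !add0r !divrr // !mulVr //; split; congr mx2.
  by rewrite mulrN !mulrA divrr // mul1r addrC subrr.
by rewrite mulNr -!mulrA mulVr // mulr1 subrr.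
Qed.

Lemma GL11_lower r : gr_parity true r -> GL11 (mx2 1 0 r 1).
Proof.
move=> pr; split.
  by apply: mx2_parity => //; [exact: gr_parity1 | exact: gr_parity0 | exact: gr_parity1].
exists (mx2 1 0 (- r) 1); rewrite !mulmx22 -!mx2_1.
rewrite !mul0r !mulr0 !addr0 !add0r !mulr1 !mul1r.
by rewrite subrr addrC subrr.
Qed.

Lemma Ber_upper a b d : Ber (mx2 a b 0 d) = a * d^-1.
Proof. by have [h1 h2 h3 h4] := mx2E a b 0 d; rewrite /Ber h1 h2 h3 h4 mulr0 subr0. Qed.

Lemma Ber_lower r : Ber (mx2 1 0 r 1) = 1.
Proof.
have [h1 h2 h3 h4] := mx2E 1 0 r 1; rewrite /Ber h1 h2 h3 h4.
by rewrite !mul0r subr0 invr1 mulr1.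
Qed.

Lemma GL11_parity (g : 'M[G]_2) : GL11 g ->
  [/\ gr_parity false (g 0 0), gr_parity true (g 0 1), gr_parity true (g 1 0)
    & gr_parity false (g 1 1)].
Proof. by move=> [pg _]; split; apply: pg. Qed.

(** Modulo nilpotents g is diagonal. *)
Lemma GL11_unit (g : 'M[G]_2) : GL11 g -> g 1 1 \is a GRing.unit.
Proof.
move=> gg; have [_ _ po _] := GL11_parity gg; have [_ [h [gh _]]] := gg.
have := congr1 (fun M : 'M[G]_2 => gr_body (M 1 1)) gh.
rewrite mulmx2 mxE eqxx gr_bodyD !gr_bodyM (gr_body_odd po) mul0r add0r gr_body1.
move=> E; rewrite gr_unitE; apply/eqP => z; move: E; rewrite z mul0r => /eqP.
by rewrite eq_sym oner_eq0.
Qed.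

Lemma GL11_mul (g h : 'M[G]_2) : GL11 g -> GL11 h -> GL11 (g *m h).
Proof.
move=> gg gh; have [g1 g2 g3 g4] := GL11_parity gg; have [h1 h2 h3 h4] := GL11_parity gh.
split.
  rewrite [g *m h]mx2_eta; apply: mx2_parity; rewrite mulmx2.
  - apply: gr_parityD; first exact: (gr_parityM (b := false) (c := false)).
    exact: (gr_parityM (b := true) (c := true)).
  - apply: gr_parityD; first exact: (gr_parityM (b := false) (c := true)).
    exact: (gr_parityM (b := true) (c := false)).
  - apply: gr_parityD; first exact: (gr_parityM (b := true) (c := false)).
    exact: (gr_parityM (b := false) (c := true)).
  - apply: gr_parityD; first exact: (gr_parityM (b := true) (c := true)).
    exact: (gr_parityM (b := false) (c := false)).
case: gg gh => _ [g' [gg' g'g]] [_ [h' [hh' h'h]]]; exists (h' *m g'); split.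
  by rewrite -mulmxA (mulmxA h) hh' mul1mx.
by rewrite -mulmxA (mulmxA g') g'g mul1mx.
Qed.

End Mx2.

Section Frames.
Variables (R : realType) (n m : nat).

Lemma frame_coord_surj (c : 'I_(n + m) + 'I_(m + n)) :
  exists F A, c = frame_coord F A.
Proof.
case: c => k; case: (fintype.splitP k) => i E.
- exists 0, (lshift m i); rewrite /frame_coord (unsplitK (inl _ i)) eqxx.
  by congr inl; apply: val_inj.
- exists 1, (rshift n i); rewrite /frame_coord (unsplitK (inr _ i)) /=.
  by congr inl; apply: val_inj.
- exists 0, (rshift n i); rewrite /frame_coord (unsplitK (inr _ i)) eqxx.
  by congr inr; apply: val_inj.
- exists 1, (lshift m i); rewrite /frame_coord (unsplitK (inl _ i)) /=.
  by congr inr; apply: val_inj.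
Qed.

Variable N : nat.
Local Notation G := (grassmann R N).
Implicit Types (X Y : 'M[G]_(2, n + m)).

Definition frame_of (z : 'I_(n + m) + 'I_(m + n) -> G) : 'M[G]_(2, n + m) :=
  \matrix_(F, A) z (frame_coord F A).

Lemma frame_point_of z : frame_point (frame_of z) = z.
Proof.
apply/funext => c; have [F [A ->]] := frame_coord_surj c.
by rewrite frame_pointE mxE.
Qed.

Lemma idx_parity_lshift a : idx_parity (lshift m a : 'I_(n + m)) = false.
Proof. by rewrite /idx_parity (unsplitK (inl _ a)). Qed.

Lemma idx_parity_rshift nu : idx_parity (rshift n nu : 'I_(n + m)) = true.
Proof. by rewrite /idx_parity (unsplitK (inr _ nu)). Qed.

Lemma spoint_frame X : is_frame X ->
  spoint (@nondegenerate_frames R n m) (frame_point X).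
Proof.
move=> [pX [mu umu]]; split.
- move=> k /=; case: (fintype.split k) => i.
    by have := pX 0 (lshift m i); rewrite idx_parity_lshift.
  by have := pX 1 (rshift n i); rewrite idx_parity_rshift.
- move=> k /=; case: (fintype.split k) => i.
    by have := pX 0 (rshift n i); rewrite idx_parity_rshift.
  by have := pX 1 (lshift m i); rewrite idx_parity_lshift.
- by exists mu; rewrite mxE /even_part /= (unsplitK (inr _ mu)) -gr_unitE.
Qed.

Lemma is_frame_of z (U : set 'rV[R]_(n + m)) : U `<=` @nondegenerate_frames R n m ->
  spoint U z -> is_frame (frame_of z).
Proof.
move=> UF [ze zo /UF[mu wmu]]; split.
  move=> F A; rewrite mxE /frame_coord /idx_parity.
  by case: (ord2P F) => ->; case: (fintype.split A) => i /=;
    first [exact: ze | exact: zo].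
exists mu; rewrite mxE /frame_coord (unsplitK (inr _ mu)) /= gr_unitE.
by move: wmu; rewrite mxE.
Qed.

Lemma is_frame_mul (g : 'M[G]_2) X : GL11 g -> is_frame X -> is_frame (g *m X).
Proof.
move=> gg [pX [mu umu]]; have u11 := GL11_unit gg.
have [pg _] := gg; split.
  move=> F A; rewrite mulmx2; apply: gr_parityD.
    by have := gr_parityM (pg F 0) (pX 0 A); rewrite /= addbF.
  have := gr_parityM (pg F 1) (pX 1 A).
  by rewrite /= addbT; case: (odd F); case: idx_parity.
exists mu; rewrite mulmx2 gr_unitE gr_bodyD !gr_bodyM.
have [_ _ po _] := GL11_parity gg; rewrite (gr_body_odd po) mul0r add0r mulf_neq0 //.
Qed.

End Frames.

Section Charts.
Variables (R : realType) (n m : nat).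

(** The homogeneous coordinate that becomes the coordinate c of the chart mu. *)
Definition home (mu : 'I_m) (c : 'I_m.-1 + 'I_n) : 'I_(n + m) :=
  match c with inl k => rshift n (lift mu k) | inr a => lshift m a end.

(** The inverse of [home], undefined at mu itself. *)
Definition chart_idx (mu : 'I_m) (A : 'I_(n + m)) : option ('I_m.-1 + 'I_n) :=
  match fintype.split A with
  | inl a => Some (inr a)
  | inr nu => omap inl (unlift mu nu)
  end.

Lemma chart_idx_home mu c : chart_idx mu (home mu c) = Some c.
Proof.
case: c => i; rewrite /chart_idx /=.
  by rewrite (unsplitK (inr _ _)) liftK.
by rewrite (unsplitK (inl _ _)).
Qed.

Lemma chart_idx_pole mu : chart_idx mu (rshift n mu) = None.
Proof. by rewrite /chart_idx (unsplitK (inr _ _)) unlift_none. Qed.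

Lemma home_or_pole mu A : A = rshift n mu \/ exists c, A = home mu c.
Proof.
case: (fintype.splitP A) => i E.
  by right; exists (inr i); apply: val_inj.
have -> : A = rshift n i by apply: val_inj.
case: (unliftP mu i) => [k ->|->]; last by left.
by right; exists (inl k).
Qed.

Variable N : nat.
Local Notation G := (grassmann R N).
Implicit Types (X Y : 'M[G]_(2, n + m)) (z : 'I_(m.-1 + n) + 'I_(n + m.-1) -> G).

(** The frame w = (1 : u : eta), x = (0 : du : d eta), that is, the pair (w, dw)
    on the chart w^mu = 1. *)
Definition chart_frame mu z : 'M[G]_(2, n + m) :=
  \matrix_(F, A) if chart_idx mu A is Some c
    then (if F == 0 then z (diff_idx c) else z (base_coord c)) else (F != 0)%:R.

Definition chart_point mu Y : 'I_(m.-1 + n) + 'I_(n + m.-1) -> G :=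
  fpoint (fun c => Y 1 (home mu c)) (fun c => Y 0 (home mu c)).

Lemma chart_frame_home mu z c : chart_frame mu z 0 (home mu c) = z (diff_idx c)
  /\ chart_frame mu z 1 (home mu c) = z (base_coord c).
Proof. by split; rewrite mxE chart_idx_home. Qed.

Lemma chart_frame_pole mu z : chart_frame mu z 0 (rshift n mu) = 0
  /\ chart_frame mu z 1 (rshift n mu) = 1.
Proof. by split; rewrite mxE chart_idx_pole. Qed.

Lemma chart_frameK mu z : chart_point mu (chart_frame mu z) = z.
Proof.
rewrite /chart_point -[RHS]fpointE; congr fpoint; apply/funext => c.
  by rewrite (chart_frame_home mu z c).2.
by rewrite (chart_frame_home mu z c).1.
Qed.

Lemma chart_pointK mu Y : Y 0 (rshift n mu) = 0 -> Y 1 (rshift n mu) = 1 ->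
  chart_frame mu (chart_point mu Y) = Y.
Proof.
move=> Y0 Y1; apply: mx2_eq => A; case: (home_or_pole mu A) => [->|[c ->]].
- by rewrite Y0 (chart_frame_pole mu _).1.
- by rewrite (chart_frame_home mu _ c).1 /chart_point fpoint_diff.
- by rewrite Y1 (chart_frame_pole mu _).2.
- by rewrite (chart_frame_home mu _ c).2 /chart_point fpoint_base.
Qed.

Lemma idx_parity_home mu c :
  idx_parity (home mu c) = if c is inl _ then true else false.
Proof. by case: c => i /=; rewrite ?idx_parity_lshift ?idx_parity_rshift. Qed.

Lemma is_frame_chart mu z : spoint setT z -> is_frame (chart_frame mu z).
Proof.
move=> [ze zo _]; split; last first.
  by exists mu; rewrite (chart_frame_pole mu z).2 unitr1.
move=> F A; case: (home_or_pole mu A) => [->|[c ->]].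
  rewrite idx_parity_rshift; case: (ord2P F) => ->.
    by rewrite (chart_frame_pole mu z).1; apply: gr_parity0.
  by rewrite (chart_frame_pole mu z).2; apply: gr_parity1.
rewrite idx_parity_home; case: (ord2P F) => ->.
  by rewrite (chart_frame_home mu z c).1; case: c => i /=.
by rewrite (chart_frame_home mu z c).2; case: c => i /=.
Qed.

Lemma spoint_chart mu Y : is_frame Y -> spoint setT (chart_point mu Y).
Proof.
move=> [pY _]; split=> // k /=; case: (fintype.split k) => i.
- by have := pY 1 (home mu (inl i)); rewrite idx_parity_home.
- by have := pY 0 (home mu (inr i)); rewrite idx_parity_home.
- by have := pY 1 (home mu (inr i)); rewrite idx_parity_home.
- by have := pY 0 (home mu (inl i)); rewrite idx_parity_home.
Qed.

(** Brings X to the form w^mu = 1, x^mu = 0.  Dividing x by w^mu as well makes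
    the Berezinian 1 and turns the new x into the value of the quotient rule for
    d (w / w^mu) at dw = x. *)
Definition norm_mx mu X : 'M[G]_2 :=
  let w := X 1 (rshift n mu) in let x := X 0 (rshift n mu) in
  mx2 w^-1 (- (w^-1 * w^-1 * x)) 0 w^-1.

Lemma frame_pole_parity mu X : is_frame X ->
  gr_parity false (X 1 (rshift n mu)) /\ gr_parity true (X 0 (rshift n mu)).
Proof.
move=> [pX _]; split.
  by have := pX 1 (rshift n mu); rewrite idx_parity_rshift.
by have := pX 0 (rshift n mu); rewrite idx_parity_rshift.
Qed.

Lemma GL11_norm mu X : is_frame X -> X 1 (rshift n mu) \is a GRing.unit ->
  GL11 (norm_mx mu X).
Proof.
move=> fX uw; have [pw px] := frame_pole_parity mu fX.
have pwV := gr_parityV pw.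
apply: GL11_upper; rewrite ?unitrV //.
apply/gr_parityN; apply: (gr_parityM (b := false) (c := true)) => //.
exact: (gr_parityM (b := false) (c := false)).
Qed.

Lemma Ber_norm mu X : X 1 (rshift n mu) \is a GRing.unit -> Ber (norm_mx mu X) = 1.
Proof. by move=> uw; rewrite Ber_upper divrr ?unitrV. Qed.

Lemma norm_mxE mu X A :
  let w := X 1 (rshift n mu) in let x := X 0 (rshift n mu) in
  (norm_mx mu X *m X) 0 A = w^-1 * X 0 A - w^-1 * w^-1 * x * X 1 A /\
  (norm_mx mu X *m X) 1 A = w^-1 * X 1 A.
Proof.
move=> w x; have [h1 h2 h3 h4] := mx2E w^-1 (- (w^-1 * w^-1 * x)) 0 w^-1.
by split; rewrite mulmx2 /norm_mx ?(h1, h2, h3, h4) ?mul0r ?add0r // mulNr.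
Qed.

Lemma norm_mx_pole mu X : is_frame X -> X 1 (rshift n mu) \is a GRing.unit ->
  (norm_mx mu X *m X) 0 (rshift n mu) = 0 /\ (norm_mx mu X *m X) 1 (rshift n mu) = 1.
Proof.
move=> fX uw; have [-> ->] := norm_mxE mu X (rshift n mu); rewrite mulVr //; split=> //.
have [pw px] := frame_pole_parity mu fX.
by rewrite -[_ * _ * X 1 _]mulrA -(gr_even_comm _ pw) -!mulrA mulKr // subrr.
Qed.

(** The chart coordinates of a frame and their differentials. *)
Definition psi mu X := chart_point mu (norm_mx mu X *m X).

Lemma psiK mu X : is_frame X -> X 1 (rshift n mu) \is a GRing.unit ->
  chart_frame mu (psi mu X) = norm_mx mu X *m X.
Proof. by move=> fX uw; have [h0 h1] := norm_mx_pole fX uw; rewrite chart_pointK. Qed.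

Lemma spoint_psi mu X : is_frame X -> X 1 (rshift n mu) \is a GRing.unit ->
  spoint setT (psi mu X).
Proof. by move=> fX uw; apply/spoint_chart/is_frame_mul => //; apply: GL11_norm. Qed.

End Charts.

(** * Superderivatives in the coordinates of frames *)

Section SuperDerivatives.
Variables (R : realType) (p q : nat) (U : set 'rV[R]_p).
Hypothesis oU : open U.
Implicit Types (f : superfun R p q) (c : 'I_p + 'I_q).

Definition codd c : bool := if c is inr _ then true else false.

Definition coordf c : superfun R p q := fun y => gpt (@gr_gen R q) y c.

Lemma smooth_coordf c : smooth U (coordf c).
Proof.
case: c => i; last exact: smooth_cst.
apply: (smooth_tensor oU (h := fun y : 'rV[R]_p => y 0 i)).
exact: Cinf_coord.
Qed.

Lemma gr_eval_coordf N c (z : 'I_p + 'I_q -> grassmann R N) : spoint U z ->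
  gr_eval (coordf c) z = z c.
Proof.
move=> sz; case: c => i; first exact: (gr_eval_even_coord oU i sz).
exact: (gr_eval_gen oU i sz).
Qed.

Lemma sderiv_evenE i f y I :
  sderiv (inl i) f y I = pderiv i (fun x => f x I) y.
Proof. exact: ffunE. Qed.

Lemma sderiv_oddE j f y I : sderiv (inr j) f y I =
  if j \in I then 0 else
    (-1) ^+ #|[set i in I | (i < j)%N]%SET| * f y (j |: I)%SET.
Proof. exact: ffunE. Qed.

Lemma sderiv0 c y : sderiv c (fun=> 0 : grassmann R q) y = 0.
Proof.
case: c => i /=; last exact: gr_deriv0.
apply/ffunP => I; rewrite !ffunE -[RHS](pderiv_cst i 0 y).
by congr (pderiv _ _ _); apply/funext => x; rewrite ffunE.
Qed.

Lemma sderiv_sign c b f y : smooth U f -> U y ->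
  sderiv c (fun y => (-1) ^+ b *: f y) y = (-1) ^+ b *: sderiv c f y.
Proof.
move=> sf Uy; case: c => i /=; last exact: gr_derivZ.
apply/ffunP => I; rewrite ffunE gr_scaleE ffunE -(pderivZ i _ (sf I) Uy).
by congr (pderiv _ _ _); apply/funext => x; rewrite gr_scaleE.
Qed.

Lemma sderiv_coordfM c c' f y : smooth U f -> U y ->
  sderiv c (fun y => coordf c' y * f y) y =
  (c == c')%:R *: f y + (-1) ^+ (codd c && codd c') *: (coordf c' y * sderiv c f y).
Proof.
move=> sf Uy; case: c => i; case: c' => j; rewrite /coordf /=.
- rewrite gr_algM expr0 scale1r; apply/ffunP => I.
  rewrite ffunE [RHS]ffunE !gr_scaleE ffunE.
  have -> : (inl i == inl j :> 'I_p + 'I_q) = (i == j) by [].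
  have := pderivM i (Cinf_coord U j) (sf I) Uy.
  rewrite pderiv_coord => <-.
  by congr (pderiv _ _ _); apply/funext => x; rewrite gr_algM gr_scaleE.
- rewrite scale0r add0r expr0 scale1r; apply/ffunP => I; rewrite ffunE gr_gen_mul.
  case: ifP => jI; last first.
    rewrite -[RHS](pderiv_cst i 0 y); congr (pderiv _ _ _).
    by apply/funext => x; rewrite gr_gen_mul jI.
  rewrite ffunE -(pderivZ i _ (sf _) Uy); congr (pderiv _ _ _).
  by apply/funext => x; rewrite gr_gen_mul jI.
- by rewrite scale0r add0r expr0 scale1r !gr_algM gr_derivZ.
- by rewrite gr_deriv_gen expr1 scaleN1r eq_sym.
Qed.

Lemma sderivC c c' f y : smooth U f -> U y ->
  sderiv c (sderiv c' f) y = (-1) ^+ (codd c && codd c') *: sderiv c' (sderiv c f) y.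
Proof.
have mixed i j : smooth U f -> U y ->
    sderiv (inl i) (sderiv (inr j) f) y = sderiv (inr j) (sderiv (inl i) f) y.
  move=> sf Uy; apply/ffunP => I; rewrite !ffunE.
  case jI: (j \in I).
    rewrite -[RHS](pderiv_cst i 0 y); congr (pderiv _ _ _).
    by apply/funext => x; rewrite ffunE jI.
  rewrite -(pderivZ i _ (sf _) Uy); congr (pderiv _ _ _).
  by apply/funext => x; rewrite ffunE jI.
move=> sf Uy; case: c => i; case: c' => j /=; rewrite ?expr0 ?expr1 ?scale1r ?scaleN1r.
- apply/ffunP => I.
  have E (k : 'I_p) : (fun y => sderiv (inl k) f y I) = pderiv k (fun y => f y I).
    by apply/funext => x; exact: ffunE.
  have E2 (k l : 'I_p) : sderiv (inl k) (sderiv (inl l) f) y I =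
      pderiv k (pderiv l (fun y => f y I)) y.
    rewrite -E; exact: ffunE.
  apply: etrans (E2 i j) _; apply: etrans _ (esym (E2 j i)).
  exact: (pderivC i j oU Uy (sf I 2%N)).
- exact: mixed.
- exact/esym/mixed.
- exact: gr_derivC.
Qed.

End SuperDerivatives.

Section FrameSums.
Variables (R : realType) (n m : nat).

Lemma frame_coord_lshift F a : @frame_coord n m F (lshift m a) =
  if F == 0 then inl (lshift m a) else inr (rshift m a).
Proof. by rewrite /frame_coord (unsplitK (inl _ a)). Qed.

Lemma frame_coord_rshift F nu : @frame_coord n m F (rshift n nu) =
  if F == 0 then inr (lshift n nu) else inl (rshift n nu).
Proof. by rewrite /frame_coord (unsplitK (inr _ nu)). Qed.

Lemma sum_frame (V : nmodType) (F : 'I_(n + m) + 'I_(m + n) -> V) :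
  \sum_c F c = \sum_A F (frame_coord 0 A) + \sum_A F (frame_coord 1 A).
Proof.
rewrite big_sumType /= !big_split_ord /=.
under [in RHS]eq_bigr => a _ do rewrite frame_coord_lshift /=.
under [X in _ = (_ + X) + _]eq_bigr => a _ do rewrite frame_coord_rshift /=.
under [X in _ = _ + (X + _)]eq_bigr => a _ do rewrite frame_coord_lshift /=.
under [X in _ = _ + (_ + X)]eq_bigr => a _ do rewrite frame_coord_rshift /=.
rewrite -!addrA; congr (_ + _).
by rewrite addrCA; congr (_ + _); rewrite addrC.
Qed.

Lemma codd_frame (F : 'I_2) A : codd (@frame_coord n m F A) = odd F (+) idx_parity A.
Proof.
case: (fintype.splitP A) => i E.
  have -> : A = lshift m i by apply: val_inj.
  by rewrite frame_coord_lshift idx_parity_lshift; case: (ord2P F) => ->.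
have -> : A = rshift n i by apply: val_inj.
by rewrite frame_coord_rshift idx_parity_rshift; case: (ord2P F) => ->.
Qed.

Lemma frame_coord_inj (F G : 'I_2) A B :
  (@frame_coord n m F A == frame_coord G B) = (F == G) && (A == B).
Proof.
apply/eqP/andP => [|[/eqP-> /eqP->]] //.
(* The coordinates of elementary matrices tell the indices apart. *)
have K (H : 'I_2) C : frame_point (\matrix_(F, A)
    ((F == H)%:R * (A == C)%:R : grassmann R 0)) (frame_coord F A) =
    (F == H)%:R * (A == C)%:R by rewrite frame_pointE mxE.
move=> E; have := K G B; rewrite E frame_pointE mxE !eqxx mulr1.
by case: (F == G); case: (A == B); rewrite ?mulr0 ?mul0r => // /eqP;
  rewrite oner_eq0.
Qed.

Lemma open_coord_neq0 p (k : 'I_p) : open [set x : 'rV[R]_p | x 0 k != 0].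
Proof.
have -> : [set x : 'rV[R]_p | x 0 k != 0] = (fun x : 'rV[R]_p => x 0 k) @^-1` [set t | t != 0].
  by [].
apply: open_comp; last exact: open_neq.
by move=> x _; apply/differentiable_continuous/differentiable_coord.
Qed.

Lemma open_nondegenerate : open (@nondegenerate_frames R n m).
Proof.
have -> : @nondegenerate_frames R n m =
    \bigcup_(mu in [set: 'I_m]) [set x : 'rV[R]_(n + m) | x 0 (rshift n mu) != 0].
  by apply/seteqP; split=> x [mu]; [move=> h; exists mu | move=> _ h; exists mu].
by apply: bigcup_open => mu _; apply: open_coord_neq0.
Qed.

End FrameSums.

(** * Infinitesimal consequences of Berezinian homogeneity *)

Local Opaque sderiv.

Section BerConsequences.
Variables (R : realType) (n m : nat).
Local Notation U := (@nondegenerate_frames R n m).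
Local Notation q := (m + n)%N.
Local Notation oU := (@open_nondegenerate R n m).

Variable L : superfun R (n + m) (m + n).
Hypotheses (sL : smooth U L) (bL : BER L).

Lemma BER_point N (g : 'M[grassmann R N]_2) z : GL11 g -> spoint U z ->
  gr_eval L (frame_point (g *m frame_of z)) = gr_eval L z * Ber g.
Proof.
move=> gg sz; rewrite bL ?frame_point_of //.
exact: (is_frame_of _ sz).
Qed.

Local Notation emb y := (gpt (@emb_gen R q) y).

Lemma spoint_emb y : U y -> spoint U (emb y).
Proof. by apply: spoint_gpt => j; apply: emb_gen_odd. Qed.

Lemma gr_eval_emb (f : superfun R (n + m) (m + n)) y : gr_eval f (emb y) = gr_subst (@emb_gen R q) (f y).
Proof. exact: gr_eval_gpt. Qed.

Lemma eq_point N (z z' : 'I_(n + m) + 'I_(m + n) -> grassmann R N) :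
  (forall A, z (frame_coord 0 A) = z' (frame_coord 0 A)) ->
  (forall A, z (frame_coord 1 A) = z' (frame_coord 1 A)) -> z = z'.
Proof.
move=> H0 H1; apply/funext => c; have [F [A ->]] := frame_coord_surj c.
by case: (ord2P F) => ->.
Qed.

(** The tangent vector with components v along one row; the sum has at most one
    term. *)
Definition dir (F : 'I_2) N (v : 'I_(n + m) -> grassmann R N) (c : 'I_(n + m) + 'I_(m + n)) :=
  \sum_(A | frame_coord F A == c) v A.

Lemma dirE F N (v : 'I_(n + m) -> grassmann R N) G A :
  dir F v (frame_coord G A) = if F == G then v A else 0.
Proof.
rewrite /dir; case: eqP => [<-|FG].
  by rewrite (big_pred1 A) // => B; rewrite (frame_coord_inj R) eqxx.
by rewrite big_pred0 // => B; rewrite (frame_coord_inj R); move/eqP/negPf: FG => ->.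
Qed.

Lemma gr_eval_dir (F : 'I_2) (f : superfun R (n + m) (m + n)) y
    (v : 'I_(n + m) -> grassmann R (q + 2)) rho :
  U y -> smooth U f -> gr_parity true rho ->
  (forall A, gr_parity (~~ odd F (+) idx_parity A) (v A)) ->
  gr_eval f (fun c => emb y c + rho * dir F v c) =
  gr_eval f (emb y) +
    rho * \sum_A v A * gr_eval (sderiv (frame_coord F A) f) (emb y).
Proof.
move=> Uy sf ro pv; have pd c : gr_parity (~~ codd c) (dir F v c).
  apply: gr_parity_sum => A /eqP <-; rewrite codd_frame -addNb.
  exact: pv.
rewrite (gr_eval_shift oU (spoint_emb Uy) sf ro) => [|i|j];
  [|exact: (pd (inl i))|exact: (pd (inr j))].
congr (_ + _ * _); rewrite sum_frame.
case: (ord2P F) => ->; [rewrite [X in _ + X]big1 ?addr0|rewrite [X in X + _]big1 ?add0r].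
- by apply: eq_bigr => A _; rewrite dirE.
- by move=> A _; rewrite dirE mul0r.
- by apply: eq_bigr => A _; rewrite dirE.
- by move=> A _; rewrite dirE mul0r.
Qed.

Lemma gr_eval_emb_sum (F c0 : 'I_2) (f : superfun R (n + m) (m + n)) y : U y -> smooth U f ->
  \sum_A emb y (frame_coord c0 A) * gr_eval (sderiv (frame_coord F A) f) (emb y) =
  gr_subst (@emb_gen R q)
    (\sum_A coordf (frame_coord c0 A) y * sderiv (frame_coord F A) f y).
Proof.
move=> Uy sf; rewrite gr_subst_sum; apply: eq_bigr => A _.
rewrite gr_substM; last exact: emb_gen_odd.
rewrite -!gr_eval_emb (gr_eval_coordf oU _ (spoint_emb Uy)) //.
Qed.

Lemma emb_parity (y : 'rV[R]_(n + m)) (c : 'I_(n + m) + 'I_q) : gr_parity (codd c) (emb y c).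
Proof. by case: c => i /=; [apply: gr_parity_alg | apply: gr_parity_gen]. Qed.

(** The lower unitriangular element of odd entry r has Berezinian 1 and moves w
    by r x; this is the coefficient of r. *)
Lemma BER_D y : U y ->
  \sum_A coordf (frame_coord 0 A) y * sderiv (frame_coord 1 A) L y = 0.
Proof.
move=> Uy; apply: extra1_inj; rewrite -gr_eval_emb_sum //.
set r := extra R q 0; have ro : gr_parity true r by apply: extra_odd.
have := BER_point (GL11_lower ro) (spoint_emb Uy); rewrite Ber_lower mulr1.
have -> : frame_point (mx2 1 0 r 1 *m frame_of (emb y)) =
    fun c => emb y c + r * dir 1 (fun A => emb y (frame_coord 0 A)) c.
  have [h1 h2 h3 h4] := mx2E 1 0 r 1.
  apply: eq_point => A; rewrite frame_pointE mulmx2 !dirE ?(h1, h2, h3, h4).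
    by rewrite !mxE mul1r mul0r mulr0.
  by rewrite !mxE mul1r addrC.
rewrite gr_eval_dir // => [|A].
  by move/eqP; rewrite -subr_eq0 addrAC subrr add0r => /eqP.
by have := @emb_parity y (frame_coord 0 A); rewrite codd_frame.
Qed.

(** The coefficient of r r' in BER for diag(1 + r r', 1), where r and r' are odd
    parameters. *)
Lemma BER_euler y : U y ->
  L y = \sum_A coordf (frame_coord 0 A) y * sderiv (frame_coord 0 A) L y.
Proof.
move=> Uy; apply/eqP; rewrite eq_sym -subr_eq0; apply/eqP.
set S := \sum_A _; apply: extra2_inj.
set r := extra R q 0; have ro : gr_parity true r by apply: extra_odd.
set r' := extra R q 1; have ro' : gr_parity true r' by apply: extra_odd.
have rre : gr_parity false (r * r') by exact: (gr_parityM (b := true) (c := true)).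
have pe : gr_parity false (1 + r * r') by apply: gr_parityD => //; exact: gr_parity1.
have ue : 1 + r * r' \is a GRing.unit.
  by rewrite gr_unitE gr_bodyD gr_body1 gr_bodyM (gr_body_odd ro) mul0r addr0 oner_neq0.
have gg : GL11 (mx2 (1 + r * r') 0 0 1).
  by apply: GL11_upper; rewrite ?unitr1 //; [apply: gr_parity0|apply: gr_parity1].
have := BER_point gg (spoint_emb Uy); rewrite Ber_upper invr1 mulr1.
have -> : frame_point (mx2 (1 + r * r') 0 0 1 *m frame_of (emb y)) =
    fun c => emb y c + r * dir 0 (fun A => r' * emb y (frame_coord 0 A)) c.
  have [h1 h2 h3 h4] := mx2E (1 + r * r') 0 0 1.
  apply: eq_point => A; rewrite frame_pointE mulmx2 !dirE ?(h1, h2, h3, h4).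
    by rewrite !mxE mul0r addr0 mulrDl mul1r mulrA.
  by rewrite !mxE mul1r mul0r mulr0 add0r addr0.
rewrite gr_eval_dir // => [|A]; last first.
  have := gr_parityM ro' (@emb_parity y (frame_coord 0 A)).
  by rewrite codd_frame.
rewrite mulrDr mulr1 => /addrI.
under eq_bigr => A _ do rewrite -mulrA.
rewrite -mulr_sumr gr_eval_emb_sum // -/S gr_eval_emb -[RHS](gr_even_comm _ rre).
rewrite -[S - L y]addrC -scaleN1r gr_subst_linear scaleN1r !mulrDr !mulrN.
by move=> ->; rewrite mulrA addrC subrr.
Qed.

(** The body of the action of diag(t, 1), which scales the row x. *)
Definition xscale (t : R) (y : 'rV[R]_(n + m)) : 'rV[R]_(n + m) :=
  \row_k (if fintype.split k is inl _ then t * y 0 k else y 0 k).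

Definition xodd (j : 'I_(m + n)) : nat := if fintype.split j is inl _ then 1%N else 0%N.
(** The degree in x of the monomial on I: the first m odd coordinates are those
    of x. *)
Definition xdeg (I : {set 'I_(m + n)}) : nat := \sum_(j <- enum I) xodd j.

Lemma xscale_nondegenerate t y : U y -> U (xscale t y).
Proof. by move=> [mu ymu]; exists mu; rewrite mxE (unsplitK (inr _ mu)). Qed.

Lemma oprod_scale (a : 'I_q -> R) (s : seq 'I_q) :
  \prod_(j <- s) (a j *: gr_gen R j) = (\prod_(j <- s) a j) *: \prod_(j <- s) gr_gen R j.
Proof.
elim: s => [|j s IH]; first by rewrite !big_nil scale1r.
by rewrite !big_cons IH -scalerAl -scalerAr scalerA.
Qed.

(** BER for diag(t, 1) with t real, one coefficient at a time. *)
Lemma BER_homog (t : R) y (I : {set 'I_q}) : t != 0 -> U y ->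
  L (xscale t y) I * t ^+ xdeg I = t * L y I.
Proof.
move=> t0 Uy; have sy := @spoint_gen_point R (n + m) q U y Uy.
have ut : (t%:A : grassmann R q) \is a GRing.unit by rewrite gr_unitE gr_body_alg.
have gg : GL11 (mx2 (t%:A : grassmann R q) 0 0 1).
  apply: GL11_upper; rewrite ?unitr1 //; first exact: gr_parity_alg.
    exact: gr_parity0.
  exact: gr_parity1.
have := BER_point gg sy; rewrite Ber_upper invr1 mulr1 gr_eval_gen_point gr_Malg.
pose eps (j : 'I_q) : grassmann R q := t ^+ xodd j *: gr_gen R j.
have -> : frame_point (mx2 t%:A 0 0 1 *m frame_of (gpt (@gr_gen R q) y)) = gpt eps (xscale t y).
  have [h1 h2 h3 h4] := mx2E (t%:A : grassmann R q) 0 0 1.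
  apply: eq_point => A; rewrite frame_pointE mulmx2 ?(h1, h2, h3, h4) mul0r !mxE.
    rewrite addr0 gr_algM; case: (fintype.splitP A) => i E.
      have -> : A = lshift m i by apply: val_inj.
      by rewrite frame_coord_lshift /= mxE (unsplitK (inl _ i)) scalerA.
    have -> : A = rshift n i by apply: val_inj.
    by rewrite frame_coord_rshift /= /eps /xodd (unsplitK (inl _ i)).
  rewrite add0r mul1r; case: (fintype.splitP A) => i E.
    have -> : A = lshift m i by apply: val_inj.
    by rewrite frame_coord_lshift /= /eps /xodd (unsplitK (inr _ i)) scale1r.
  have -> : A = rshift n i by apply: val_inj.
  by rewrite frame_coord_rshift /= mxE (unsplitK (inr _ i)).
rewrite gr_eval_gpt => /ffunP /(_ I); rewrite gr_scaleE => <-.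
rewrite /gr_subst sum_ffunE (bigD1 I) //= [X in _ + X]big1 ?addr0 => [|J JI].
  rewrite gr_scaleE oprod_enum /oprod oprod_scale -/(oprod (@gr_gen R q) _).
  rewrite -oprod_enum -gr_monoE gr_scaleE ffunE eqxx mulr1; congr (_ * _).
  by rewrite /xdeg; elim: (enum I) => [|j s IH]; rewrite ?big_nil // !big_cons exprD IH.
rewrite gr_scaleE oprod_enum /oprod oprod_scale -/(oprod (@gr_gen R q) _).
by rewrite -oprod_enum -gr_monoE gr_scaleE ffunE eq_sym (negPf JI) !mulr0.
Qed.

Definition xweight (t : R) (k : 'I_(n + m)) : R :=
  if fintype.split k is inl _ then t else 1.

Lemma xscaleE t y k : xscale t y 0 k = xweight t k * y 0 k.
Proof. by rewrite mxE /xweight; case: fintype.split; rewrite ?mul1r. Qed.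

Lemma Cinf_xscale t k : Cinf U (fun y => xscale t y 0 k).
Proof.
apply: (@Cinf_congr _ _ _ oU (fun y => xweight t k * y 0 k)).
  by move=> y _; rewrite xscaleE.
exact: (CinfM oU (Cinf_cst U _) (Cinf_coord U k)).
Qed.

Lemma pderiv_xscale t k h y : Cinf U h -> U y ->
  pderiv k (h \o xscale t) y = xweight t k * pderiv k h (xscale t y).
Proof.
move=> Ch Uy.
have UU x : U x -> U (xscale t x) by exact: xscale_nondegenerate.
have Cx l := Cinf_xscale t l 1%N.
rewrite (pderiv_comp k oU (Ch 1%N) UU Cx Uy).
have E l : pderiv k (fun y => xscale t y 0 l) y = xweight t l * (k == l)%:R.
  rewrite -(pderiv_coord k l y) -(pderivZ k _ (Cinf_coord U l) Uy).
  by congr (pderiv _ _ _); apply/funext => x; rewrite xscaleE.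
under eq_bigr => l _ do rewrite E.
rewrite (bigD1 k) //= big1 ?addr0 ?eqxx ?mulr1 1?mulrC // => l /negPf lk.
by rewrite eq_sym lk !mulr0.
Qed.

Lemma xscale_continuous y : {for 0, continuous (fun t : R => xscale t y)}.
Proof.
rewrite /prop_for /continuous_at; apply/(@cvgrPdist_le R 'rV[R]_(n + m) R (nbhs (0 : R))) => e e0.
have d0 : 0 < e / (`|y| + 1) by rewrite divr_gt0 // ltr_wpDl.
have : \forall t \near (0 : R), `|t| <= e / (`|y| + 1).
  by apply/nbhs_ballP; exists (e / (`|y| + 1)) => //= t;
    rewrite /ball /= sub0r normrN => /ltW.
apply: filterS => t lt; apply: norm_rV_le; first exact: ltW.
move=> k; rewrite !mxE; case: fintype.split => i; last by rewrite subrr normr0 ltW.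
rewrite mul0r sub0r normrN normrM.
have := ler_pM (normr_ge0 _) (normr_ge0 _) lt (norm_coord y k) => /le_trans; apply.
rewrite mulrAC ler_pdivrMr ?ltr_wpDl //; apply: ler_wpM2l; first exact: ltW.
by rewrite lerDl.
Qed.

(** Let t tend to 0: homogeneity of degree -e extends to t = 0 by continuity,
    because x = 0 is allowed in a frame. *)
Lemma homog_limit (h : 'rV[R]_(n + m) -> R) e y : U y -> Cinf U h ->
  (forall t, t != 0 -> h (xscale t y) * t ^+ e = h y) ->
  h y = (e == 0)%N%:R * h (xscale 0 y).
Proof.
move=> Uy Ch H; pose k (t : R) := h (xscale t y) * t ^+ e.
have ck : {for 0, continuous k}.
  apply: (@continuousM R _ (fun t : R => h (xscale t y)) (fun t => t ^+ e)).
    apply: continuous_comp; first exact: xscale_continuous.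
    exact: Ck_continuous (Ch 0%N) (xscale_nondegenerate 0 Uy).
  exact: exprn_continuous.
have k0 : k 0 = h y.
  have lk : k t @[t --> 0^'] --> k 0 by move/continuous_withinNx : ck.
  have lh : k t @[t --> 0^'] --> h y.
    apply: cvg_near_cst.
    have : \forall t \near (0 : R)^', t != 0 by exact: nbhs_dnbhs_neq.
    by apply: filterS => t t0; apply: H.
  exact: cvg_unique lk lh.
by rewrite -k0 /k expr0n mulrC.
Qed.

Lemma xdegU1 (j : 'I_q) (I : {set 'I_q}) : j \notin I ->
  xdeg (j |: I)%SET = (xodd j + xdeg I)%N.
Proof.
by move=> jI; rewrite /xdeg !big_enum big_setU1.
Qed.

Lemma xdegS (j : 'I_q) (I : {set 'I_q}) : j \in I -> (xodd j <= xdeg I)%N.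
Proof.
by move=> jI; rewrite /xdeg big_enum (bigD1 j) //= leq_addr.
Qed.

Local Notation dx A := (sderiv (@frame_coord n m 0 A) L).

Lemma smooth_dx A : smooth U (dx A).
Proof. exact: (smooth_sderiv oU). Qed.

(** The derivative of L along x is homogeneous of degree 0 in x, so by
    [homog_limit] it only depends on w.  The coefficients that involve odd
    coordinates of x have negative degree in the even ones and vanish. *)
Lemma dx_const A I y : U y ->
  dx A y I = (xdeg I == 0)%N%:R * dx A (xscale 0 y) I.
Proof.
move=> Uy; apply: (@homog_limit (fun y => dx A y I) _ _ Uy (@smooth_dx A I)) => t t0.
case: (fintype.splitP A) => i E.
  have -> : A = lshift m i by apply: val_inj.
  rewrite frame_coord_lshift eqxx !sderiv_evenE.
  set k := lshift m i; apply: (mulfI t0).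
  rewrite -(pderivZ k t (sL I) Uy).
  have <- : pderiv k (fun x => t ^+ xdeg I * (fun x => L x I) (xscale t x)) y =
      pderiv k (fun x => t * L x I) y.
    by apply: (pderiv_congr k oU) Uy => x Ux; rewrite mulrC BER_homog.
  have CC : Cinf U ((fun x => L x I) \o xscale t).
    apply: (Cinf_comp oU oU (sL I)) => [x|j]; [exact: xscale_nondegenerate|].
    exact: Cinf_xscale.
  rewrite (pderivZ k _ CC Uy) (pderiv_xscale t k (sL I) Uy).
  have -> : xweight t k = t by rewrite /xweight (unsplitK (inl _ i)).
  by rewrite [RHS]mulrC !mulrA.
have -> : A = rshift n i by apply: val_inj.
rewrite frame_coord_rshift eqxx !sderiv_oddE.
case: ifP => [_|/negbT jI]; first by rewrite mul0r.
rewrite -mulrA; congr (_ * _); apply: (mulfI t0).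
have := BER_homog (lshift n i |: I)%SET t0 Uy; rewrite xdegU1 //.
rewrite /xodd (unsplitK (inl _ i)) exprD expr1 => <-.
by rewrite mulrCA.
Qed.

Lemma dxdx0 A B y : U y -> sderiv (frame_coord 0 B) (dx A) y = 0.
Proof.
move=> Uy; apply/ffunP => I; rewrite [RHS]ffunE.
case: (fintype.splitP B) => i E.
  have -> : B = lshift m i by apply: val_inj.
  rewrite frame_coord_lshift eqxx sderiv_evenE.
  set k := lshift m i; set c := (xdeg I == 0)%N%:R : R.
  have -> : pderiv k (fun x => dx A x I) y =
      pderiv k (fun x => c * ((fun x => dx A x I) \o xscale 0) x) y.
    by apply: (pderiv_congr k oU) Uy => x Ux; apply: dx_const.
  have CC : Cinf U ((fun x => dx A x I) \o xscale 0).
    apply: (Cinf_comp oU oU (@smooth_dx A I)) => [x|j]; [exact: xscale_nondegenerate|].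
    exact: Cinf_xscale.
  rewrite (pderivZ k c CC Uy) (pderiv_xscale 0 k (@smooth_dx A I) Uy).
  have -> : xweight 0 k = 0 by rewrite /xweight (unsplitK (inl _ i)).
  by rewrite mul0r mulr0.
have -> : B = rshift n i by apply: val_inj.
rewrite frame_coord_rshift eqxx sderiv_oddE; case: ifP => // /negbT jI.
rewrite dx_const //.
have /negPf -> : xdeg (lshift n i |: I)%SET != 0%N.
  by rewrite xdegU1 // /xodd (unsplitK (inl _ i)).
by rewrite mul0r mulr0.
Qed.

(** For two derivatives along x this is [dxdx0], and for two derivatives along w
    the two terms of the equation cancel.  The mixed equation is [BER_D]
    differentiated twice along x, where [dxdx0] removes the third derivatives. *)
Lemma BER_imp_PDE : PDE L.
Proof.
pose F A := sderiv (@frame_coord n m 1 A) L.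
have sF A : smooth U (F A) by exact: (smooth_sderiv oU).
have codd0 A : codd (@frame_coord n m 0 A) = idx_parity A by rewrite codd_frame.
have codd1 A : codd (@frame_coord n m 1 A) = ~~ idx_parity A by rewrite codd_frame.
(* The derivative along x^B of BER_D. *)
have D1 B y : U y -> F B y + \sum_A (-1) ^+ (idx_parity B && idx_parity A) *:
    (coordf (frame_coord 0 A) y * sderiv (frame_coord 0 B) (F A) y) = 0.
  move=> Uy; rewrite -[RHS](@sderiv0 R _ _ (frame_coord 0 B) y).
  rewrite -(sderiv_congr oU (frame_coord 0 B) (fun x Ux => BER_D Ux) Uy).
  rewrite (sderiv_sum oU) //; last first.
    move=> A _; exact: (smoothM oU (smooth_coordf oU (frame_coord 0 A)) (sF A)).
  under [RHS]eq_bigr => A _ do rewrite (sderiv_coordfM _ _ (sF A) Uy) !codd0 (frame_coord_inj R) eqxx andTb.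
  rewrite big_split /=; congr (_ + _).
  rewrite (bigD1 B) //= eqxx scale1r big1 ?addr0 // => A AB.
  by rewrite eq_sym (negPf AB) scale0r.
have third A B C y : U y ->
    sderiv (frame_coord 0 C) (sderiv (frame_coord 0 B) (F A)) y = 0.
  move=> Uy.
  have E x : U x -> sderiv (frame_coord 0 B) (F A) x =
      (-1) ^+ (idx_parity B && ~~ idx_parity A) *: sderiv (frame_coord 1 A) (dx B) x.
    by move=> Ux; rewrite /F (sderivC oU (frame_coord 0 B) (frame_coord 1 A) sL Ux) codd0 codd1.
  rewrite (sderiv_congr oU _ E Uy) (sderiv_sign _ _ _ Uy); last first.
    exact/(smooth_sderiv oU)/smooth_dx.
  rewrite (sderivC oU (frame_coord 0 C) (frame_coord 1 A) (@smooth_dx B) Uy).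
  rewrite (sderiv_congr oU _ (fun x Ux => @dxdx0 B C x Ux) Uy) sderiv0.
  by rewrite !scaler0.
(* The derivative along x^C of D1; the sum is reduced to its term A = C. *)
have D2 B C y : U y -> sderiv (frame_coord 0 C) (F B) y +
    (-1) ^+ (idx_parity B && idx_parity C) *: sderiv (frame_coord 0 B) (F C) y = 0.
  move=> Uy; rewrite -[RHS](@sderiv0 R _ _ (frame_coord 0 C) y).
  rewrite -(sderiv_congr oU (frame_coord 0 C) (D1 B) Uy).
  have sG A : smooth U (sderiv (frame_coord 0 B) (F A)) by exact: (smooth_sderiv oU).
  have sH A : smooth U (fun x => coordf (frame_coord 0 A) x * sderiv (frame_coord 0 B) (F A) x).
    exact: (smoothM oU (smooth_coordf oU (frame_coord 0 A)) (sG A)).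
  have sK A : smooth U (fun x => (-1) ^+ (idx_parity B && idx_parity A) *:
      (coordf (frame_coord 0 A) x * sderiv (frame_coord 0 B) (F A) x)).
    apply: (smooth_congr oU _ (smoothM oU (smooth_cst U ((-1) ^+ (idx_parity B && idx_parity A))%:A) (sH A))).
    by move=> x _; rewrite gr_algM.
  rewrite (sderivD oU) //; last exact: (smooth_sum oU).
  congr (_ + _); rewrite (sderiv_sum oU) //.
  under [RHS]eq_bigr => A _ do
    rewrite (sderiv_sign _ _ (sH A) Uy) (sderiv_coordfM _ _ (sG A) Uy) third // mulr0 scaler0 addr0
      (frame_coord_inj R) eqxx andTb.
  rewrite (bigD1 C) //= eqxx scale1r big1 ?addr0 // => A AC.
  by rewrite eq_sym (negPf AC) scale0r scaler0.
have D3 A B y : U y -> sderiv (frame_coord 0 A) (F B) y +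
    (-1) ^+ idx_parity B *: sderiv (frame_coord 1 A) (dx B) y = 0.
  move=> Uy; rewrite -[RHS](D2 B A y Uy); congr (_ + _).
  rewrite /F (sderivC oU (frame_coord 1 A) (frame_coord 0 B) sL Uy) codd0 codd1 scalerA -exprD; congr (_ *: _).
  by case: (idx_parity A); case: (idx_parity B); rewrite //= expr2 mulN1r opprK.
move=> A B G H y Uy; case: (ord2P G) => ->; case: (ord2P H) => ->.
- by rewrite (@dxdx0 B A y Uy) !add0r scaler0.
- rewrite [X in (-1) ^+ X](_ : _ = idx_parity B :> nat); last by case: (idx_parity B).
  exact: D3.
- rewrite [X in (-1) ^+ X](_ : _ = idx_parity B :> nat); last by case: (idx_parity B).
  have := congr1 (fun x => (-1) ^+ idx_parity B *: x) (D3 A B y Uy).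
  rewrite scalerDr scalerA -expr2 sqrr_sign scale1r scaler0 => E.
  by rewrite -[RHS]E addrC.
- rewrite [X in (-1) ^+ X](_ : _ = 1 + 2 * idx_parity B :> nat)%N; last by case: (idx_parity B).
  by rewrite exprD exprM sqrrN expr1n expr1n mulr1 expr1 scaleN1r subrr.
Qed.

End BerConsequences.

(** * Restriction of a function of frames to the normalised frames *)

Section ChartBody.
Variables (R : realType) (n m : nat).

(** The even coordinates of [chart_frame] at even base coordinates u and even
    differentials v. *)
Definition hbody (mu : 'I_m) (u : 'rV[R]_m.-1) (v : 'rV[R]_n) : 'rV[R]_(n + m) :=
  \row_k match fintype.split k with inl a => v 0 a | inr nu => homog mu u nu end.

Lemma homog_self (mu : 'I_m) (u : 'rV[R]_m.-1) : homog mu u mu = 1.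
Proof. by rewrite /homog unlift_none. Qed.

Lemma hbody_nondegenerate mu u v : @nondegenerate_frames R n m (hbody mu u v).
Proof. by exists mu; rewrite mxE (unsplitK (inr _ mu)) homog_self oner_neq0. Qed.

Lemma chart_frame_lshift N mu (z : 'I_(m.-1 + n) + 'I_(n + m.-1) -> grassmann R N) a :
  chart_frame mu z 0 (lshift m a) = z (diff_idx (inr a)) /\
  chart_frame mu z 1 (lshift m a) = z (base_coord (inr a)).
Proof. exact: (chart_frame_home mu z (inr a)). Qed.

Lemma chart_frame_rshift N mu (z : 'I_(m.-1 + n) + 'I_(n + m.-1) -> grassmann R N) nu :
  chart_frame mu z 0 (rshift n nu) =
    (if unlift mu nu is Some k then z (diff_idx (inl k)) else 0) /\
  chart_frame mu z 1 (rshift n nu) =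
    (if unlift mu nu is Some k then z (base_coord (inl k)) else 1).
Proof.
by split; rewrite mxE /chart_idx (unsplitK (inr _ nu)); case: unlift.
Qed.

Lemma frame_point_body N mu (z : 'I_(m.-1 + n) + 'I_(n + m.-1) -> grassmann R N)
    (u : 'rV[R]_m.-1) (v : 'rV[R]_n) k :
  (forall i, z (base_coord (inl i)) = (u 0 i)%:A) ->
  (forall a, z (diff_idx (inr a)) = (v 0 a)%:A) ->
  frame_point (chart_frame mu z) (inl k) = (hbody mu u v 0 k)%:A.
Proof.
move=> zu zv; rewrite mxE /=; case: (fintype.split k) => i.
  by rewrite (chart_frame_lshift mu z i).1 zv.
rewrite (chart_frame_rshift mu z i).2 /homog; case: unlift => [j|]; first exact: zu.
by rewrite scale1r.
Qed.

Lemma Cinf_hbody p (V : set 'rV[R]_p) mu (u : 'rV[R]_p -> 'rV[R]_m.-1)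
    (v : 'rV[R]_p -> 'rV[R]_n) :
  (forall i, Cinf V (fun y => u y 0 i)) -> (forall a, Cinf V (fun y => v y 0 a)) ->
  open V -> forall k, Cinf V (fun y => hbody mu (u y) (v y) 0 k).
Proof.
move=> Cu Cv oV k.
case E: (fintype.split k) => [a|nu].
  by apply: (Cinf_congr oV _ (Cv a)) => y _; rewrite mxE E.
case E': (unlift mu nu) => [i|].
  by apply: (Cinf_congr oV _ (Cu i)) => y _; rewrite mxE E /homog E'.
by apply: (Cinf_congr oV _ (Cinf_cst V 1)) => y _; rewrite mxE E /homog E'.
Qed.

Section ChartFamily.
Variables (p q : nat) (V : set 'rV[R]_p) (mu : 'I_m).
Variable zf : 'rV[R]_p -> 'I_(m.-1 + n) + 'I_(n + m.-1) -> grassmann R q.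
Hypothesis oV : open V.

Lemma smooth_chart_family c : (forall d, smooth V (fun y => zf y d)) ->
  smooth V (fun y => frame_point (chart_frame mu (zf y)) c).
Proof.
move=> sz; have [F [A ->]] := frame_coord_surj c.
apply: (smooth_congr (f := fun y => chart_frame mu (zf y) F A) oV) => [y _|].
  by rewrite frame_pointE.
case: (home_or_pole mu A) => [->|[d ->]]; case: (ord2P F) => ->.
- apply: (smooth_congr oV _ (smooth_cst V 0)) => y _.
  by rewrite (chart_frame_pole mu _).1.
- apply: (smooth_congr oV _ (smooth_cst V 1)) => y _.
  by rewrite (chart_frame_pole mu _).2.
- apply: (smooth_congr oV _ (sz (diff_idx d))) => y _.
  by rewrite (chart_frame_home mu _ d).1.
- apply: (smooth_congr oV _ (sz (base_coord d))) => y _.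
  by rewrite (chart_frame_home mu _ d).2.
Qed.

(** The entries of a normalised frame are 0, 1 or coordinates. *)
Lemma gr_eval_chart_family N (z : 'I_p + 'I_q -> grassmann R N) z' :
  spoint V z -> (forall d, gr_eval (fun y => zf y d) z = z' d) ->
  forall c, gr_eval (fun y => frame_point (chart_frame mu (zf y)) c) z =
    frame_point (chart_frame mu z') c.
Proof.
move=> sz H c; have [F [A ->]] := frame_coord_surj c; rewrite frame_pointE.
have -> : (fun y => frame_point (chart_frame mu (zf y)) (frame_coord F A))
  = fun y => chart_frame mu (zf y) F A.
  by apply/funext => y; rewrite frame_pointE.
case: (home_or_pole mu A) => [->|[d ->]]; case: (ord2P F) => ->.
- rewrite (chart_frame_pole mu _).1 (_ : (fun y => _) = fun=> 0).
    by rewrite (gr_eval_cst oV _ sz) gr_subst0.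
  by apply/funext => y; rewrite (chart_frame_pole mu _).1.
- rewrite (chart_frame_pole mu _).2 (_ : (fun y => _) = fun=> 1).
    by rewrite (gr_eval_cst oV _ sz) gr_subst1.
  by apply/funext => y; rewrite (chart_frame_pole mu _).2.
- rewrite (chart_frame_home mu _ d).1 -H; congr gr_eval.
  by apply/funext => y; rewrite (chart_frame_home mu _ d).1.
- rewrite (chart_frame_home mu _ d).2 -H; congr gr_eval.
  by apply/funext => y; rewrite (chart_frame_home mu _ d).2.
Qed.

End ChartFamily.

End ChartBody.

Section Forward.
Variables (R : realType) (n m : nat).
Local Notation U := (@nondegenerate_frames R n m).
Local Notation oU := (@open_nondegenerate R n m).
Local Notation p' := (m.-1 + n)%N.
Local Notation q' := (n + m.-1)%N.

(** The coordinates of the normalised frames, as functions on the space of forms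
    over the chart. *)
Definition chart_phi (mu : 'I_m) (c : 'I_(n + m) + 'I_(m + n)) : superfun R p' q' :=
  fun y => frame_point (chart_frame mu (gpt (@gr_gen R q') y)) c.

(** The isomorphism: restriction to the normalised frames over each chart. *)
Definition Phi (L : superfun R (n + m) (m + n)) : proj_forms R n m :=
  fun mu => scomp (chart_phi mu) L.

Definition ubody (mu : 'I_m) (y : 'rV[R]_p') : 'rV[R]_(n + m) :=
  hbody mu (lsubmx y) (rsubmx y).

Lemma chart_phiE mu k y : chart_phi mu (inl k) y = (ubody mu y 0 k)%:A.
Proof. by apply: frame_point_body => i /=; rewrite mxE. Qed.

Lemma Cinf_ubody mu k : Cinf setT (fun y => ubody mu y 0 k).
Proof.
apply: Cinf_hbody openT k; first exact: Cinf_lsubmx.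
move=> a; apply: (Cinf_congr openT _ (Cinf_coord setT (rshift m.-1 a))).
by move=> y _; rewrite mxE.
Qed.

Lemma smooth_chart_phi mu j : smooth setT (chart_phi mu (inr j)).
Proof.
apply: (smooth_chart_family mu openT) => d.
exact: (smooth_coordf openT d).
Qed.

Lemma gr_eval_chart mu N (z : 'I_p' + 'I_q' -> grassmann R N) c :
  spoint setT z -> gr_eval (chart_phi mu c) z = frame_point (chart_frame mu z) c.
Proof.
move=> sz; apply: (gr_eval_chart_family mu openT sz) => d.
exact: (gr_eval_coordf openT d sz).
Qed.

Lemma smooth_Phi L mu : smooth U L -> smooth setT (Phi L mu).
Proof.
move=> sL; apply: (smooth_scomp openT oU (chart_phiE mu) (Cinf_ubody mu)) sL.
  by move=> y _; apply: hbody_nondegenerate.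
exact: smooth_chart_phi.
Qed.

Lemma gr_eval_Phi L mu N (z : 'I_p' + 'I_q' -> grassmann R N) :
  spoint setT z -> smooth U L ->
  gr_eval (Phi L mu) z = gr_eval L (frame_point (chart_frame mu z)).
Proof.
move=> sz sL; rewrite (gr_eval_scomp openT oU (chart_phiE mu) (Cinf_ubody mu) _
  (@smooth_chart_phi mu) sz sL); last by move=> y _; apply: hbody_nondegenerate.
by congr gr_eval; apply/funext => c; apply: gr_eval_chart.
Qed.

Lemma Phi_linear (a : R) u v : Phi (a *: u + v) = a *: Phi u + Phi v.
Proof.
apply/funext => mu; apply/funext => y.
rewrite /Phi (scompE (chart_phiE mu)).
have -> : (a *: (fun mu => scomp (chart_phi mu) u : superfun R p' q') +
   (fun mu => scomp (chart_phi mu) v : superfun R p' q')) mu y =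
   a *: scomp (chart_phi mu) u y + scomp (chart_phi mu) v y by [].
rewrite !(scompE (chart_phiE mu)) scaler_sumr -big_split; apply: eq_bigr => J _ /=.
rewrite scalerAl -mulrDl; congr (_ * _).
by rewrite scalerA -scalerDl ffunE gr_scaleE.
Qed.

Lemma Phi_parity b L : superfun_parity b L -> proj_forms_parity b (Phi L).
Proof.
move=> pL mu y; apply: gr_parity_eval pL.
by apply: spoint_frame; apply: is_frame_chart; apply: spoint_gen_point.
Qed.

Section WithBER.
Variable L : superfun R (n + m) (m + n).
Hypotheses (sL : smooth U L) (bL : BER L).

(** Normalised frames are preserved when r x is added to w, as x^mu = 0.  The
    Berezinian of this change is 1, and on the chart it is the flow of d
    ([form_shift]). *)
Lemma Phi_closed mu y : deRham (Phi L mu) y = 0.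
Proof.
apply: extra1_inj; set r := extra R q' 0.
have ro : gr_parity true r by apply: extra_odd.
set z := gpt (@emb_gen R q') y.
have sz : spoint setT z by apply: spoint_gpt => // j; apply: emb_gen_odd.
rewrite -gr_eval_gpt.
have := form_shift sz (smooth_Phi mu sL) ro.
set z' := fpoint _ _.
have E : chart_frame mu z' = mx2 1 0 r 1 *m chart_frame mu z.
  have [h1 h2 h3 h4] := mx2E 1 0 r 1.
  apply: mx2_eq => A; rewrite mulmx2 ?(h1, h2, h3, h4);
    case: (home_or_pole mu A) => [->|[c ->]].
  - by rewrite !(chart_frame_pole mu _).1 mulr0 mul0r addr0.
  - by rewrite !(chart_frame_home mu _ c).1 mul1r mul0r addr0 /z' fpoint_diff.
  - by rewrite !(chart_frame_pole mu _).1 !(chart_frame_pole mu _).2 mulr0 add0r mul1r.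
  - rewrite !(chart_frame_home mu _ c).1 !(chart_frame_home mu _ c).2 /z' fpoint_base.
    by rewrite mul1r addrC.
have sz' : spoint setT z'.
  have := spoint_chart mu (is_frame_mul (GL11_lower ro) (is_frame_chart mu sz)).
  by rewrite -E chart_frameK.
rewrite (gr_eval_Phi mu sz' sL) E (bL (GL11_lower ro) (is_frame_chart mu sz)).
rewrite Ber_lower mulr1 -(gr_eval_Phi mu sz sL) -{1}[gr_eval _ z]addr0.
by move=> /addrI <-.
Qed.

(** Normalising a frame does not change the value of L, because [norm_mx] has
    Berezinian 1. *)
Lemma BER_psi N (X : 'M[grassmann R N]_(2, n + m)) mu : is_frame X ->
  X 1 (rshift n mu) \is a GRing.unit ->
  gr_eval L (frame_point X) = gr_eval (Phi L mu) (psi mu X).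
Proof.
move=> fX uw; rewrite (gr_eval_Phi mu (spoint_psi fX uw) sL) psiK //.
by rewrite bL ?Ber_norm ?mulr1 //; apply: GL11_norm.
Qed.

End WithBER.
End Forward.

(** * The restriction is linear in the differentials *)

Section OneForm.
Variables (R : realType) (n m : nat).
Local Notation U := (@nondegenerate_frames R n m).
Local Notation oU := (@open_nondegenerate R n m).
Local Notation p' := (m.-1 + n)%N.
Local Notation q' := (n + m.-1)%N.

(** The normalised frames with zero differentials; the derivatives of L along x
    at these frames are the coefficients of the one-form [Phi L]. *)
Definition base_frame_phi (mu : 'I_m) (c : 'I_(n + m) + 'I_(m + n)) : superfun R m.-1 n :=
  fun u => frame_point (chart_frame mu
    (fpoint (gpt (@gr_gen R n) u) (fun=> 0 : grassmann R n))) c.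

Lemma base_frame_phiE mu k u :
  base_frame_phi mu (inl k) u = (hbody mu u (0 : 'rV[R]_n) 0 k)%:A.
Proof.
apply: frame_point_body => i; first by rewrite fpoint_base.
by rewrite fpoint_diff mxE scale0r.
Qed.

Lemma Cinf_base_body mu k : Cinf setT (fun u : 'rV[R]_m.-1 => hbody mu u (0 : 'rV[R]_n) 0 k).
Proof.
apply: (@Cinf_hbody R n m m.-1 setT mu id (fun=> 0)) openT k.
  exact: Cinf_coord.
by move=> a; exact: Cinf_cst.
Qed.

Lemma smooth_base_frame_phi mu j : smooth setT (base_frame_phi mu (inr j)).
Proof.
apply: (smooth_chart_family mu openT) => -[k|k] /=; case: (fintype.split k) => i.
- exact: (smooth_coordf openT (inl i)).
- exact: smooth_cst.
- exact: (smooth_coordf openT (inr i)).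
- exact: smooth_cst.
Qed.

Lemma sum_home (V : nmodType) mu (F : 'I_(n + m) -> V) :
  \sum_A F A = F (rshift n mu) + \sum_c F (home mu c).
Proof.
rewrite big_split_ord big_sumType /= addrC (bigD1_ord mu) //= -addrA; congr (_ + _).
Qed.

Lemma prod0_seq (A : nzRingType) (T : eqType) (s : seq T) (f : T -> A) j :
  j \in s -> f j = 0 -> \prod_(i <- s) f i = 0.
Proof.
move=> + fj; elim: s => // i s IH; rewrite inE big_cons => /orP[/eqP<-|/IH->].
  by rewrite fj mul0r.
by rewrite mulr0.
Qed.

Variable L : superfun R (n + m) (m + n).
Hypotheses (sL : smooth U L) (bL : BER L).
Local Notation dx A := (sderiv (@frame_coord n m 0 A) L).

Lemma spoint_base (y : 'rV[R]_p') :
  spoint setT (fun c => gpt (@gr_gen R q') y (@base_coord m.-1 n c)).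
Proof. by split=> // i; [exact: gr_parity_alg | exact: gr_parity_gen]. Qed.

Lemma base_fun_coef mu A y :
  base_fun (scomp (base_frame_phi mu) (dx A)) y =
  gr_eval (dx A) (frame_point (chart_frame mu
    (fpoint (fun c => gpt (@gr_gen R q') y (base_coord c)) (fun=> 0 : grassmann R q')))).
Proof.
have sdx : smooth U (dx A) by exact: (smooth_sderiv oU).
have UU u : [set: 'rV[R]_m.-1] u -> U (hbody mu u (0 : 'rV[R]_n)).
  by move=> _; apply: hbody_nondegenerate.
rewrite -[LHS]gr_eval_gen_point gr_eval_base_fun; last first.
- exact: (smooth_scomp openT oU (base_frame_phiE mu) (Cinf_base_body mu) UU
    (@smooth_base_frame_phi mu) sdx).
- exact: spoint_gen_point.
rewrite (gr_eval_scomp openT oU (base_frame_phiE mu) (Cinf_base_body mu) UU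
    (@smooth_base_frame_phi mu) (spoint_base y) sdx).
congr gr_eval; apply/funext => c.
apply: (gr_eval_chart_family mu openT (spoint_base y)).
case=> k /=; case: (fintype.split k) => i.
- exact: (gr_eval_coordf openT (inl i) (spoint_base y)).
- by rewrite (gr_eval_cst openT _ (spoint_base y)) gr_subst0.
- exact: (gr_eval_coordf openT (inr i) (spoint_base y)).
- by rewrite (gr_eval_cst openT _ (spoint_base y)) gr_subst0.
Qed.

(** By [dx_const], the derivatives of L along x may be evaluated at x = 0. *)
Lemma gr_eval_dx_base mu A y :
  gr_eval (dx A) (frame_point (chart_frame mu (gpt (@gr_gen R q') y))) =
  gr_eval (dx A) (frame_point (chart_frame mu
    (fpoint (fun c => gpt (@gr_gen R q') y (base_coord c)) (fun=> 0 : grassmann R q')))).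
Proof.
set X := chart_frame mu (gpt _ y); set X0 := chart_frame mu (fpoint _ _).
pose b := ubody mu y; have Ub : U b by apply: hbody_nondegenerate.
have E1 k : frame_point X (inl k) = (b 0 k)%:A by exact: chart_phiE.
have E0 k : frame_point X0 (inl k) = (xscale 0 b 0 k)%:A.
  rewrite (@frame_point_body _ _ _ _ mu _ (lsubmx y) 0) => [|i|a].
  - congr (_ *: _); rewrite xscaleE /b /xweight /ubody !mxE.
    by case: (fintype.split k) => i; rewrite ?mul1r // mul0r mxE.
  - by rewrite fpoint_base /= mxE.
  - by rewrite fpoint_diff mxE scale0r.
rewrite (gr_eval_real _ E1) (gr_eval_real _ E0) /gr_subst; apply: eq_bigr => I _.
rewrite (dx_const sL bL A I Ub) !oprod_enum /oprod.
have [I0|I0] := eqVneq (xdeg I) 0%N.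
  rewrite mul1r; congr (_ *: _); rewrite big_seq [RHS]big_seq; apply: eq_bigr => j.
  rewrite mem_enum => jI; have := xdegS jI; rewrite I0 /xodd /odd_part /=.
  case: (fintype.split j) => // i _.
  by rewrite !(chart_frame_lshift mu _ i).2 fpoint_base.
rewrite mul0r scale0r.
have [j jI jx] : exists2 j, j \in enum I & xodd j != 0%N.
  apply/hasP; apply: contraNT I0 => /hasPn H; rewrite /xdeg big_seq big1 // => j /H.
  by rewrite negbK => /eqP.
rewrite (prod0_seq jI) ?scaler0 //; move: jx; rewrite /xodd /odd_part /=.
case: (fintype.split j) => // i _.
rewrite (chart_frame_rshift mu _ i).1; case: unlift => // k.
by rewrite fpoint_diff.
Qed.

(** Euler's identity [BER_euler] at the normalised frames, where x^mu = 0. *)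
Lemma Phi_one_form mu : one_form (Phi L mu).
Proof.
exists (fun c => scomp (base_frame_phi mu) (dx (home mu c))); split.
  move=> c; apply: (smooth_scomp openT oU (base_frame_phiE mu) (Cinf_base_body mu)).
  - by move=> u _; apply: hbody_nondegenerate.
  - exact: smooth_base_frame_phi.
  - exact: (smooth_sderiv oU).
move=> y; set X := chart_frame mu (gpt (@gr_gen R q') y).
have sX : spoint U (frame_point X).
  by apply/spoint_frame/is_frame_chart/spoint_gen_point.
have sdx A : smooth U (dx A) by exact: (smooth_sderiv oU).
rewrite /Phi /scomp -/(scomp (base_frame_phi mu) _) -[LHS]/(gr_eval L (frame_point X)).
rewrite (gr_eval_congr oU (fun x Ux => BER_euler sL bL Ux) sX).
rewrite (gr_eval_sum oU _ sX); last first.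
  by move=> A _; exact: (smoothM oU (smooth_coordf oU _) (sdx A)).
rewrite (sum_home mu) (gr_evalM oU sX (smooth_coordf oU _) (sdx _)).
rewrite (gr_eval_coordf oU _ sX) frame_pointE (chart_frame_pole mu _).1 mul0r add0r.
apply: eq_bigr => c _.
rewrite (gr_evalM oU sX (smooth_coordf oU _) (sdx _)) (gr_eval_coordf oU _ sX).
rewrite frame_pointE (chart_frame_home mu _ c).1 base_fun_coef gr_eval_dx_base.
by congr (_ * _); case: c.
Qed.

End OneForm.

(** * Normalisation and the change of charts *)

Local Transparent sderiv.

Section DeRhamTensor.
Variables (R : realType) (p q : nat).

Lemma deRham_tensor (V : set 'rV[R]_(p + q)) (H : 'rV[R]_(p + q) -> R)
    (c : grassmann R (q + p)) y : open V -> Cinf V H -> V y ->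
  deRham (stensor H c) y =
    \sum_i (pderiv (lshift q i) H y) *: (gr_gen R (rshift q i) * c) +
    \sum_j (y 0 (rshift p j) * H y) *: gr_deriv (lshift p j) c.
Proof.
move=> oV CH Vy; rewrite /deRham big_sumType; congr (_ + _); apply: eq_bigr => i _.
  rewrite (sderiv_tensor_even oV (lshift q i) c CH Vy) /stensor /=.
  by rewrite -scalerAr.
by rewrite /= gr_derivZ gr_algM scalerA.
Qed.

End DeRhamTensor.

Section Transition.
Variables (R : realType) (n m : nat).
Local Notation U := (@nondegenerate_frames R n m).
Local Notation p' := (m.-1 + n)%N.
Local Notation q' := (n + m.-1)%N.

Lemma gr_algV N (a : R) : a != 0 -> (a%:A : grassmann R N)^-1 = a^-1%:A.
Proof.
move=> a0; apply: (@mulIr _ (a%:A : grassmann R N)).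
  by rewrite gr_unitE gr_body_alg.
by rewrite mulVr ?gr_unitE ?gr_body_alg // gr_algM scalerA mulVf // scale1r.
Qed.

Lemma pderivV p (V : set 'rV[R]_p) (f : 'rV[R]_p -> R) i x :
  Cinf V f -> V x -> f x != 0 ->
  pderiv i (fun x => (f x)^-1) x = - (f x)^-1 * (f x)^-1 * pderiv i f x.
Proof.
move=> Cf Vx f0; have := deriveV f0 (Cinf_derivable (i := i) Cf Vx).
by rewrite expr2 invfM -mulNr.
Qed.

(** The homogeneous coordinate w^nu on the chart mu. *)
Definition hom_fun (mu nu : 'I_m) (y : 'rV[R]_p') : R := homog mu (lsubmx y) nu.

Lemma hom_funE mu nu :
  hom_fun mu nu = if unlift mu nu is Some k then fun y => y 0 (lshift n k) else fun=> 1.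
Proof.
apply/funext => y; rewrite /hom_fun /homog; case: unlift => // k.
by rewrite mxE.
Qed.

Lemma Cinf_hom_fun mu nu (V : set 'rV[R]_p') : Cinf V (hom_fun mu nu).
Proof.
by rewrite hom_funE; case: unlift => [k|]; [exact: Cinf_coord | exact: Cinf_cst].
Qed.

Lemma open_hom_neq0 mu nu : open [set y | hom_fun mu nu y != 0].
Proof.
apply: (@open_comp _ _ (hom_fun mu nu) [set t | t != 0]); last exact: open_neq.
by move=> y _; exact: (Ck_continuous (@Cinf_hom_fun mu nu setT 0%N)).
Qed.

(** The differential of [hom_fun mu nu]. *)
Definition dhom (mu nu : 'I_m) : grassmann R q' :=
  if unlift mu nu is Some k then gr_gen R (rshift n k) else 0.

Lemma sum_dhom mu nu y :
  \sum_i pderiv (lshift n i) (hom_fun mu nu) y *: gr_gen R (rshift n i) = dhom mu nu.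
Proof.
rewrite hom_funE /dhom; case: unlift => [k|]; last first.
  by rewrite big1 // => i _; rewrite pderiv_cst scale0r.
rewrite (bigD1 k) //= pderiv_coord eqxx scale1r big1 ?addr0 // => i ik.
by rewrite pderiv_coord eq_lshift (negPf ik) scale0r.
Qed.

Lemma chart_gen_pole mu nu (y : 'rV[R]_p') :
  chart_frame mu (gpt (@gr_gen R q') y) 0 (rshift n nu) = dhom mu nu /\
  chart_frame mu (gpt (@gr_gen R q') y) 1 (rshift n nu) = (hom_fun mu nu y)%:A.
Proof.
have [-> ->] := chart_frame_rshift mu (gpt (@gr_gen R q') y) nu.
rewrite /dhom hom_funE; case: unlift => //=.
by rewrite scale1r.
Qed.

(** Normalising the pair (w, dw) of the chart mu at w^nu divides w by w^nu and
    applies the quotient rule to dw; these are the transition to the chart nu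
    and the differentials of its coordinates. *)
Lemma tangent_psi mu nu y : hom_fun mu nu y != 0 ->
  tangent_point (@transition R n m mu nu) y =
  psi nu (chart_frame mu (gpt (@gr_gen R q') y)).
Proof.
move=> h0; set X := chart_frame mu _; set phi := @transition R n m mu nu.
have -> : tangent_point phi y =
    fpoint (fun c => base_fun (phi c) y) (fun c => deRham (base_fun (phi c)) y).
  by apply/funext => -[k|k] /=; case: (fintype.split k).
pose V := [set y | hom_fun mu nu y != 0].
have oV : open V by apply: open_hom_neq0.
have [x0 w0] := chart_gen_pole mu nu y; rewrite -/X in x0 w0.
have E1 c : base_fun (phi c) = match c with
    | inl k => stensor (fun y => hom_fun mu (lift nu k) y * (hom_fun mu nu y)^-1) 1
    | inr a => stensor (fun y => (hom_fun mu nu y)^-1) (gr_gen R (lshift m.-1 a)) end.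
  apply/funext => x; rewrite base_funE; case: c => i.
    rewrite /scomp (@gr_eval_real _ _ _ _ _ (lsubmx x)) // gr_substZ gr_subst1.
    by [].
  rewrite /scomp (@gr_eval_real _ _ _ _ _ (lsubmx x)) // gr_substZ gr_subst_gen //.
  by move=> j; apply: gr_parity_gen.
have Ci : Cinf V (fun y => (hom_fun mu nu y)^-1).
  by apply: (CinfV oV) => //; exact: Cinf_hom_fun.
rewrite /psi /chart_point; congr fpoint; apply/funext => c; rewrite E1.
  rewrite (norm_mxE nu X (home nu c)).2 w0 gr_algV // gr_algM; case: c => i.
    rewrite /home (chart_gen_pole mu (lift nu i) y).2 /stensor.
    by rewrite scalerA mulrC.
  by rewrite /home (chart_frame_lshift mu _ i).2.
rewrite (norm_mxE nu X (home nu c)).1 w0 x0 gr_algV // !gr_algM scalerA -!scalerAl.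
case: c => i.
  rewrite /home (chart_gen_pole mu (lift nu i) y).2 (chart_gen_pole mu (lift nu i) y).1.
  set h' := hom_fun mu (lift nu i); set h := hom_fun mu nu.
  have Ch' : Cinf V h' by exact: Cinf_hom_fun.
  have Ch : Cinf V h by exact: Cinf_hom_fun.
  rewrite (deRham_tensor 1 oV (CinfM oV Ch' Ci) h0).
  rewrite [X in _ + X]big1 ?addr0 => [|j _]; last by rewrite gr_deriv1 scaler0.
  rewrite gr_Malg -(sum_dhom mu (lift nu i) y) -(sum_dhom mu nu y).
  rewrite mul1r !scaler_sumr -sumrN -big_split /=; apply: eq_bigr => j _.
  rewrite (pderivM _ Ch' Ci h0) (pderivV _ Ch h0 h0) mulr1 !scalerA -scalerBl.
  congr (_ *: _); rewrite -/h -/h'.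
  by rewrite mulrC !mulNr mulrN; congr (_ - _); rewrite mulrCA !mulrA.
rewrite /home (chart_frame_lshift mu _ i).1 (chart_frame_lshift mu _ i).2.
set h := hom_fun mu nu; have Ch : Cinf V h by exact: Cinf_hom_fun.
rewrite (deRham_tensor _ oV Ci h0) addrC; congr (_ + _).
  rewrite (bigD1 i) //= big1 ?addr0 => [|j ji].
    rewrite -[gr_gen R (lshift m.-1 i)]mulr1 gr_deriv_gen gr_deriv1 mulr0 subr0 eqxx.
    by rewrite scale1r scalerA mulrC.
  rewrite -[gr_gen R (lshift m.-1 i)]mulr1 gr_deriv_gen gr_deriv1 mulr0 subr0.
  by rewrite eq_lshift eq_sym (negPf ji) scale0r scaler0.
rewrite -(sum_dhom mu nu y) mul1r mulr_suml scaler_sumr -sumrN; apply: eq_bigr => j _.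
by rewrite (pderivV _ Ch h0 h0) -scaleNr !mulNr -[in RHS]scalerAl [RHS]scalerA mulNr.
Qed.

Lemma Phi_glues (L : superfun R (n + m) (m + n)) :
  smooth U L -> BER L -> glues (Phi L).
Proof.
move=> sL bL mu nu y h0; rewrite /pullback tangent_psi //.
set X := chart_frame mu _.
have fX : is_frame X by apply/is_frame_chart/spoint_gen_point.
by rewrite -(BER_psi sL bL) // (chart_gen_pole mu nu y).2 gr_unitE gr_body_alg.
Qed.

End Transition.

(** * Lifting a closed form from one chart to frames *)

Section Locality.
Variables (R : realType) (p : nat).
Implicit Types (U V : set 'rV[R]_p).

Lemma Ck_local k U (h : 'rV[R]_p -> R) :
  (forall x, U x -> exists2 V, V x & Ck k V h) -> Ck k U h.
Proof.
elim: k h => [|k IH] h H.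
  by split=> // x /H[V Vx [ch _]]; apply: ch.
split=> [x /H[V Vx [ch _]]|i]; first exact: ch.
split=> [x /H[V Vx [_ dh]]|]; first exact: (dh i).1.
by apply: IH => x /H[V Vx [_ dh]]; exists V => //; exact: (dh i).2.
Qed.

Lemma Cinf_subset U V (h : 'rV[R]_p -> R) : V `<=` U -> Cinf U h -> Cinf V h.
Proof. by move=> VU Ch k; apply: Ck_local => x /VU Ux; exists U. Qed.

Lemma smooth_local q U (f : superfun R p q) :
  (forall x, U x -> exists2 V, V x & smooth V f) -> smooth U f.
Proof. by move=> H I k; apply: Ck_local => x /H[V Vx sf]; exists V. Qed.

Lemma smooth_subset q U V (f : superfun R p q) : V `<=` U -> smooth U f -> smooth V f.
Proof. by move=> VU sf; apply: smooth_local => x /VU Ux; exists U. Qed.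

End Locality.

Section BerezinianCalculus.
Variables (R : realType) (N : nat).
Local Notation G := (grassmann R N).

(** Multiplicativity of the Berezinian for the inverses of the normalising
    matrices, whose Berezinian is 1. *)
Lemma Ber_mul_upper (g : 'M[G]_2) (w x : G) : GL11 g ->
  gr_parity false w -> gr_parity true x -> w \is a GRing.unit ->
  Ber (g *m mx2 w x 0 w) = Ber g.
Proof.
move=> gg pw px uw.
have us := GL11_unit gg; have [pp pq pr ps] := GL11_parity gg.
have gh : GL11 (mx2 w x 0 w) by apply: GL11_upper.
have uS := GL11_unit (GL11_mul gg gh).
rewrite {1}/Ber !mulmx2; have [-> -> -> ->] := mx2E w x 0 w.
move: uS; rewrite mulmx2; have [_ -> _ ->] := mx2E w x 0 w.
rewrite !mulr0 !addr0 /Ber.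
move: us pp pq pr ps; move: (g 0 0) (g 0 1) (g 1 0) (g 1 1) => p q r s us pp pq pr ps.
set S := r * x + s * w => uS.
have rr := gr_odd_sq pr; have psV := gr_parityV ps; have pwV := gr_parityV pw.
have pS : gr_parity false S.
  apply: gr_parityD; first exact: (gr_parityM (b := true) (c := true)).
  exact: (gr_parityM (b := false) (c := false)).
have rS : r * S = r * (s * w) by rewrite mulrDr mulrA rr mul0r add0r.
set t := s^-1 * r.
have pt : gr_parity true t by exact: (gr_parityM (b := false) (c := true)).
have tt : t * t = 0 by exact: gr_odd_sq.
have Srw : S^-1 * (r * w) = t.
  have -> : r * w = S * (r * s^-1).
    rewrite (gr_even_comm _ pS) -mulrA (gr_even_comm S psV) mulrA rS.
    by rewrite (gr_even_comm w ps) mulrA mulrK.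
  by rewrite mulKr // -(gr_even_comm _ psV).
apply: (mulIr uS); rewrite mulrVK // -(mulrA _ S^-1) Srw.
have sS : s^-1 * S = t * x + w by rewrite mulrDr !mulrA mulVr // mul1r.
rewrite -(mulrA q) -/t -mulrA sS mulrBl !mulrDr !mulrDl.
have -> : q * t * (t * x) = 0 by rewrite mulrA -(mulrA q) tt mulr0 mul0r.
rewrite add0r -!mulrA (gr_odd_anticomm px pt) (gr_even_comm t pw) mulrN opprD opprK.
by rewrite addrA (addrC (p * w)) /t -!mulrA.
Qed.

End BerezinianCalculus.

Section Backward.
Variables (R : realType) (n m : nat).
Local Notation U := (@nondegenerate_frames R n m).
Local Notation p' := (m.-1 + n)%N.
Local Notation q' := (n + m.-1)%N.
Local Notation q := (m + n)%N.

Definition pole_set (mu : 'I_m) : set 'rV[R]_(n + m) := [set y | y 0 (rshift n mu) != 0].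

Lemma open_pole_set mu : open (pole_set mu).
Proof. exact: open_coord_neq0. Qed.

Lemma pole_set_sub mu : pole_set mu `<=` U.
Proof. by move=> y ymu; exists mu. Qed.

Lemma spoint_pole N mu (X : 'M[grassmann R N]_(2, n + m)) :
  is_frame X -> X 1 (rshift n mu) \is a GRing.unit -> spoint (pole_set mu) (frame_point X).
Proof.
move=> fX uw; have [ze zo _] := spoint_frame fX; split=> //.
by rewrite /pole_set /= mxE /even_part /= (unsplitK (inr _ mu)) -gr_unitE.
Qed.

Lemma gr_algV0 N (a : R) : (a%:A : grassmann R N)^-1 = a^-1%:A.
Proof.
have [->|] := eqVneq a 0; last exact: gr_algV.
by rewrite scale0r !invr0 scale0r.
Qed.

Lemma psi_base N mu (X : 'M[grassmann R N]_(2, n + m)) c :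
  psi mu X (base_coord c) = (X 1 (rshift n mu))^-1 * X 1 (home mu c).
Proof. by rewrite /psi /chart_point fpoint_base (norm_mxE mu X (home mu c)).2. Qed.

Lemma psi_diff N mu (X : 'M[grassmann R N]_(2, n + m)) c :
  psi mu X (diff_idx c) = (X 1 (rshift n mu))^-1 * X 0 (home mu c) -
    (X 1 (rshift n mu))^-1 * (X 1 (rshift n mu))^-1 * X 0 (rshift n mu) * X 1 (home mu c).
Proof. by rewrite /psi /chart_point fpoint_diff (norm_mxE mu X (home mu c)).1. Qed.

Definition gframe (y : 'rV[R]_(n + m)) : 'M[grassmann R q]_(2, n + m) :=
  frame_of (gpt (@gr_gen R q) y).

Lemma gframeE F A y : gframe y F A = coordf (frame_coord F A) y.
Proof. by rewrite mxE. Qed.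

Lemma is_gframe y : U y -> is_frame (gframe y).
Proof. by move=> Uy; apply: (is_frame_of (U := U)) => //; apply: spoint_gen_point. Qed.

Lemma gframe_pole mu y : gframe y 1 (rshift n mu) = (y 0 (rshift n mu))%:A.
Proof. by rewrite gframeE frame_coord_rshift. Qed.

Lemma gframe_unit mu y : pole_set mu y -> gframe y 1 (rshift n mu) \is a GRing.unit.
Proof. by move=> ymu; rewrite gframe_pole gr_unitE gr_body_alg. Qed.

Section OnPole.
Variable mu : 'I_m.
Local Notation V := (pole_set mu).
Local Notation oV := (@open_pole_set mu).

Definition winv : superfun R (n + m) q := fun y => (gframe y 1 (rshift n mu))^-1.

Lemma winvE y : winv y = (y 0 (rshift n mu))^-1%:A.
Proof. by rewrite /winv gframe_pole gr_algV0. Qed.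

Lemma Cinf_winv : Cinf V (fun y => (y 0 (rshift n mu))^-1).
Proof.
exact: (@CinfV R _ V oV (fun y => y 0 (rshift n mu)) (fun y Vy => Vy) (Cinf_coord V _)).
Qed.

Lemma smooth_winv : smooth V winv.
Proof.
apply: (smooth_congr oV _ (smooth_tensor oV 1 Cinf_winv)) => y _.
by rewrite winvE.
Qed.

Lemma gr_eval_winv N (X : 'M[grassmann R N]_(2, n + m)) :
  is_frame X -> X 1 (rshift n mu) \is a GRing.unit ->
  gr_eval winv (frame_point X) = (X 1 (rshift n mu))^-1.
Proof.
move=> fX uw; have sX := spoint_pole fX uw.
apply: (mulIr uw); rewrite mulVr //.
rewrite -{1}(frame_pointE X 1 (rshift n mu)) -(gr_eval_coordf oV _ sX).
rewrite -(gr_evalM oV sX smooth_winv (smooth_coordf oV _)).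
transitivity (gr_eval (fun=> 1 : grassmann R q) (frame_point X)); last first.
  by rewrite (gr_eval_cst oV _ sX) gr_subst1.
apply: (gr_eval_congr oV) sX => y Vy.
by rewrite /winv -gframeE mulVr // gframe_unit.
Qed.

Definition psi_base_fun (c : 'I_m.-1 + 'I_n) : superfun R (n + m) q :=
  fun y => winv y * coordf (frame_coord 1 (home mu c)) y.

Definition psi_diff_fun (c : 'I_m.-1 + 'I_n) : superfun R (n + m) q :=
  fun y => winv y * coordf (frame_coord 0 (home mu c)) y -
    winv y * winv y * coordf (frame_coord 0 (rshift n mu)) y *
      coordf (frame_coord 1 (home mu c)) y.

Lemma psi_gframe_base c y : psi mu (gframe y) (base_coord c) = psi_base_fun c y.
Proof. by rewrite psi_base /psi_base_fun /winv !gframeE. Qed.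

Lemma psi_gframe_diff c y : psi mu (gframe y) (diff_idx c) = psi_diff_fun c y.
Proof. by rewrite psi_diff /psi_diff_fun /winv !gframeE. Qed.

Lemma smooth_psi_base c : smooth V (psi_base_fun c).
Proof. exact: (smoothM oV smooth_winv (smooth_coordf oV _)). Qed.

Lemma smoothN (f : superfun R (n + m) q) : smooth V f -> smooth V (fun y => - f y).
Proof.
move=> sf; apply: (smooth_congr oV _ (smoothM oV (smooth_cst V (- 1)) sf)) => y _.
by rewrite mulN1r.
Qed.

Lemma smooth_psi_diff c : smooth V (psi_diff_fun c).
Proof.
have sw := smooth_winv; have sc (d : 'I_(n + m) + 'I_q) := smooth_coordf oV d.
have s1 := smoothM oV sw sw.
have s2 := smoothM oV s1 (sc (frame_coord 0 (rshift n mu))).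
have s3 := smoothM oV s2 (sc (frame_coord 1 (home mu c))).
exact: (smoothD oV (smoothM oV sw (sc (frame_coord 0 (home mu c)))) (smoothN s3)).
Qed.

Lemma gr_eval_psi_base N (X : 'M[grassmann R N]_(2, n + m)) c :
  is_frame X -> X 1 (rshift n mu) \is a GRing.unit ->
  gr_eval (psi_base_fun c) (frame_point X) = psi mu X (base_coord c).
Proof.
move=> fX uw; have sX := spoint_pole fX uw.
rewrite (gr_evalM oV sX smooth_winv (smooth_coordf oV _)) gr_eval_winv //.
by rewrite (gr_eval_coordf oV _ sX) frame_pointE psi_base.
Qed.

Lemma gr_evalN N (f : superfun R (n + m) q) (z : _ -> grassmann R N) :
  spoint V z -> smooth V f -> gr_eval (fun y => - f y) z = - gr_eval f z.
Proof.
move=> sz sf; rewrite (gr_eval_congr oV (g := fun y => - 1 * f y)) //.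
  rewrite (gr_evalM oV sz (smooth_cst V _) sf) (gr_eval_cst oV _ sz).
  by rewrite -[- 1]scaleN1r gr_substZ gr_subst1 scaleN1r mulN1r.
by move=> y _; rewrite mulN1r.
Qed.

Lemma gr_eval_psi_diff N (X : 'M[grassmann R N]_(2, n + m)) c :
  is_frame X -> X 1 (rshift n mu) \is a GRing.unit ->
  gr_eval (psi_diff_fun c) (frame_point X) = psi mu X (diff_idx c).
Proof.
move=> fX uw; have sX := spoint_pole fX uw.
have sw := smooth_winv; have sc (d : 'I_(n + m) + 'I_q) := smooth_coordf oV d.
have s1 := smoothM oV sw sw.
have s2 := smoothM oV s1 (sc (frame_coord 0 (rshift n mu))).
have s3 := smoothM oV s2 (sc (frame_coord 1 (home mu c))).
rewrite (gr_evalD oV sX (smoothM oV sw (sc _)) (smoothN s3)) (gr_evalN sX s3).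
rewrite (gr_evalM oV sX sw (sc _)) (gr_evalM oV sX s2 (sc _)).
rewrite (gr_evalM oV sX s1 (sc _)) (gr_evalM oV sX sw sw) gr_eval_winv //.
by rewrite !(gr_eval_coordf oV _ sX) !frame_pointE psi_diff.
Qed.

Definition ratio (y : 'rV[R]_(n + m)) : 'rV[R]_m.-1 :=
  \row_k ((y 0 (rshift n mu))^-1 * y 0 (rshift n (lift mu k))).

Lemma psi_base_funE k y : psi_base_fun (inl k) y = (ratio y 0 k)%:A.
Proof.
by rewrite /psi_base_fun winvE frame_coord_rshift /coordf /= gr_algM scalerA mxE.
Qed.

Lemma Cinf_ratio k : Cinf V (fun y => ratio y 0 k).
Proof.
apply: (Cinf_congr oV _ (CinfM oV Cinf_winv (Cinf_coord V (rshift n (lift mu k))))) => y _.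
by rewrite mxE.
Qed.

(** The pullback of a form on the chart mu to the frames with w^mu invertible. *)
Definition lift_form (w : superfun R p' q') : superfun R (n + m) q :=
  fun y => gr_eval w (psi mu (gframe y)).

Variable w : superfun R p' q'.
Hypothesis w1 : one_form w.

Lemma lift_formE : exists a : 'I_m.-1 + 'I_n -> superfun R m.-1 n,
  [/\ forall c, smooth setT (a c),
      forall y, w y = \sum_(c : 'I_m.-1 + 'I_n) dcoord c y * base_fun (a c) y &
      forall y, V y -> lift_form w y =
        \sum_c psi_diff_fun c y * scomp psi_base_fun (a c) y].
Proof.
have [a [sa wE]] := w1; exists a; split=> // y Vy.
rewrite /lift_form (gr_eval_one_form sa wE); last first.
  by apply: spoint_psi; [apply/is_gframe/(pole_set_sub Vy) | apply: gframe_unit].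
apply: eq_bigr => c _; rewrite psi_gframe_diff /scomp; congr (_ * gr_eval _ _).
by apply/funext => d; rewrite psi_gframe_base.
Qed.

Lemma smooth_scomp_psi (a : superfun R m.-1 n) :
  smooth setT a -> smooth V (scomp psi_base_fun a).
Proof.
move=> sa; apply: (smooth_scomp oV openT psi_base_funE Cinf_ratio (fun x _ => I)) sa.
by move=> j; exact: smooth_psi_base.
Qed.

Lemma smooth_lift_form : smooth V (lift_form w).
Proof.
have [a [sa wE lE]] := lift_formE.
apply: (smooth_congr oV (fun y Vy => esym (lE y Vy))).
apply: (smooth_sum oV) => c _.
exact: (smoothM oV (smooth_psi_diff c) (smooth_scomp_psi (sa c))).
Qed.

Lemma gr_eval_lift_form N (X : 'M[grassmann R N]_(2, n + m)) :
  is_frame X -> X 1 (rshift n mu) \is a GRing.unit ->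
  gr_eval (lift_form w) (frame_point X) = gr_eval w (psi mu X).
Proof.
move=> fX uw; have sX := spoint_pole fX uw.
have [a [sa wE lE]] := lift_formE.
have sA c := smooth_scomp_psi (sa c).
rewrite (gr_eval_congr oV lE sX) (gr_eval_sum oV _ sX); last first.
  by move=> c _; exact: (smoothM oV (smooth_psi_diff c) (sA c)).
rewrite (gr_eval_one_form sa wE (spoint_psi fX uw)); apply: eq_bigr => c _.
rewrite (gr_evalM oV sX (smooth_psi_diff c) (sA c)) gr_eval_psi_diff //.
rewrite (gr_eval_scomp oV openT psi_base_funE Cinf_ratio (fun x _ => I)
  (fun j => smooth_psi_base (inr j)) sX (sa c)).
congr (_ * gr_eval _ _); apply/funext => d.
exact: gr_eval_psi_base.
Qed.

Hypothesis dw0 : forall y, deRham w y = 0.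

(** With X = h X0 and X0 normalised, the second row of g h X0 at mu is the
    invertible lower right entry of g h.  After normalisation the base point of
    X0 has moved by rho times its differential, and the differentials are
    multiplied by Ber (g h) = Ber g.  The form is linear in the differentials
    and, being closed, invariant under the flow of d. *)
Lemma BER_lift_form N (g : 'M[grassmann R N]_2) (X : 'M[grassmann R N]_(2, n + m)) :
  GL11 g -> is_frame X -> X 1 (rshift n mu) \is a GRing.unit ->
  gr_eval (lift_form w) (frame_point (g *m X)) =
  gr_eval (lift_form w) (frame_point X) * Ber g.
Proof.
move=> gg fX uw; have [pw px] := frame_pole_parity mu fX.
set W := X 1 (rshift n mu) in uw pw *; set x := X 0 (rshift n mu) in px *.
(* The inverse of the normalising matrix of X. *)
pose h := mx2 W x 0 W; have gh : GL11 h by apply: GL11_upper.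
pose M := g *m h; have gM : GL11 M by apply: GL11_mul.
pose Z := psi mu X; have sZ : spoint setT Z by apply: spoint_psi.
pose X0 := chart_frame mu Z; have fX0 : is_frame X0 by apply: is_frame_chart.
have [X0p0 X0p1] := chart_frame_pole mu Z; rewrite -/X0 in X0p0 X0p1.
have X0h c : X0 0 (home mu c) = Z (diff_idx c) /\ X0 1 (home mu c) = Z (base_coord c).
  exact: chart_frame_home.
have hX0 : h *m X0 = X.
  rewrite /X0 psiK // mulmxA (_ : h *m _ = 1%:M) ?mul1mx //.
  rewrite /norm_mx mulmx22 -mx2_1; congr mx2.
  - by rewrite mulr0 addr0 divrr.
  - rewrite mulrN !mulrA divrr // mul1r (gr_even_comm _ (gr_parityV pw)).
    by rewrite addrC subrr.
  - by rewrite mul0r mulr0 addr0.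
  - by rewrite mul0r add0r divrr.
have gX : g *m X = M *m X0 by rewrite -mulmxA hX0.
have fgX : is_frame (g *m X) by apply: is_frame_mul.
have uS : M 1 1 \is a GRing.unit by apply: GL11_unit.
have [pM00 pM01 pM10 pM11] := GL11_parity gM.
have E1 : (g *m X) 1 (rshift n mu) = M 1 1 by rewrite gX mulmx2 X0p0 X0p1 mulr0 mulr1 add0r.
have E0 : (g *m X) 0 (rshift n mu) = M 0 1 by rewrite gX mulmx2 X0p0 X0p1 mulr0 mulr1 add0r.
have ugX : (g *m X) 1 (rshift n mu) \is a GRing.unit by rewrite E1.
rewrite !gr_eval_lift_form // -/Z.
have BM : Ber M = Ber g by apply: Ber_mul_upper.
set rho := (M 1 1)^-1 * M 1 0.
have pSV := gr_parityV pM11.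
have pr : gr_parity true rho by exact: (gr_parityM (b := false) (c := true)).
have BE : Ber M = (M 1 1)^-1 * M 0 0 - (M 1 1)^-1 * (M 1 1)^-1 * M 0 1 * M 1 0.
  rewrite /Ber -(gr_even_comm _ pSV) mulrBr; congr (_ - _).
  by rewrite -(gr_even_comm (M 0 1) pSV) !mulrA.
have pB : gr_parity false (Ber g).
  rewrite -BM BE; apply: gr_parityB; first exact: (gr_parityM (b := false) (c := false)).
  apply: (gr_parityM (b := true) (c := true)) => //.
  apply: (gr_parityM (b := false) (c := true)) => //.
  exact: (gr_parityM (b := false) (c := false)).
have -> : psi mu (g *m X) = fpoint (fun c => Z (base_coord c) + rho * Z (diff_idx c))
    (fun c => Ber g * Z (diff_idx c)).
  rewrite -[LHS]fpointE; congr fpoint; apply/funext => c.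
    rewrite psi_base E1 gX (mulmx2 M X0) (X0h c).1 (X0h c).2.
    by rewrite mulrDr !mulrA mulVr // mul1r addrC.
  rewrite psi_diff E1 E0 gX !(mulmx2 M X0) (X0h c).1 (X0h c).2.
  set z0 := Z (diff_idx c); set z1 := Z (base_coord c).
  rewrite -BM BE mulrBl !mulrDr !mulrA opprD addrACA -[RHS]addr0; congr (_ + _).
  have -> : (M 1 1)^-1 * (M 1 1)^-1 * M 0 1 * M 1 1 = (M 1 1)^-1 * M 0 1.
    by rewrite -(mulrA _ (M 0 1)) -(gr_even_comm (M 0 1) pM11) mulrA mulrVK.
  by rewrite subrr.
have sZ' : spoint setT (fpoint (fun c => Z (base_coord c) + rho * Z (diff_idx c))
    (fun c => Z (diff_idx c))).
  have := spoint_chart mu (is_frame_mul (GL11_lower pr) fX0).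
  rewrite (_ : chart_point mu _ = fpoint (fun c => Z (base_coord c) + rho * Z (diff_idx c))
    (fun c => Z (diff_idx c))) //.
  have [h1 h2 h3 h4] := mx2E 1 0 rho 1.
  congr fpoint; apply/funext => c; rewrite mulmx2 ?(h1, h2, h3, h4)
    (X0h c).1 (X0h c).2 ?mul1r ?mul0r ?addr0 //.
  by rewrite addrC.
have [a [sa wE]] := w1.
have scale b d (B : grassmann R N) : gr_parity false B ->
    spoint setT (fpoint b d) ->
    gr_eval w (fpoint b (fun c => B * d c)) = B * gr_eval w (fpoint b d).
  move=> BB [ze zo _].
  rewrite (gr_eval_one_form sa wE); last first.
    split=> // k /=.
      have := ze k => /=; case: (fintype.split k) => // i pd.
      exact: (gr_parityM (b := false) (c := false)).
    have := zo k => /=; case: (fintype.split k) => // i pd.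
    exact: (gr_parityM (b := false) (c := true)).
  rewrite (gr_eval_one_form sa wE); last by split.
  rewrite mulr_sumr; apply: eq_bigr => c _; rewrite !fpoint_diff mulrA; congr (_ * gr_eval _ _).
  by apply/funext => e; rewrite !fpoint_base.
rewrite (scale _ _ _ pB sZ') (form_shift sZ (smooth_one_form w1) pr).
have -> : gr_eval (deRham w) Z = 0.
  rewrite (_ : deRham w = fun=> 0); last exact/funext.
  by rewrite (gr_eval_cst openT _ sZ) gr_subst0.
by rewrite mulr0 addr0 (gr_even_comm _ pB).
Qed.

End OnPole.
End Backward.

(** * The isomorphism *)

Section Isomorphism.
Variables (R : realType) (n m : nat).
Local Notation U := (@nondegenerate_frames R n m).
Local Notation p' := (m.-1 + n)%N.
Local Notation q' := (n + m.-1)%N.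
Local Notation q := (m + n)%N.

Lemma frame_point_gframe (y : 'rV[R]_(n + m)) :
  frame_point (gframe y) = gpt (@gr_gen R q) y.
Proof. exact: frame_point_of. Qed.

Lemma psi_chart_frame N mu (z : 'I_p' + 'I_q' -> grassmann R N) :
  psi mu (chart_frame mu z) = z.
Proof.
have [x0 w1] := chart_frame_pole mu z.
rewrite -[LHS]fpointE -[RHS]fpointE; congr fpoint; apply/funext => c.
  by rewrite psi_base w1 invr1 mul1r (chart_frame_home mu z c).2.
by rewrite psi_diff w1 x0 invr1 !mul1r mul0r subr0 (chart_frame_home mu z c).1.
Qed.

Lemma VZ_eval (L : superfun R (n + m) (m + n)) mu y :
  smooth U L -> BER L -> pole_set mu y ->
  L y = gr_eval (Phi L mu) (psi mu (gframe y)).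
Proof.
move=> sL bL ymu; rewrite -(BER_psi sL bL).
- by rewrite frame_point_gframe gr_eval_gen_point.
- exact/is_gframe/(pole_set_sub ymu).
- exact: gframe_unit.
Qed.

Lemma Phi_inj (L L' : superfun R (n + m) (m + n)) :
  VZ_form L -> VZ_form L' -> Phi L = Phi L' -> L = L'.
Proof.
move=> [sL zL bL _] [sL' zL' bL' _] E; apply/funext => y.
have [[mu ymu]|ny] := pselect (U y); last by rewrite zL // zL'.
by rewrite (VZ_eval sL bL ymu) (VZ_eval sL' bL' ymu) E.
Qed.

Lemma Phi_closed_form (L : superfun R (n + m) (m + n)) :
  VZ_form L -> proj_closed_one_form (Phi L).
Proof.
move=> [sL _ bL _]; split; last by move=> mu y; apply: Phi_closed.
by split; [move=> mu; apply: Phi_one_form | apply: Phi_glues].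
Qed.

Section Surjectivity.
Variable w : proj_forms R n m.
Hypotheses (w1 : forall mu, one_form (w mu)) (gw : glues w)
  (dw : forall mu y, deRham (w mu) y = 0).

Local Notation lift mu := (lift_form mu (w mu)).

Lemma glue_chart mu nu y : hom_fun mu nu y != 0 ->
  w mu y = scomp (chart_phi mu) (lift nu) y.
Proof.
move=> h0; rewrite (@gw mu nu y h0) /pullback tangent_psi // /scomp.
rewrite -gr_eval_lift_form //.
- exact/is_frame_chart/spoint_gen_point.
- by rewrite (chart_gen_pole mu nu y).2 gr_unitE gr_body_alg.
Qed.

(** Gluing expresses [w mu] by the lift of [w nu] at the normalised frames of
    the chart mu ([glue_chart]); the two lifts then agree because BER for the
    second one is applied to an element of Berezinian 1. *)
Lemma lift_form_overlap mu nu y :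
  pole_set mu y -> pole_set nu y -> lift mu y = lift nu y.
Proof.
move=> ymu ynu; set X := gframe y.
have fX : is_frame X by exact/is_gframe/(pole_set_sub ymu).
have umu : X 1 (rshift n mu) \is a GRing.unit by apply: gframe_unit.
have unu : X 1 (rshift n nu) \is a GRing.unit by apply: gframe_unit.
set V := [set y' : 'rV[R]_p' | hom_fun mu nu y' != 0].
have oV : open V by apply: open_hom_neq0.
have sT := spoint_psi fX umu.
have sV : spoint V (psi mu X).
  have [ze zo _] := sT; split=> //; rewrite /V /= hom_funE.
  case E : (unlift mu nu) => [k|]; last exact: oner_neq0.
  have nuE : nu = fintype.lift mu k by case: unliftP E => // j -> [->].
  rewrite mxE /even_part -[inl _]/(base_coord (inl k)) psi_base.
  rewrite gr_bodyM gr_bodyV /home -nuE.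
  by rewrite mulf_neq0 ?invr_eq0 -?gr_unitE.
have sub : V `<=` setT by [].
have uV y' : V y' -> pole_set nu (ubody mu y').
  by move=> Vy'; rewrite /pole_set /= mxE (unsplitK (inr _ nu)).
have sL := smooth_lift_form nu (w1 nu).
rewrite {1}/lift_form -/X (gr_eval_congr oV (@glue_chart mu nu) sV).
rewrite (gr_eval_scomp oV (@open_pole_set R n m nu) (chart_phiE mu)
  (fun k => Cinf_subset sub (Cinf_ubody R mu k)) uV
  (fun j => smooth_subset sub (smooth_chart_phi R mu j)) sV sL).
have -> : (fun c => gr_eval (chart_phi mu c) (psi mu X)) =
    frame_point (norm_mx mu X *m X).
  by apply/funext => c; rewrite gr_eval_chart // psiK.
rewrite (BER_lift_form (w1 nu) (dw nu) (GL11_norm fX umu) fX unu) Ber_norm // mulr1.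
by rewrite frame_point_gframe gr_eval_gen_point.
Qed.

(** By [lift_form_overlap] the choice of the invertible coordinate does not
    matter. *)
Definition glued_lift : superfun R (n + m) (m + n) :=
  fun y => if [pick mu | y 0 (rshift n mu) != 0] is Some mu then lift mu y else 0.

Lemma glued_liftE mu y : pole_set mu y -> glued_lift y = lift mu y.
Proof.
move=> ymu; rewrite /glued_lift; case: pickP => [nu ynu|/(_ mu)].
  exact: lift_form_overlap.
by move: ymu; rewrite /pole_set /= => ->.
Qed.

Lemma smooth_glued_lift : smooth U glued_lift.
Proof.
apply: smooth_local => y [mu ymu]; exists (pole_set mu) => //.
apply: (smooth_congr (@open_pole_set R n m mu) _ (smooth_lift_form mu (w1 mu))) => x xmu.
by rewrite (glued_liftE xmu).
Qed.

Lemma gr_eval_glued_lift N mu (X : 'M[grassmann R N]_(2, n + m)) :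
  is_frame X -> X 1 (rshift n mu) \is a GRing.unit ->
  gr_eval glued_lift (frame_point X) = gr_eval (lift mu) (frame_point X).
Proof.
move=> fX uX.
exact: (gr_eval_congr (@open_pole_set R n m mu) (@glued_liftE mu) (spoint_pole fX uX)).
Qed.

Lemma BER_glued_lift : BER glued_lift.
Proof.
move=> N g X gg fX; have [_ [mu umu]] := fX.
have fgX := is_frame_mul gg fX.
have ugX : (g *m X) 1 (rshift n mu) \is a GRing.unit.
  have [_ _ po _] := GL11_parity gg; have := GL11_unit gg; rewrite !gr_unitE => u11.
  by rewrite mulmx2 gr_bodyD !gr_bodyM (gr_body_odd po) mul0r add0r mulf_neq0.
rewrite (gr_eval_glued_lift fgX ugX) (gr_eval_glued_lift fX umu).
exact: BER_lift_form.
Qed.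

Lemma VZ_glued_lift : VZ_form glued_lift.
Proof.
split.
- exact: smooth_glued_lift.
- move=> y ny; rewrite /glued_lift; case: pickP => // mu ymu.
  by case: ny; exists mu.
- exact: BER_glued_lift.
- exact: (BER_imp_PDE smooth_glued_lift BER_glued_lift).
Qed.

Lemma Phi_glued_lift : Phi glued_lift = w.
Proof.
apply/funext => mu; apply/funext => y; rewrite /Phi /scomp.
set X := chart_frame mu (gpt (@gr_gen R q') y).
have fX : is_frame X by apply/is_frame_chart/spoint_gen_point.
have uX : X 1 (rshift n mu) \is a GRing.unit.
  by rewrite (chart_frame_pole mu _).2 unitr1.
rewrite -[LHS]/(gr_eval glued_lift (frame_point X)).
rewrite (gr_eval_glued_lift fX uX) (gr_eval_lift_form (w1 mu) fX uX).
by rewrite psi_chart_frame gr_eval_gen_point.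
Qed.

End Surjectivity.
End Isomorphism.

Theorem theorem4p2 (R : realType) (n m : nat) :
  super_isomorphic (@superfun_parity R (n + m) (m + n))
    (@proj_forms_parity R n m)
    (@VZ_form R n m) (@proj_closed_one_form R n m).
Proof.
exists (@Phi R n m); split.
- by move=> a u v _ _; apply: Phi_linear.
- split.
  + by move=> L /Phi_closed_form.
  + by move=> L L' /set_mem vL /set_mem vL'; apply: Phi_inj.
  + move=> w [[w1 gw] dw]; exists (glued_lift w); first exact: VZ_glued_lift.
    exact: Phi_glued_lift.
- by move=> b L _; apply: Phi_parity.
Qed.
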